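(* For every $G>0$, $\delta\in(0,G/2)$ and $K_V\ge0$ there is $T'=T'(G,\delta,K_V)>0$ such that for all $T\in(0,T']$, all $(G,\delta)$-equidistributed sequences, all measurable and bounded $V:\mathbb{R}^d\to\mathbb{R}$ with $\lVert V\rVert_\infty\le K_V$ and all $L\in G\mathbb{N}$, the system $$\begin{cases}\partial_tu-\Delta_Lu+V_Lu=0,& u\in L^2([0,T]\times\Lambda_L),\\ u=0,&\text{on }(0,T)\times\partial\Lambda_L,\\ u(0,\cdot)=u_0,& u_0\in L^2(\Lambda_L),\end{cases}$$ is final state observable on the set $W_\delta(L)$ at time $T$ with cost $\kappa_T$ satisfying $$\kappa_T\ \le\ 4a_0b_0\,e^{2c_*/T},$$ where $a_0=(\delta/G)^{-N(1+G^{4/3}\lVert V\rVert_\infty^{2/3})}$, $b_0=e^{2\lVert V\rVert_\infty}$, $c_*\le(\ln(G/\delta))^2\,(NG+4/\ln2)^2$, and $N=N(d)$ is the unique continuation constant described in the context.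
   Context: $d\in\mathbb{N}$ is the dimension; $\Lambda_L=(-L/2,L/2)^d$; $V_L$ is the restriction of $V$ to $\Lambda_L$; $\Delta_L$ here is the Dirichlet Laplacian on $L^2(\Lambda_L)$; $B(x,r)$ is the Euclidean ball with center $x$ and radius $r$. For $G,\delta>0$, a sequence $z_j\in\mathbb{R}^d$, $j\in(G\mathbb{Z})^d$, is called $(G,\delta)$-equidistributed if $B(z_j,\delta)\subset\Lambda_G+j$ for all $j\in(G\mathbb{Z})^d$; correspondingly, for $L\in G\mathbb{N}$, $W_\delta(L)=\bigcup_{j\in(G\mathbb{Z})^d}B(z_j,\delta)\cap\Lambda_L$. The system is called final state observable on an open set $\omega\subset\Lambda_L$ at time $T$ with cost $\kappa_T$ if for every initial state $u_0\in L^2(\Lambda_L)$ the solution $u\in L^2([0,T]\times\Lambda_L)$ satisfies $\lVert u(T,\cdot)\rVert_{L^2(\Lambda_L)}^2\le\kappa_T\lVert u\rVert_{L^2([0,T]\times\omega)}^2$. The constant $N=N(d)$: a constant depending only on $d$ such that for all $\delta\in(0,1/2)$, all $(1,\delta)$-equidistributed sequences, all measurable bounded $V:\mathbb{R}^d\to\mathbb{R}$, all $L\in\mathbb{N}$, all $b\ge0$ and all $\phi\in\mathrm{Ran}(\chi_{(-\infty,b]}(-\Delta_L+V|_{\Lambda_L}))$ one has $\lVert\phi\rVert_{L^2(W_\delta(L))}^2\ge\delta^{N(1+\lVert V\rVert_\infty^{2/3}+\sqrt b)}\lVert\phi\rVert_{L^2(\Lambda_L)}^2$ (for the Laplacian with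 Dirichlet, Neumann or periodic boundary conditions). Such a constant exists. *)

(* Defs.v *)
From HB Require Import structures.
From mathcomp Require Import all_boot all_order all_algebra.
From mathcomp Require Import all_classical all_reals all_analysis.
From mathcomp Require Import complex.

Set Implicit Arguments.
Unset Strict Implicit.
Unset Printing Implicit Defensive.

Import Order.TTheory GRing.Theory Num.Theory.
Import numFieldTopology.Exports numFieldNormedType.Exports.

Local Open Scope classical_set_scope.
Local Open Scope ring_scope.
Local Open Scope complex_scope.

(* R^n is 'rV[R]_n, with the product (= Borel) sigma-algebra, i.e. the one
   generated by the coordinates. *)
Definition rV_display : measure_display.
Proof. exact: default_measure_display. Qed.

Section measurable_rV.
Context {R : realType} {n : nat}.

Let coord : 'I_n -> 'rV[R]_n -> R := fun i x => x ord0 i.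

Let rV_set0 : g_sigma_preimage coord set0.
Proof. exact: sigma_algebra0. Qed.

Let rV_setC A : g_sigma_preimage coord A -> g_sigma_preimage coord (~` A).
Proof. exact: sigma_algebraC. Qed.

Let rV_bigcup (F : (set 'rV[R]_n)^nat) :
  (forall i, g_sigma_preimage coord (F i)) ->
  g_sigma_preimage coord (\bigcup_i F i).
Proof. exact: sigma_algebra_bigcup. Qed.

HB.instance Definition _ := @isMeasurable.Build rV_display
  'rV[R]_n (g_sigma_preimage coord) rV_set0 rV_setC rV_bigcup.

Lemma measurable_coord (i : 'I_n) :
  measurable_fun [set: 'rV[R]_n] (fun x : 'rV[R]_n => x ord0 i).
Proof.
move=> _ Y mY; rewrite setTI; apply: sub_sigma_algebra => /=.
rewrite -bigcup_seq/=; exists i => /=; first by rewrite mem_index_enum.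
by exists Y => //; rewrite setTI.
Qed.

Lemma measurable_fun_rVP d (T : measurableType d) (f : T -> 'rV[R]_n) :
  (forall i, measurable_fun [set: T] (fun t => f t ord0 i)) ->
  measurable_fun [set: T] f.
Proof.
move=> mf.
pose G := \big[setU/set0]_(i < n) preimage_set_system setT (coord i) measurable.
apply: (@measurability _ _ _ _ setT f G) => //.
move=> _ [A + <-]; rewrite /G -bigcup_seq/= => -[i _ [B mB <-]].
by have := mf i measurableT B mB; rewrite !setTI.
Qed.

End measurable_rV.

(* Lebesgue measure on R^n: the n-fold product of lebesgue_measure. *)
Section lebesgue_rV.
Context {R : realType}.

Definition rV_cons n (p : R * 'rV[R]_n) : 'rV[R]_n.+1 :=
  \row_i oapp (fun j => p.2 ord0 j) p.1 (unlift ord0 i).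

Definition rV_uncons n (x : 'rV[R]_n.+1) : R * 'rV[R]_n :=
  (x ord0 ord0, \row_j x ord0 (lift ord0 j)).

Lemma rV_consK n : cancel (@rV_cons n) (@rV_uncons n).
Proof.
case=> a x; rewrite /rV_uncons /rV_cons; congr pair.
  by rewrite mxE unlift_none.
by apply/rowP => j; rewrite !mxE liftK.
Qed.

Lemma measurable_rV_cons n : measurable_fun setT (@rV_cons n).
Proof.
apply: measurable_fun_rVP => i.
case: (unliftP ord0 i) => [j ->|->].
- rewrite (_ : (fun _ => _) = (fun x : 'rV[R]_n => x ord0 j) \o snd).
    by apply: measurableT_comp => //; exact: measurable_coord.
  by apply/funext => p /=; rewrite mxE liftK.
- rewrite (_ : (fun _ => _) = fst) //.
  by apply/funext => p /=; rewrite mxE unlift_none.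
Qed.

Lemma measurable_rV_uncons n : measurable_fun setT (@rV_uncons n).
Proof.
apply: measurable_fun_pair; first exact: measurable_coord.
apply: measurable_fun_rVP => i.
rewrite (_ : (fun _ => _) = (fun x : 'rV[R]_n.+1 => x ord0 (lift ord0 i))).
  exact: measurable_coord.
by apply/funext => x; rewrite mxE.
Qed.

Section cons_measure.
Variables (n : nat) (m : {sigma_finite_measure set 'rV[R]_n -> \bar R}).

Definition cons_measure : set 'rV[R]_n.+1 -> \bar R :=
  pushforward (lebesgue_measure \x m)%E (@rV_cons n).

HB.instance Definition _ := Measure.copy cons_measure
  (measure_function_pushforward__canonical__measure_function_Measure
     (lebesgue_measure \x m)%E (@measurable_rV_cons n)).

Let cons_measure_sigma_finite : sigma_finite setT cons_measure.
Proof.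
have /sigma_finiteP[F [FT ndF Foo]] := sigma_finiteT (@lebesgue_measure R).
have /sigma_finiteP[G [GT ndG Goo]] := sigma_finiteT m.
exists (fun k => @rV_uncons n @^-1` (F k `*` G k)).
  rewrite -preimage_bigcup (_ : \bigcup_i _ = setT) ?preimage_setT//.
  apply/seteqP; split=> // -[x y] _.
  have [[i _ Fx] [j _ Gy]] : (\bigcup_i F i) x /\ (\bigcup_i G i) y.
    by rewrite -FT -GT.
  exists (maxn i j) => //; split => /=.
    by move: x Fx; exact/subsetPset/ndF/leq_maxl.
  by move: y Gy; exact/subsetPset/ndG/leq_maxr.
move=> k; have [mF Fk] := Foo k; have [mG Gk] := Goo k; split.
  rewrite -[X in measurable X]setTI.
  by apply: measurable_rV_uncons => //; exact: measurableX.
rewrite /cons_measure /pushforward -comp_preimage.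
rewrite (_ : _ \o _ = id); last by apply/funext => p; exact: rV_consK.
by rewrite preimage_id product_measure1E// lte_mul_pinfty// ge0_fin_numE.
Qed.

HB.instance Definition _ := Measure_isSigmaFinite.Build _ _ _
  cons_measure cons_measure_sigma_finite.

End cons_measure.

Fixpoint lebesgue_rV (n : nat) : {sigma_finite_measure set 'rV[R]_n -> \bar R} :=
  match n with
  | 0 => \d_(0 : 'rV[R]_0)
  | n'.+1 => cons_measure (lebesgue_rV n')
  end.

End lebesgue_rV.

Section L2.
Context {R : realType} {d : nat}.
Local Notation E := 'rV[R]_d.
Local Notation C := R[i].
Local Notation mu := (lebesgue_rV d : {measure set E -> \bar R}).
Implicit Types (D : set E) (f g : E -> C).

Definition sqmod (z : C) : R := complex.Re z ^+ 2 + complex.Im z ^+ 2.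

Definition sqnorm D f : \bar R := (\int[mu]_(x in D) (sqmod (f x))%:E)%E.

Definition L2 D f : Prop :=
  [/\ measurable_fun D (fun x => complex.Re (f x)),
      measurable_fun D (fun x => complex.Im (f x)) &
      (sqnorm D f < +oo)%E].

Definition eq_L2 D f g : Prop := {ae mu, forall x, D x -> f x = g x}.

Definition inner D f g : C :=
  (\int[mu]_(x in D) complex.Re (f x * (g x)^*)) +i*
  (\int[mu]_(x in D) complex.Im (f x * (g x)^*)).

End L2.

Section dirichlet.
Context {R : realType} {d : nat}.
Local Notation E := 'rV[R]_d.
Local Notation C := R[i].
Implicit Types (D : set E) (f g u v : E -> C).

Definition partial (i : 'I_d) (h : E -> R) : E -> R :=
  fun x => 'D_(delta_mx ord0 i) h x.

Definition smooth (h : E -> R) : Prop :=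
  forall s : seq 'I_d, let h' := foldr partial h s in
    continuous h' /\ forall i x, derivable h' x (delta_mx ord0 i).

Definition partialC (i : 'I_d) f : E -> C := fun x =>
  partial i (fun y => complex.Re (f y)) x +i*
  partial i (fun y => complex.Im (f y)) x.

Definition laplaceC f : E -> C := fun x => \sum_i partialC i (partialC i f) x.

Definition test_function D f : Prop :=
  [/\ smooth (fun x => complex.Re (f x)), smooth (fun x => complex.Im (f x)) &
      exists K, [/\ compact K, K `<=` D & forall x, ~ K x -> f x = 0]].

(* H^1_0(D), the closure of C_c^oo(D) in H^1(D): the functions g i are the weak
   partial derivatives of u. *)
Definition H10 D u : Prop :=
  exists (phi : nat -> E -> C) (g : 'I_d -> E -> C),
    [/\ L2 D u,
        forall i, L2 D (g i),
        forall n, test_function D (phi n),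
        sqnorm D (phi n \- u) @[n --> \oo] --> 0%E &
        forall i, sqnorm D (partialC i (phi n) \- g i) @[n --> \oo] --> 0%E].

(* Graph of the Dirichlet Laplacian on L^2(D): its domain consists of the
   u in H^1_0(D) whose distributional Laplacian v is in L^2(D). *)
Definition dirichlet_laplacian D u v : Prop :=
  [/\ H10 D u, L2 D v &
      forall phi, test_function D phi ->
        inner D u (laplaceC phi) = inner D v phi].

(* Graph of - Delta + V on L^2(D), with Dirichlet boundary conditions. *)
Definition schrodinger D (V : E -> R) u v : Prop :=
  L2 D v /\
  exists2 w, dirichlet_laplacian D u w &
    eq_L2 D v (fun x => - w x + (V x)%:C * u x).

End dirichlet.

Section spectral.
Context {R : realType} {d : nat}.
Local Notation E := 'rV[R]_d.
Local Notation C := R[i].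
Implicit Types (D : set E) (f g : E -> C).

Definition orthogonal_projection D (P : (E -> C) -> (E -> C)) : Prop :=
  [/\ forall f, L2 D f -> L2 D (P f),
      forall (a : C) f g, L2 D f -> L2 D g ->
        eq_L2 D (P (fun x => a * f x + g x)) (fun x => a * P f x + P g x),
      forall f g, L2 D f -> L2 D g -> inner D (P f) g = inner D f (P g) &
      forall f, L2 D f -> eq_L2 D (P (P f)) (P f)].

(* S is the projection-valued spectral measure of the self-adjoint operator on
   L^2(D) with graph H, i.e. H = \int lambda dS(lambda). For f in L^2(D),
   m = <S(.) f, f> = |S(.) f|^2; the operator is determined by its domain
   {f | \int lambda^2 dm < oo} and its form <H f, f> = \int lambda dm. *)
Definition spectral_measure D (H : (E -> C) -> (E -> C) -> Prop)
    (S : set R -> (E -> C) -> (E -> C)) : Prop :=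
  [/\ forall B, measurable B -> orthogonal_projection D (S B),
      forall f, L2 D f -> eq_L2 D (S setT f) f,
      forall A B f, measurable A -> measurable B -> L2 D f ->
        eq_L2 D (S (A `&` B) f) (S A (S B f)) &
      forall f, L2 D f -> exists m : {measure set (measurableTypeR R) -> \bar R},
        [/\ forall B, measurable B -> m B = sqnorm D (S B f),
            (exists g, H f g) <-> (\int[m]_x ((x : R) ^+ 2)%:E < +oo)%E &
            forall g, H f g -> inner D g f = (\int[m]_x (x : R))%:C]].

(* f belongs to Ran chi_(-oo, b] (H). *)
Definition spectral_subspace D H (b : R) f : Prop :=
  L2 D f /\
  exists2 S, spectral_measure D H S & eq_L2 D (S [set` `]-oo, b]] f) f.

End spectral.

Section geometry.
Context {R : realType} {d : nat}.
Local Notation E := 'rV[R]_d.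

(* Lambda_L *)
Definition cube (L : R) : set E :=
  [set x | forall i, - (L / 2) < x ord0 i < L / 2].

Definition eball (x : E) (r : R) : set E :=
  [set y | Num.sqrt (\sum_i (y ord0 i - x ord0 i) ^+ 2) < r].

(* The lattice (G Z)^d is parametrized by Z^d: k stands for j = G k, and
   z k for z_j. *)
Definition lattice_point (G : R) (k : 'rV[int]_d) : E :=
  \row_i (G * (k ord0 i)%:~R).

Definition equidistributed (G delta : R) (z : 'rV[int]_d -> E) : Prop :=
  forall k, eball (z k) delta `<=` [set x | cube G (x - lattice_point G k)].

(* W_delta(L) *)
Definition sensor_set (delta : R) (z : 'rV[int]_d -> E) (L : R) : set E :=
  (\bigcup_k eball (z k) delta) `&` cube L.

Definition bounded_measurable (V : E -> R) : Prop :=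
  measurable_fun setT V /\ exists M : R, forall x, `|V x| <= M.

Definition norm_oo (V : E -> R) : R :=
  fine (Lnorm (lebesgue_rV d : {measure set E -> \bar R}) +oo%E (EFin \o V)).

End geometry.

(* The defining property of the unique continuation constant N(d), for the
   Dirichlet Laplacian. *)
Definition unique_continuation_constant (R : realType) (d : nat) (N : R) : Prop :=
  forall (delta : R), 0 < delta < 1 / 2 ->
  forall z : 'rV[int]_d -> 'rV[R]_d, equidistributed 1 delta z ->
  forall V : 'rV[R]_d -> R, bounded_measurable V ->
  forall n : nat, (0 < n)%N ->
  forall b : R, 0 <= b ->
  forall phi : 'rV[R]_d -> R[i],
    let L := n%:R in
    spectral_subspace (cube L) (schrodinger (cube L) V) b phi ->
    ((delta `^ (N * (1 + norm_oo V `^ (2 / 3) + Num.sqrt b)))%:E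
       * sqnorm (cube L) phi <= sqnorm (sensor_set delta z L) phi)%E.

Section heat.
Context {R : realType} {d : nat}.
Local Notation E := 'rV[R]_d.
Local Notation C := R[i].
Local Notation mu := (lebesgue_rV d : {measure set E -> \bar R}).
Implicit Types (D : set E) (V : E -> R) (u : R -> E -> C).

(* |u|^2 in L^2([0, T] x D) *)
Definition sqnormT (T : R) D u : \bar R :=
  (\int[lebesgue_measure \x lebesgue_rV d]_(p in [set` `[0%R, T]] `*` D)
     (sqmod (u p.1 p.2))%:E)%E.

(* u solves d_t u - Delta u + V u = 0 on (0, T) with values in L^2(D) and
   u(0) = u0, as an abstract Cauchy problem: u is continuous from [0, T] to
   L^2(D) and, at each t in (0, T), has a derivative ut in L^2(D) and lies in
   the domain of the Dirichlet Laplacian (this is the boundary condition). *)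
Definition heat_solution D V (T : R) (u0 : E -> C) u : Prop :=
  [/\ [/\ measurable_fun ([set` `[0, T]] `*` D) (fun p => complex.Re (u p.1 p.2)),
          measurable_fun ([set` `[0, T]] `*` D) (fun p => complex.Im (u p.1 p.2)) &
          (sqnormT T D u < +oo)%E],
      forall t, t \in `[0, T] -> L2 D (u t) /\
        sqnorm D (u s \- u t) @[s --> within [set` `[0, T]] (nbhs t)] --> 0%E,
      eq_L2 D (u 0) u0 &
      forall t, t \in `]0, T[ -> exists ut w : E -> C,
        [/\ L2 D ut,
            sqnorm D (fun x => (h^-1)%:C * (u (t + h) x - u t x) - ut x)
              @[h --> 0^'] --> 0%E,
            dirichlet_laplacian D (u t) w &
            eq_L2 D (fun x => ut x - w x + (V x)%:C * u t x) (cst 0)]].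

Definition final_state_observable D V (omega : set E) (T kappa : R) : Prop :=
  forall (u0 : E -> C) u, L2 D u0 -> heat_solution D V T u0 u ->
    (sqnorm D (u T) <= kappa%:E * sqnormT T omega u)%E.

End heat.

(* Main.v *)
Require Import Defs.
From HB Require Import structures.
From mathcomp Require Import all_boot all_order all_algebra.
From mathcomp Require Import all_classical all_reals all_analysis.
From mathcomp Require Import complex.
From mathcomp Require Import ring lra measurable_realfun ess_sup_inf.

(* The form of - Delta + V on a cube, shifted so as to dominate the L^2 norm, is
   compactly embedded in L^2 by Poincare's inequality on small boxes. Minimizing
   it successively gives an eigenbasis, so that - Delta + V has an atomic spectral
   measure and the heat flow multiplies the k-th coefficient by exp(- mu_k t).

   Rescaling by G turns the unique continuation bound into
     |p|^2 <= a_0 exp(a sqrt b) |p|^2_W,   a = N G ln (G / delta),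
   for combinations p of modes mu_k <= b, while the modes mu_k > b have decayed by
   exp(- 2 b t) at time t. For F = |u|^2 and b^(1/2) = s / tau, s = a + c and
   c = 4 ln (G / delta) / ln 2, integrating over the end of an interval of length
   tau yields
     w(tau) F(th + tau) - w(tau / 2) F(th) <= \int_th^(th + tau) |u|^2_W
   with w(tau) of the order tau exp(- a s / tau), provided that tau is small. These
   inequalities telescope over the intervals ]T 2^(-k-1), T 2^-k], and
   1 / w(T / 2) <= 4 a_0 b_0 exp(2 s^2 / T) is the cost. *)

Set Implicit Arguments.
Unset Strict Implicit.
Unset Printing Implicit Defensive.

Import Order.TTheory GRing.Theory Num.Theory.
Import numFieldTopology.Exports numFieldNormedType.Exports.

Local Open Scope classical_set_scope.
Local Open Scope ring_scope.

(** * Compact quadratic forms *)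

(** [unique_continuation_constant] speaks only of functions in a [spectral_subspace], which asks for
    an actual projection-valued measure of an operator defined through distributional Laplacians.
    Estimates on the form are therefore not enough: an eigenbasis has to be constructed and its
    atomic measure shown to be a spectral measure. Since V is real, this is done for real functions,
    a complex function being a pair of them. In the telescoping, s = a + c balances two effects: the
    part a of s pays the observation cost exp(a sqrt b) and the doubling of its exponent from tau to
    tau / 2, and the surplus c pays the constants. The estimates only use c >= 1; the value 4 ln (G
    / delta) / ln 2 makes s = ln (G / delta) (N G + 4 / ln 2), whose square is the announced bound
    on c_*. Requiring T <= 1 turns exp(2 |V| T) into at most b_0, and the other bound on T is taken
    at the worst norm KV. The definition of N does not fix its sign, but comparing exponents after
    rescaling needs N >= 0. *)

Section semi_inner.
Context {R : realType} {V : lmodType R}.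

(** Only semi-definite: [L2sp] below consists of functions and not of classes, and
    [b (u - v) (u - v) = 0] replaces equality in L^2. *)
Record semi_inner (b : V -> V -> R) : Prop := SemiInner {
  siC : forall u v, b u v = b v u;
  si_lin : forall a u v w, b (a *: u + v) w = a * b u w + b v w;
  si_ge0 : forall u, 0 <= b u u }.

Variable b : V -> V -> R.
Hypothesis sb : semi_inner b.

Definition scvg (u : nat -> V) (l : V) : Prop :=
  b (u n - l) (u n - l) @[n --> \oo] --> (0 : R).

Definition scauchy (u : nat -> V) : Prop :=
  forall e : R, 0 < e -> exists N, forall m n, (N <= m)%N -> (N <= n)%N ->
    b (u m - u n) (u m - u n) < e.

Definition scomplete : Prop := forall u, scauchy u -> exists l, scvg u l.

Lemma si0l w : b 0 w = 0.
Proof. by have := si_lin sb (-1) 0 0 w; rewrite scaler0 addr0; lra. Qed.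

Lemma si0r w : b w 0 = 0.
Proof. by rewrite (siC sb) si0l. Qed.

Lemma siDl u v w : b (u + v) w = b u w + b v w.
Proof. by have := si_lin sb 1 u v w; rewrite scale1r mul1r. Qed.

Lemma siZl a u w : b (a *: u) w = a * b u w.
Proof. by have := si_lin sb a u 0 w; rewrite addr0 si0l addr0. Qed.

Lemma siDr u v w : b w (u + v) = b w u + b w v.
Proof. by rewrite !(siC sb w) siDl. Qed.

Lemma siZr a u w : b w (a *: u) = a * b w u.
Proof. by rewrite !(siC sb w) siZl. Qed.

Lemma siNl u w : b (- u) w = - b u w.
Proof. by rewrite -scaleN1r siZl mulN1r. Qed.

Lemma siNr u w : b w (- u) = - b w u.
Proof. by rewrite !(siC sb w) siNl. Qed.

Lemma siBl u v w : b (u - v) w = b u w - b v w.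
Proof. by rewrite siDl siNl. Qed.

Lemma siBr u v w : b w (u - v) = b w u - b w v.
Proof. by rewrite siDr siNr. Qed.

Definition siE := (siDl, siDr, siNl, siNr, siZl, siZr, si0l, si0r).

Lemma si_suml I (r : seq I) (P : pred I) (F : I -> V) w :
  b (\sum_(i <- r | P i) F i) w = \sum_(i <- r | P i) b (F i) w.
Proof.
by apply: (big_morph (fun x => b x w)) => [x y|]; rewrite ?siDl ?si0l.
Qed.

Lemma si_sumr I (r : seq I) (P : pred I) (F : I -> V) w :
  b w (\sum_(i <- r | P i) F i) = \sum_(i <- r | P i) b w (F i).
Proof.
by apply: (big_morph (fun x => b w x)) => [x y|]; rewrite ?siDr ?si0r.
Qed.

Lemma si_cs u v : b u v ^+ 2 <= b u u * b v v.
Proof.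
have [b0|b0] := eqVneq (b v v) 0.
  have [->|nz] := eqVneq (b u v) 0; first by rewrite b0 expr0n mulr0.
  (* With [b v v = 0] the square of [u - c *: v] is b u u - 2 (b u u + 1) < 0, a contradiction. *)
  set c := (b u u + 1) / b u v.
  have hc : c * b u v = b u u + 1 by rewrite divfK.
  have := si_ge0 sb (u - c *: v).
  rewrite !siE b0 (siC sb v u) hc => h.
  by have := si_ge0 sb u; lra.
have vp : 0 < b v v by rewrite lt_def b0 (si_ge0 sb).
have := si_ge0 sb (b v v *: u - b u v *: v).
rewrite !siE (siC sb v u) => h.
have {}h : 0 <= b v v * (b u u * b v v - b u v ^+ 2) by lra.
by rewrite -subr_ge0 -(pmulr_rge0 _ vp).
Qed.

Lemma si_abs_le u v e : 0 < e ->
  `|b u v| <= b u u * e + b v v / e.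
Proof.
move=> e0; have h := si_cs u v.
have u0 := si_ge0 sb u; have v0 := si_ge0 sb v.
have p0 : 0 <= b u u * e by rewrite mulr_ge0// ltW.
have q0 : 0 <= b v v / e by rewrite divr_ge0// ltW.
have {}h : `|b u v| ^+ 2 <= (b u u * e + b v v / e) ^+ 2.
  rewrite real_normK ?num_real// (le_trans h)//.
  have -> : b u u * b v v = (b u u * e) * (b v v / e).
    by field; rewrite gt_eqF.
  nra.
by rewrite -(@ler_pXn2r _ 2)// nnegrE// addr_ge0.
Qed.

Lemma si_null u v : b u u = 0 -> b u v = 0.
Proof.
move=> u0; have := si_cs u v; rewrite u0 mul0r => h.
by apply/eqP; rewrite -sqrf_eq0 eq_le h sqr_ge0.
Qed.

Lemma si_parallelogram u v :
  b (u - v) (u - v) = 2 * b u u + 2 * b v v - b (u + v) (u + v).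
Proof. by rewrite !siE; ring. Qed.

Lemma siD_le u v : b (u + v) (u + v) <= 2 * b u u + 2 * b v v.
Proof.
by rewrite -subr_ge0 -si_parallelogram (si_ge0 sb).
Qed.

Lemma siB_le u v : b (u - v) (u - v) <= 2 * b u u + 2 * b v v.
Proof. by rewrite (le_trans (siD_le _ _))// siNl siNr opprK. Qed.

Lemma siB_sym u v : b (u - v) (u - v) = b (v - u) (v - u).
Proof. by rewrite -(opprB v u) siNl siNr opprK. Qed.

Lemma siB_tri u v w :
  b (u - w) (u - w) <= 2 * b (u - v) (u - v) + 2 * b (v - w) (v - w).
Proof. by rewrite -(subrKA v) siD_le. Qed.

Lemma scvg_ip u l : scvg u l -> forall w, b (u n) w @[n --> \oo] --> b l w.
Proof.
move=> ul w; apply/cvgrPdist_lt => e e0.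
have [N _ hN] : \forall n \near \oo, b (u n - l) (u n - l) * (b w w + 1) < e ^+ 2.
  have c0 : 0 < e ^+ 2 / (b w w + 1).
    by rewrite divr_gt0 ?exprn_gt0// ltr_wpDl// (si_ge0 sb).
  have /cvgrPdist_lt/(_ _ c0) := ul.
  apply: filterS => n /=; rewrite sub0r normrN ger0_norm ?(si_ge0 sb)//.
  by rewrite ltr_pdivlMr// ltr_wpDl// (si_ge0 sb).
exists N => // n Nn /=.
have := hN _ Nn => h.
rewrite distrC -siBl -(@ltr_pXn2r _ 2)// ?nnegrE// ?(ltW e0)//.
rewrite real_normK ?num_real// (le_lt_trans (si_cs _ _))//.
apply: le_lt_trans h.
by rewrite ler_wpM2l ?(si_ge0 sb)// lerDl.
Qed.

Lemma scvg_sq u l : scvg u l -> b (u n) (u n) @[n --> \oo] --> b l l.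
Proof.
move=> ul.
rewrite (_ : (fun n => _) = (fun n => b (u n - l) (u n - l) + 2 * b (u n) l - b l l)).
  suff : b (u n - l) (u n - l) + 2 * b (u n) l - b l l @[n --> \oo] -->
      0 + 2 * b l l - b l l.
    by rewrite (_ : 0 + 2 * b l l - b l l = b l l) //; ring.
  apply: cvgB; last exact: cvg_cst.
  by apply: cvgD => //; apply: cvgM; [exact: cvg_cst|exact: scvg_ip].
by apply/funext => n; rewrite !siE (siC sb l); ring.
Qed.

Lemma scvgD a u v lu lv : scvg u lu -> scvg v lv ->
  scvg (fun n => a *: u n + v n) (a *: lu + lv).
Proof.
move=> hu hv; rewrite /scvg.
have h : 2 * (a ^+ 2 * b (u n - lu) (u n - lu)) + 2 * b (v n - lv) (v n - lv)
    @[n --> \oo] --> (0 : R).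
  rewrite (_ : (0 : R) = 2 * (a ^+ 2 * 0) + 2 * 0); last by ring.
  by apply: cvgD; apply: cvgM => //; try exact: cvg_cst;
    apply: cvgM => //; exact: cvg_cst.
apply: (squeeze_cvgr _ (cvg_cst 0) h).
apply: nearW => n; rewrite (si_ge0 sb)/=.
rewrite (_ : a *: u n + v n - _ = a *: (u n - lu) + (v n - lv)); last first.
  by rewrite scalerBr opprD addrACA.
by rewrite (le_trans (siD_le _ _))// siZl siZr; lra.
Qed.

Lemma scvg_cst u : scvg (fun=> u) u.
Proof. by rewrite /scvg subrr si0l; exact: cvg_cst. Qed.

(* Orthonormal family, except that null vectors are allowed: this lets finite
   and infinite families be indexed uniformly by nat. *)
Definition sorthonormal (e : nat -> V) : Prop :=
  (forall i j, i != j -> b (e i) (e j) = 0) /\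
  (forall i, b (e i) (e i) = 1 \/ b (e i) (e i) = 0).

Section bessel.
Variable e : nat -> V.
Hypothesis oe : sorthonormal e.

Definition sproj n f := \sum_(k < n) b f (e k) *: e k.

Lemma sproj_ip n (c : nat -> R) j :
  b (\sum_(k < n) c k *: e k) (e j) = if (j < n)%N then c j * b (e j) (e j) else 0.
Proof.
rewrite si_suml; case: ifPn => jn.
  rewrite (bigD1 (Ordinal jn))//= siZl big1 ?addr0// => i ij.
  by rewrite siZl oe.1 ?mulr0//.
rewrite big1// => i _; rewrite siZl oe.1 ?mulr0//.
by apply: contraNneq jn => <-.
Qed.

(** A null [e j] has zero coefficients by Cauchy-Schwarz. This removes the weights [b (e k) (e k)]
    from the formulas of Bessel and Parseval. *)
Lemma coef_norm f j : b f (e j) * b (e j) (e j) = b f (e j).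
Proof.
by have [->|h] := oe.2 j; [rewrite mulr1|rewrite (siC sb) (si_null _ h) mul0r].
Qed.

Lemma ssum_sq n (c : nat -> R) :
  b (\sum_(k < n) c k *: e k) (\sum_(k < n) c k *: e k) =
  \sum_(k < n) c k ^+ 2 * b (e k) (e k).
Proof.
rewrite [LHS]si_sumr; apply: eq_bigr => i _; rewrite siZr sproj_ip ltn_ord; ring.
Qed.

Lemma sproj_rest n f : b (f - sproj n f) (f - sproj n f) =
  b f f - \sum_(k < n) b f (e k) ^+ 2.
Proof.
rewrite siBl !siBr (siC sb (sproj n f) f) (ssum_sq n (fun k => b f (e k))).
have -> : b f (sproj n f) = \sum_(k < n) b f (e k) ^+ 2.
  by rewrite si_sumr; apply: eq_bigr => i _; rewrite siZr expr2.
rewrite (_ : \sum_(k < n) _ * _ = \sum_(k < n) b f (e k) ^+ 2); first by ring.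
by apply: eq_bigr => i _; rewrite expr2 -mulrA coef_norm.
Qed.

Lemma sproj_rest_ip n f j : (j < n)%N -> b (f - sproj n f) (e j) = 0.
Proof.
by move=> jn; rewrite siBl (sproj_ip n (fun k => b f (e k))) jn coef_norm subrr.
Qed.

Lemma bessel n f : \sum_(k < n) b f (e k) ^+ 2 <= b f f.
Proof. by rewrite -subr_ge0 -sproj_rest (si_ge0 sb). Qed.

(** Orthonormal systems tend weakly to 0; with compactness this will force the eigenvalues to
    infinity. *)
Lemma bessel_cvg0 f : b f (e k) ^+ 2 @[k --> \oo] --> (0 : R).
Proof.
apply: cvg_series_cvg_0.
apply: nondecreasing_is_cvgn.
  apply: nondecreasing_series => k _ _; exact: sqr_ge0.
exists (b f f) => _ [n _ <-]; rewrite /series/= big_mkord; exact: bessel.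
Qed.

Lemma ssum_cauchy (c : nat -> R) (M : R) :
  (forall n, \sum_(k < n) c k ^+ 2 * b (e k) (e k) <= M) ->
  scauchy (fun n => \sum_(k < n) c k *: e k).
Proof.
move=> cM eps eps0.
have : cvgn (series (fun k => c k ^+ 2 * b (e k) (e k))).
  apply: nondecreasing_is_cvgn.
    apply: nondecreasing_series => k _ _.
    by rewrite mulr_ge0 ?sqr_ge0 ?(si_ge0 sb).
  by exists M => _ [n _ <-]; rewrite /series/= big_mkord.
move=> hc; have /cvgrPdist_lt/(_ (eps / 2))[|K _ hK] := hc; first by rewrite divr_gt0.
exists K => m n.
wlog mn : m n / (m <= n)%N.
  move=> h Km Kn; case: (leqP m n) => mn; first exact: h.
  by rewrite siB_sym h// ltnW.
move=> Km Kn.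
(* Erasing the first m coefficients writes the difference as one sum over [k < n], to which
   [ssum_sq] applies. *)
have -> : \sum_(k < m) c k *: e k - \sum_(k < n) c k *: e k =
    - \sum_(k < n) (if (k < m)%N then 0 else c k) *: e k.
  rewrite -!(big_mkord xpredT (fun k => c k *: e k)).
  rewrite -!(big_mkord xpredT (fun k => (if (k < m)%N then 0 else c k) *: e k)).
  rewrite [X in _ - X](@big_cat_nat _ _ _ m)//= [in RHS](@big_cat_nat _ _ _ m)//=.
  rewrite opprD addrA subrr add0r [X in - (X + _)]big1_seq ?add0r.
    by congr (- _); apply: eq_big_nat => i /andP[mi _]; rewrite ltnNge mi.
  by move=> i /=; rewrite mem_index_iota => /andP[_ im]; rewrite im scale0r.
rewrite siNl siNr opprK (ssum_sq n (fun k => if (k < m)%N then 0 else c k)).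
have -> : \sum_(k < n) (if (k < m)%N then 0 else c k) ^+ 2 * b (e k) (e k) =
  series (fun k => c k ^+ 2 * b (e k) (e k)) n - series (fun k => c k ^+ 2 * b (e k) (e k)) m.
  rewrite sub_series_geq//.
  rewrite -(big_mkord xpredT (fun k => (if (k < m)%N then 0 else c k) ^+ 2 * b (e k) (e k))).
  rewrite (big_cat_nat (n := m) _ _)//= big1_seq ?add0r.
    by apply: eq_big_nat => i /andP[mi _]; rewrite ltnNge mi.
  by move=> i /=; rewrite mem_index_iota => /andP[_ im]; rewrite im expr0n mul0r.
have := hK m Km; have := hK n Kn => /=.
set l' := limn _; set x := series _ m; set y := series _ n.
rewrite !ltr_norml => /andP[? ?] /andP[? ?]; lra.
Qed.

(** The Riesz-Fischer theorem for an abstract complete form. *)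
Lemma ssum_limit (c : nat -> R) (M : R) : scomplete ->
  (forall n, \sum_(k < n) c k ^+ 2 * b (e k) (e k) <= M) ->
  exists g, scvg (fun n => \sum_(k < n) c k *: e k) g /\
    forall k, b g (e k) = c k * b (e k) (e k).
Proof.
move=> cb cM; have [g hg] := cb _ (ssum_cauchy cM).
exists g; split=> // k.
have h := @scvg_ip _ _ hg (e k).
have h2 : b (\sum_(i < n) c i *: e i) (e k) @[n --> \oo] --> c k * b (e k) (e k).
  apply: cvg_near_cst; exists k.+1 => // n kn /=.
  by rewrite sproj_ip kn.
exact: (cvg_unique (@Rhausdorff R) h h2).
Qed.

End bessel.

End semi_inner.

(* Ultrafilters replace the extraction of successive subsequences in the proof
   that bounded sets of the form domain are relatively compact. *)
Lemma ultra_bounded (R : realType) (F : set_system nat) (x : nat -> R) (B : R) :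
  UltraFilter F -> (forall n, `|x n| <= B) ->
  forall d, 0 < d -> exists A, F A /\
    forall m n, A m -> A n -> (x m - x n) ^+ 2 < d.
Proof.
move=> UF xB d d0.
have cB : compact `[- B, B]%classic by exact: segment_compact.
have FF : ProperFilter F by exact: ultra_proper.
have FB : (x @ F) `[- B, B]%classic.
  apply: (@filterS _ F _ setT); last exact: filterT.
  by move=> n _ /=; rewrite in_itv/= -ler_norml.
have [l [_ xl]] := cB _ _ FB.
have s0 : 0 < Num.sqrt d / 2 by rewrite divr_gt0// sqrtr_gt0.
exists (fun n => `|l - x n| < Num.sqrt d / 2); split=> [|m n hm hn].
  have [//|FC] := in_ultra_setVsetC (fun n => `|l - x n| < Num.sqrt d / 2) UF.
  have FC' : (x @ F) [set y | ~ (`|l - y| < Num.sqrt d / 2)] by exact: FC.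
  have [y [/= ny ly]] := xl _ _ FC' (nbhsx_ballx l (Num.sqrt d / 2) s0).
  by case: ny; rewrite -ball_normE in ly.
rewrite -real_normK ?num_real// -[ltRHS]sqr_sqrtr ?ltW//.
rewrite ltr_pXn2r ?nnegrE ?sqrtr_ge0//.
move: hm hn; rewrite !ltr_norml => /andP[? ?] /andP[? ?]; apply/andP; split; lra.
Qed.

(* The first variation vanishes at a minimum of a quadratic functional. *)
Lemma affine_nonneg (R : realType) (a b : R) :
  (forall t, 0 <= a * t ^+ 2 + b * t) -> b = 0.
Proof.
move=> h; apply/eqP; apply: contraT => b0.
pose k := `|a| + 1; have k0 : 0 < k by rewrite ltr_wpDl.
have := h (- b / k).
have -> : a * (- b / k) ^+ 2 + b * (- b / k) = (b / k) ^+ 2 * (a - k).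
  by field; rewrite gt_eqF.
have : 0 < (b / k) ^+ 2 by rewrite exprn_even_gt0//= mulf_neq0// invr_neq0// gt_eqF.
have : a - k < 0 by rewrite /k; have := ler_norm a; lra.
by nra.
Qed.

Section form.
Context {R : realType} {H X : lmodType R}.
Variables (ip : H -> H -> R) (en : X -> X -> R) (J : {linear X -> H}).
Hypotheses (sip : semi_inner ip) (sen : semi_inner en).
Hypotheses (cip : scomplete ip) (cen : scomplete en).
Hypothesis en_ge : forall u, ip (J u) (J u) <= en u u.
(* Compactness of [J], as an inequality of Poincare type with finitely many means. *)
Hypothesis cpt : forall eps : R, 0 < eps -> exists s : seq H,
  forall u, ip (J u) (J u) <= \sum_(h <- s) ip (J u) h ^+ 2 + eps * en u u.

Let ipJ u v := ip (J u) (J v).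

Let sipJ : semi_inner ipJ.
Proof.
split=> [u v|a u v w|u]; rewrite /ipJ; last exact: si_ge0.
  exact: siC.
by rewrite linearP (si_lin sip).
Qed.

(** On a suitable set of the ultrafilter, each of the finitely many means provided by [cpt] is
    almost constant, while the energy of a difference is at most 4 M and carries a small factor. *)
Lemma form_ultra (F : set_system nat) (u : nat -> X) (M : R) : UltraFilter F ->
  (forall n, en (u n) (u n) <= M) ->
  forall eps, 0 < eps -> exists A, F A /\
    forall m n, A m -> A n -> ipJ (u m - u n) (u m - u n) < eps.
Proof.
move=> UF uM eps eps0; have FF : ProperFilter F by exact: ultra_proper.
have M0 : 0 <= M by exact: le_trans (si_ge0 sen _) (uM 0%N).
(* This factor keeps the energy term below eps / 2, and [d] below does the same for the means;
   adding 1 to M and to the number of means avoids a division by 0. *)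
have e0 : 0 < eps / (8 * (M + 1)) by rewrite divr_gt0// mulr_gt0// ltr_wpDl.
have [s hs] := cpt e0.
pose d := eps / (2 * ((size s)%:R + 1)).
have d0 : 0 < d by rewrite divr_gt0// mulr_gt0// ltr_wpDl.
have [A [FA hA]] : exists A, F A /\ forall m n, A m -> A n ->
    \sum_(h <- s) ip (J (u m - u n)) h ^+ 2 <= (size s)%:R * d.
  elim: (s) => [|h s' [A [FA hA]]].
    by exists setT; split=> [|m n _ _]; [exact: filterT|rewrite big_nil mul0r].
  have [|B [FB hB]] := @ultra_bounded R F (fun n => ip (J (u n)) h)
      (M * 1 + ip h h / 1) UF _ d d0.
    move=> n; apply: le_trans (si_abs_le sip _ _ ltr01) _.
    by rewrite lerD2r ler_wpM2r// (le_trans (en_ge _)).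
  exists (A `&` B); split=> [|m n [Am Bm] [An Bn]]; first exact: filterI.
  rewrite big_cons/= -natr1 mulrDl mul1r addrC lerD ?hA// ltW//.
  by have := hB m n Bm Bn; rewrite linearB (siBl sip).
exists A; split=> // m n Am An.
apply: le_lt_trans (hs _) _.
have h1 := hA m n Am An.
have h2 : en (u m - u n) (u m - u n) <= 4 * M.
  by have := siB_le sen (u m) (u n); have := uM m; have := uM n; lra.
have h3 : (size s)%:R * d <= eps / 2.
  have -> : (size s)%:R * d = eps / 2 * ((size s)%:R / ((size s)%:R + 1)).
    by rewrite /d; field; rewrite gt_eqF// ltr_wpDl.
  rewrite ler_piMr ?divr_ge0 ?(ltW eps0)//.
  by rewrite ler_pdivrMr ?mul1r ?lerDl// ltr_wpDl.
have h4 : eps / (8 * (M + 1)) * en (u m - u n) (u m - u n) <= eps / (8 * (M + 1)) * (4 * M).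
  by rewrite ler_wpM2l// ltW.
have h5 : eps / (8 * (M + 1)) * (4 * M) < eps / 2.
  rewrite mulrAC ltr_pdivrMr; last by rewrite mulr_gt0// ltr_wpDl.
  by rewrite -subr_gt0; have -> : eps / 2 * (8 * (M + 1)) - eps * (4 * M) = 4 * eps;
    [field|rewrite mulr_gt0].
lra.
Qed.

(** One ultrafilter finer than [\oo] gives for each k a set of indices with oscillation below 1 / (k
    + 1). Picking [p k] beyond k in the intersection of the sets up to k makes the selected sequence
    Cauchy. *)
Lemma form_subseq (u : nat -> X) (M : R) :
  (forall n, en (u n) (u n) <= M) ->
  exists2 p : nat -> nat, (forall k, (k <= p k)%N) & scauchy ipJ (u \o p).
Proof.
move=> uM.
have [F [UF ooF]] := ultraFilterLemma (_ : ProperFilter \oo).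
have PF : ProperFilter F by exact: ultra_proper.
have h k : exists A, F A /\
    forall m n, A m -> A n -> ipJ (u m - u n) (u m - u n) < k.+1%:R^-1.
  exact: form_ultra.
have [A hA] := choice h.
pose B := fix B k := if k is k'.+1 then B k' `&` A k else A 0%N.
have FB k : F (B k `&` [set n | (k <= n)%N]).
  apply: filterI; last by apply: ooF; exists k.
  by elim: k => [|k IH]; [exact: (hA _).1|apply: filterI => //; exact: (hA _).1].
have BA i k : (i <= k)%N -> B k `<=` A i.
  elim: k => [|k IH]; first by rewrite leqn0 => /eqP ->.
  rewrite leq_eqVlt => /predU1P[->|]; first by move=> x [].
  by rewrite ltnS => /IH h' x [/h'].
have hp k : exists n, (B k `&` [set n | (k <= n)%N]) n by exact: (filter_ex (FB k)).
have [p Hp] := choice hp.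
exists p => [k|]; first exact: (Hp k).2.
move=> e e0; exists (Num.truncn e^-1) => m n Nm Nn.
apply: lt_trans (_ : (Num.truncn e^-1).+1%:R^-1 < e).
  apply: (hA _).2; apply: BA (Hp _).1 => //.
by rewrite invf_plt ?posrE// truncnS_gt.
Qed.

(** The direct method: a minimizing sequence of unit vectors is made Cauchy for [ip] by compactness,
    then Cauchy for [en] by the parallelogram identities, so that the limit is attained in the form
    domain. *)
Lemma form_min (s : seq X) :
  (exists u, (forall e, e \in s -> ipJ u e = 0) /\ 0 < ipJ u u) ->
  exists e, [/\ forall e', e' \in s -> ipJ e e' = 0, ipJ e e = 1 &
    forall u, (forall e', e' \in s -> ipJ u e' = 0) -> en e e * ipJ u u <= en u u].
Proof.
move=> [u0 [u0s u0p]].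
pose Y u := forall e', e' \in s -> ipJ u e' = 0.
have YP a u v : Y u -> Y v -> Y (a *: u + v).
  by move=> Yu Yv e' es; rewrite (si_lin sipJ) Yu// Yv// mulr0 addr0.
have Y0 : Y 0 by move=> e' _; rewrite (si0l sipJ).
pose E := [set en u u | u in [set u | Y u /\ ipJ u u = 1]].
have nrm u : 0 < ipJ u u -> ipJ ((Num.sqrt (ipJ u u))^-1 *: u) ((Num.sqrt (ipJ u u))^-1 *: u) = 1.
  move=> up; rewrite (siZl sipJ) (siZr sipJ) mulrA -expr2 exprVn sqr_sqrtr ?ltW//.
  by rewrite mulVf// gt_eqF.
have E0 : has_inf E.
  split; last by exists 0 => _ [u _ <-]; exact: (si_ge0 sen).
  exists (en ((Num.sqrt (ipJ u0 u0))^-1 *: u0) ((Num.sqrt (ipJ u0 u0))^-1 *: u0)).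
  exists ((Num.sqrt (ipJ u0 u0))^-1 *: u0) => //; split; last exact: nrm.
  by rewrite -[_ *: _]addr0; exact: YP.
pose I := inf E.
have Ile u : Y u -> I * ipJ u u <= en u u.
  move=> Yu; have [u00|up] := leP (ipJ u u) 0.
    rewrite (_ : ipJ u u = 0) ?mulr0 ?(si_ge0 sen)//.
    by apply/eqP; rewrite eq_le u00 (si_ge0 sipJ).
  set c := (Num.sqrt (ipJ u u))^-1.
  have : I <= en (c *: u) (c *: u).
    apply: ge_inf; first exact: E0.2.
    by exists (c *: u) => //; split; [rewrite -[_ *: _]addr0; exact: YP|exact: nrm].
  rewrite (siZl sen) (siZr sen) mulrA -expr2 /c exprVn sqr_sqrtr ?(ltW up)//.
  by rewrite [X in _ <= X]mulrC ler_pdivlMr.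
have hn n : exists u, [/\ Y u, ipJ u u = 1 & en u u < I + n.+1%:R^-1].
  have n0 : 0 < n.+1%:R^-1 :> R by rewrite invr_gt0.
  by have [_ [u [Yu u1] <-] h] := inf_adherent n0 E0; exists u.
have [u hu] := choice hn.
have [|p pk cp] := @form_subseq u (I + 1).
  move=> n; have [_ _ /ltW h] := hu n; apply: le_trans h _.
  by rewrite lerD2l invf_le1// ler1n.
pose v := u \o p.
have vY n : Y (v n) by have [] := hu (p n).
have v1 n : ipJ (v n) (v n) = 1 by have [] := hu (p n).
have vI n : en (v n) (v n) < I + n.+1%:R^-1.
  have [_ _ h] := hu (p n); apply: lt_le_trans h _.
  by rewrite lerD2l lef_pV2 ?posrE// ler_nat ltnS.
have I0 : 0 <= I by apply: lb_le_inf; [exact: E0.1|move=> _ [w _ <-]; exact: (si_ge0 sen)].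
have cv : scauchy en v.
  move=> e e0.
  have e8 : 0 < e / 8 by rewrite divr_gt0.
  have eI : 0 < e / (4 * (I + 1)) by rewrite divr_gt0// mulr_gt0// ltr_wpDl.
  have [N hN] := cp _ eI.
  pose N' := Num.truncn (e / 8)^-1.
  exists (maxn N N') => m n; rewrite !geq_max => /andP[Nm N'm] /andP[Nn N'n].
  have hvI k : (N' <= k)%N -> en (v k) (v k) < I + e / 8.
    move=> Nk; apply: lt_trans (vI k) _; rewrite ltrD2l.
    rewrite invf_plt ?posrE//; apply: lt_le_trans (truncnS_gt _) _.
    by rewrite ler_nat ltnS.
  have h1 := hvI _ N'm; have h2 := hvI _ N'n.
  (* The sum satisfies the same constraints, so its energy is at least I times its L^2 square. The
     two parallelogram identities then bound the energy of [v m - v n] by I times its L^2 square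
     plus the excess of the two energies over I. *)
  have h3 : I * ipJ (v m + v n) (v m + v n) <= en (v m + v n) (v m + v n).
    by apply: Ile; rewrite -[v m]scale1r; exact: YP.
  have h4 : ipJ (v m - v n) (v m - v n) < e / (4 * (I + 1)) by exact: hN.
  have h5 := si_parallelogram sipJ (v m) (v n).
  have h6 := si_parallelogram sen (v m) (v n).
  have h7 : I * ipJ (v m - v n) (v m - v n) <= e / 4.
    apply: le_trans (_ : I * (e / (4 * (I + 1))) <= _).
      by rewrite ler_wpM2l// ltW.
    rewrite mulrCA ler_pdivlMr//; have -> : e * (I / (4 * (I + 1))) * 4 = e * (I / (I + 1)).
      by field; rewrite gt_eqF// ltr_wpDl.
    rewrite ler_piMr ?(ltW e0)// ler_pdivrMr ?ltr_wpDl//; lra.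
  move: h5; rewrite !v1 => h5.
  have h8 : I * ipJ (v m + v n) (v m + v n) = 4 * I - I * ipJ (v m - v n) (v m - v n).
    by rewrite h5; ring.
  rewrite h6; lra.
have [e ve] := cen cv.
have veJ : scvg ipJ v e.
  apply: (squeeze_cvgr _ (cvg_cst 0) ve).
  by apply: nearW => n; rewrite (si_ge0 sipJ) en_ge.
have e1 : ipJ e e = 1.
  apply: (cvg_unique (@Rhausdorff R) (scvg_sq sipJ veJ)).
  have -> : (fun n => ipJ (v n) (v n)) = cst 1 by apply/funext => n; rewrite v1.
  exact: cvg_cst.
have eI : en e e <= I.
  have h : I + n.+1%:R^-1 @[n --> \oo] --> I + 0.
    by apply: cvgD; [exact: cvg_cst|exact: cvg_harmonic].
  have := ler_lim (cvgP _ (scvg_sq sen ve)) (cvgP _ h).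
  rewrite (cvg_lim _ (scvg_sq sen ve))// (cvg_lim _ h)// addr0; apply.
  by apply: nearW => n; rewrite ltW.
exists e; split=> [e' es||w Yw] //.
  apply: (cvg_unique (@Rhausdorff R) (@scvg_ip _ _ _ sipJ _ _ veJ e')).
  have -> : (fun n => ipJ (v n) e') = cst 0 by apply/funext => n; rewrite vY.
  exact: cvg_cst.
apply: le_trans (Ile w Yw); rewrite ler_wpM2r//; exact: (si_ge0 sipJ).
Qed.

Lemma orth_proj (e : seq X) : pairwise (fun u v => ipJ u v == 0) e ->
  all (fun u => (ipJ u u == 1) || (u == 0)) e ->
  forall v, forall e', e' \in e -> ipJ (v - \sum_(u <- e) ipJ v u *: u) e' = 0.
Proof.
elim/last_ind: e => [|e x IH]; first by [].
rewrite pairwise_rcons all_rcons => /andP[xe pe] /andP[x1 ae] v e'.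
rewrite mem_rcons inE big_rcons/= => /predU1P[->|ee].
  rewrite opprD addrA (siBl sipJ) (siBl sipJ) (si_suml sipJ) big_seq big1; last first.
    move=> u ue; rewrite (siZl sipJ).
    by move/allP : xe => /(_ _ ue)/= /eqP ->; rewrite mulr0.
  rewrite (siZl sipJ) subr0; case/orP : x1 => /eqP x1; first by rewrite x1 mulr1 subrr.
  by rewrite x1 !(si0r sipJ) mulr0 subrr.
rewrite opprD addrA (siBl sipJ) IH// (siZl sipJ) (siC sipJ x).
by move/allP : xe => /(_ _ ee)/= /eqP ->; rewrite mulr0 subrr.
Qed.

(** Against vectors orthogonal to s this is the vanishing first variation. The component of v in the
    span of s contributes 0 to both sides, because the elements of s are themselves eigenvectors. *)
Lemma form_eigen (s : seq X) (e : X) : pairwise (fun u v => ipJ u v == 0) s ->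
  all (fun u => (ipJ u u == 1) || (u == 0)) s ->
  (forall f, f \in s -> exists l, forall v, en f v = l * ipJ f v) ->
  (forall e', e' \in s -> ipJ e e' = 0) -> ipJ e e = 1 ->
  (forall u, (forall e', e' \in s -> ipJ u e' = 0) -> en e e * ipJ u u <= en u u) ->
  forall v, en e v = en e e * ipJ e v.
Proof.
move=> os ns es Ye e1 me.
have hY v : (forall e', e' \in s -> ipJ v e' = 0) -> en e v = en e e * ipJ e v.
  move=> Yv; apply/eqP; rewrite -subr_eq0; apply/eqP.
  suff : 2 * (en e v - en e e * ipJ e v) = 0 by lra.
  apply: (@affine_nonneg _ (en v v - en e e * ipJ v v)) => t.
  have := me (t *: v + e); rewrite -subr_ge0.
  rewrite !(siDl sen) !(siDr sen) !(siZl sen) !(siZr sen).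
  rewrite !(siDl sipJ) !(siDr sipJ) !(siZl sipJ) !(siZr sipJ) e1.
  rewrite (siC sen v e) (siC sipJ v e) => h.
  have : forall e', e' \in s -> ipJ (t *: v + e) e' = 0.
    by move=> e' e's; rewrite (si_lin sipJ) Yv// Ye// mulr0 addr0.
  move/h; lra.
move=> v; rewrite -[v](subrK (\sum_(u <- s) ipJ v u *: u)).
rewrite (siDr sen) (siDr sipJ) hY; last exact: orth_proj.
rewrite mulrDr; congr (_ + _).
rewrite (si_sumr sen) (si_sumr sipJ) big_seq [in RHS]big_seq !big1 ?mulr0// => u us.
  by rewrite (siZr sipJ) Ye// mulr0.
rewrite (siZr sen) (siC sen).
by have [l ->] := es u us; rewrite (siC sipJ u) Ye// !mulr0.
Qed.

(* The spectral theorem in variational form: each [e k] minimizes the form on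
   the orthogonal complement of the previous ones, and is 0 once that complement
   is null, the eigenvalue being then the junk value [k + 1]. *)
Definition eigenbasis (e : nat -> X) (lam : nat -> R) : Prop :=
  [/\ sorthonormal ip (J \o e),
      forall k v, en (e k) v = lam k * ip (J (e k)) (J v),
      forall k, 1 <= lam k,
      forall M, exists K, forall k, (K <= k)%N -> M < lam k &
      forall k u, (forall j, (j < k)%N -> ip (J u) (J (e j)) = 0) ->
        lam k * ip (J u) (J u) <= en u u].

Lemma form_spectral : exists e lam, eigenbasis e lam.
Proof.
have step (s : seq X) : exists p : X * R,
   [/\ forall e', e' \in s -> ipJ p.1 e' = 0,
    (ipJ p.1 p.1 = 1 /\ en p.1 p.1 = p.2) \/ (p.1 = 0 /\ p.2 = (size s).+1%:R) &
    forall u, (forall e', e' \in s -> ipJ u e' = 0) -> p.2 * ipJ u u <= en u u].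
  have [h|h] := pselect (exists u, (forall e, e \in s -> ipJ u e = 0) /\ 0 < ipJ u u).
    by have [e [h1 h2 h3]] := form_min h; exists (e, en e e); split => //; left.
  exists (0, (size s).+1%:R); split => [e' _||u us]; first exact: si0l.
    by right.
  have [u0|u0] := ltP 0 (ipJ u u); first by exfalso; apply: h; exists u.
  have -> : ipJ u u = 0 by apply/eqP; rewrite eq_le u0 (si_ge0 sipJ).
  by rewrite mulr0 (si_ge0 sen).
have [nx hnx] := choice step.
pose S := fix S k := if k is k'.+1 then rcons (S k') (nx (S k')).1 else [::].
pose e k := (nx (S k)).1; pose lam k := (nx (S k)).2.
have sS k : size (S k) = k by elim: k => //= k IH; rewrite size_rcons IH.
have SE k x : x \in S k <-> exists2 j, (j < k)%N & x = e j.
  elim: k x => [|k IH] x; first by split=> // -[].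
  rewrite /= mem_rcons inE; split=> [/predU1P[->|/IH[j jk ->]]|[j]].
  - by exists k.
  - by exists j => //; rewrite ltnS ltnW.
  - rewrite ltnS leq_eqVlt => /predU1P[-> ->|jk ->]; first by rewrite eqxx.
    by apply/orP; right; apply: (IH _).2; exists j.
have Se j k : (j < k)%N -> e j \in S k by move=> jk; apply/SE; exists j.
have oe k j : (j < k)%N -> ipJ (e k) (e j) = 0.
  by move=> jk; have [h _ _] := hnx (S k); apply: h; exact: Se.
have pS k : pairwise (fun u v => ipJ u v == 0) (S k).
  elim: k => //= k IH; rewrite pairwise_rcons IH andbT.
  by apply/allP => _ /SE[j jk ->]; rewrite /= (siC sipJ) oe.
have nS k : all (fun u => (ipJ u u == 1) || (u == 0)) (S k).
  apply/allP => _ /SE[j jk ->]; rewrite /e; have [_ [[-> _]|[-> _]] _] := hnx (S j).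
    by rewrite eqxx.
  by rewrite eqxx orbT.
have me k u : (forall j, (j < k)%N -> ipJ u (e j) = 0) -> lam k * ipJ u u <= en u u.
  by move=> hu; have [_ _] := hnx (S k); apply => _ /SE[j jk ->]; exact: hu.
have eig k : forall v, en (e k) v = lam k * ipJ (e k) v.
  elim/ltn_ind: k => k IH v.
  have [_ [[h1 h2]|[h1 _]] h3] := hnx (S k); last by rewrite /e h1 (si0l sen) (si0l sipJ) mulr0.
  rewrite -/(e k) in h1 h2; rewrite /lam -h2.
  apply: (@form_eigen (S k)) => //.
  - by move=> _ /SE[j jk ->]; exists (lam j); exact: IH.
  - by move=> _ /SE[j jk ->]; exact: oe.
  - by move=> u us; rewrite h2; apply: h3.
have so : sorthonormal ip (J \o e).
  split=> [i j|i].
    rewrite neq_ltn => /orP[ij|ji]; last exact: oe.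
    by rewrite (siC sip); exact: oe.
  have [_ [[h1 _]|[h1 _]] _] := hnx (S i); first by left.
  by right; rewrite /= /e h1 linear0 (si0l sip).
exists e, lam; split=> // [k|M].
  have [_ [[h1 h2]|[_ h2]] _] := hnx (S k); rewrite /lam -?h2; last first.
    by rewrite h2 ler1n.
  by rewrite -h1; exact: en_ge.
pose M1 := `|M| + 1.
have M10 : 0 < M1 by rewrite ltr_wpDl.
(* With this weight in [cpt], a unit vector whose squared means sum to less than 1 / 2 has energy
   greater than M1; by Bessel this applies to [e k] for large k. *)
have d0 : 0 < (2 * M1)^-1 by rewrite invr_gt0 mulr_gt0.
have [s hs] := cpt d0.
have : \sum_(h <- s) ip (J (e k)) h ^+ 2 @[k --> \oo] --> \sum_(h <- s) (0 : R).
  elim: s {hs} => [|h s IH].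
    by under eq_fun do rewrite big_nil; rewrite big_nil; exact: cvg_cst.
  under eq_fun do rewrite big_cons; rewrite big_cons.
  apply: cvgD => //.
  under eq_fun do rewrite (siC sip).
  exact: (bessel_cvg0 sip so h).
rewrite big1// => /cvgrPdist_lt/(_ (1/2)); rewrite divr_gt0// => /(_ isT)[K _ hK].
(* The second bound takes care of the indices with the junk eigenvalue k + 1. *)
exists (maxn K (Num.truncn M)) => k; rewrite geq_max => /andP[Kk Mk].
have [_ [[h1 h2]|[_ h2]] _] := hnx (S k); last first.
  by rewrite /lam h2 sS; apply: lt_le_trans (truncnS_gt _) _; rewrite ler_nat.
rewrite -/(e k) in h1 h2.
rewrite /lam -h2.
have := hs (e k); rewrite -/(ipJ _ _) h1 => h3.
have := hK k Kk => /=; rewrite sub0r normrN => /(le_lt_trans (ler_norm _)) h4.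
have h5 : 1 / 2 < (2 * M1)^-1 * en (e k) (e k) by lra.
rewrite [ltRHS]mulrC ltr_pdivlMr ?mulr_gt0// in h5.
by have := ler_norm M; rewrite /M1 in h5; lra.
Qed.

Section basis.
Variables (e : nat -> X) (lam : nat -> R).
Hypothesis eb : eigenbasis e lam.
Hypothesis dens : forall g, (forall v, ip g (J v) = 0) -> ip g g = 0.

Let E := J \o e.
Let oE : sorthonormal ip E. Proof. by case: eb. Qed.

Lemma eigen_ge1 k : 1 <= lam k. Proof. by case: eb. Qed.

(** The remainder is orthogonal to the first n eigenvectors, so its L^2 square is at most its energy
    over [lam n]. Its energy is at most that of u, since the remainder and the projection are
    orthogonal for [en] as well. *)
Lemma form_rest_cvg u : scvg ip (fun n => sproj ip E n (J u)) (J u).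
Proof.
have lamoo : lam k @[k --> \oo] --> +oo.
  apply/cvgryPgt => M; have [_ _ _ h _] := eb; have [K hK] := h M.
  by exists K.
have h : (lam n)^-1 * en u u @[n --> \oo] --> 0 * en u u.
  apply: cvgM; last exact: cvg_cst.
  apply/gtr0_cvgV0 => //.
  by apply: nearW => n; exact: lt_le_trans (eigen_ge1 n).
rewrite mul0r in h.
apply: (squeeze_cvgr _ (cvg_cst 0) h); apply: nearW => n.
rewrite (si_ge0 sip)/= (siB_sym sip) mulrC ler_pdivlMr; last first.
  exact: lt_le_trans (eigen_ge1 n).
pose p := \sum_(k < n) ip (J u) (E k) *: e k.
have pE : sproj ip E n (J u) = J p.
  by rewrite /p linear_sum; apply: eq_bigr => i _; rewrite linearZ.
have h1 : lam n * ip (J (u - p)) (J (u - p)) <= en (u - p) (u - p).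
  have [_ _ _ _] := eb; apply => j jn.
  by rewrite linearB -pE; exact: (sproj_rest_ip sip oE).
rewrite pE -linearB mulrC; apply: le_trans h1 _.
have h2 : en p (u - p) = 0.
  rewrite (si_suml sen) big1// => i _; rewrite (siZl sen).
  have [_ -> _ _ _] := eb.
  have h0 := @sproj_rest_ip _ _ _ sip _ oE n (J u) i (ltn_ord i).
  by rewrite linearB -pE (siC sip (J (e i))) h0 !mulr0.
have : en u u = en (u - p) (u - p) + en p p.
  have h3 : en (u - p) p = 0 by rewrite (siC sen).
  move: h2 h3; set w := u - p => h2 h3; have -> : u = w + p by rewrite subrK.
  clearbody w p.
  by rewrite (siDl sen) !(siDr sen) h2 h3; ring.
by move->; rewrite lerDl (si_ge0 sen).
Qed.

(** Such an f is orthogonal to the expansions of all [J v], hence to their limits [J v], which are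
    dense by [dens]. *)
Lemma basis_complete f : (forall k, ip f (E k) = 0) -> ip f f = 0.
Proof.
move=> fe; apply: dens => v; rewrite (siC sip).
have h := @scvg_ip _ _ _ sip _ _ (form_rest_cvg v) f.
apply: (cvg_unique (@Rhausdorff R) h).
rewrite (_ : (fun n => _) = fun=> 0); first exact: cvg_cst.
apply/funext => n; rewrite (si_suml sip) big1// => i _.
by rewrite (siZl sip) (siC sip _ f) fe mulr0.
Qed.

Lemma basis_synth (c : nat -> R) (M : R) :
  (forall n, \sum_(k < n) c k ^+ 2 * ip (E k) (E k) <= M) ->
  exists g, scvg ip (fun n => \sum_(k < n) c k *: E k) g /\
    forall k, ip g (E k) = c k * ip (E k) (E k).
Proof. exact: (ssum_limit sip oE cip). Qed.

Lemma coef_eq f g : (forall k, ip f (E k) = ip g (E k)) -> ip (f - g) (f - g) = 0.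
Proof.
by move=> fg; apply: basis_complete => k; rewrite (siBl sip) fg subrr.
Qed.

(** The sum of the series exists by Riesz-Fischer and has the coefficients of f, so it differs from
    f by a null vector, which does not affect convergence. *)
Lemma basis_expand f : scvg ip (fun n => sproj ip E n f) f.
Proof.
have [|g [hg ge]] := @basis_synth (fun k => ip f (E k)) (ip f f).
  move=> n; apply: le_trans (bessel sip oE n f).
  apply: ler_sum => i _; rewrite expr2 -mulrA (coef_norm sip oE) -expr2.
  by [].
have fg : ip (g - f) (g - f) = 0.
  by apply: coef_eq => k; rewrite ge (coef_norm sip oE).
have h : 2 * ip (sproj ip E n f - g) (sproj ip E n f - g) + 2 * ip (g - f) (g - f)
   @[n --> \oo] --> 2 * 0 + 2 * ip (g - f) (g - f).
  by apply: cvgD; [apply: cvgM => //; exact: cvg_cst|exact: cvg_cst].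
rewrite fg !mulr0 addr0 in h.
apply: (squeeze_cvgr _ (cvg_cst 0) h); apply: nearW => n.
rewrite (si_ge0 sip)/= (le_trans (siB_tri sip _ g _))//.
by rewrite fg mulr0.
Qed.

Lemma parseval f g :
  \sum_(k < n) ip f (E k) * ip g (E k) @[n --> \oo] --> ip f g.
Proof.
have := @scvg_ip _ _ _ sip _ _ (basis_expand f) g.
rewrite (_ : (fun n => _) = (fun n => \sum_(k < n) ip f (E k) * ip g (E k)))//.
apply/funext => n; rewrite (si_suml sip); apply: eq_bigr => k _.
by rewrite (siZl sip) (siC sip g).
Qed.

Lemma parseval_sq f :
  \sum_(k < n) ip f (E k) ^+ 2 @[n --> \oo] --> ip f f.
Proof. exact: parseval. Qed.

Lemma form_coef u g : (forall v, en u v = ip g (J v)) ->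
  forall k, ip g (E k) = lam k * ip (J u) (E k).
Proof.
move=> h k; rewrite -[E k]/(J (e k)) -h (siC sen).
by have [_ -> _ _ _] := eb; rewrite (siC sip).
Qed.

(** Converse of [form_coef]: coefficients that stay square summable after multiplication by [lam]
    put f, up to a null vector, in the operator domain. The expansion also converges for [en], since
    the vectors [e k] divided by the square root of [lam k] are orthonormal there and [lam k >= 1]
    bounds the new coefficients. *)
Lemma form_regular f (M : R) :
  (forall n, \sum_(k < n) (lam k * ip f (E k)) ^+ 2 <= M) ->
  exists u g, [/\ ip (J u - f) (J u - f) = 0 & forall v, en u v = ip g (J v)].
Proof.
move=> fM.
pose c k := ip f (E k).
have cE k : c k * ip (E k) (E k) = c k by exact: (coef_norm sip oE).
have [|g [hg ge]] := @basis_synth (fun k => lam k * c k) M.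
  move=> n; apply: le_trans (fM n); apply: ler_sum => i _.
  by rewrite expr2 -!mulrA cE.
have lam0 k : 0 < lam k by exact: lt_le_trans (eigen_ge1 k).
have en_e k v : en (e k) v = lam k * ip (E k) (J v) by have [_ -> _ _ _] := eb.
pose sl k := Num.sqrt (lam k).
have sl0 k : 0 < sl k by rewrite sqrtr_gt0.
have slE k : sl k ^+ 2 = lam k by rewrite sqr_sqrtr// ltW.
pose e' k := (sl k)^-1 *: e k.
have e'E k : en (e' k) (e' k) = ip (E k) (E k).
  rewrite (siZl sen) (siZr sen) en_e mulrA -expr2 exprVn slE mulKf//.
  by rewrite gt_eqF.
have oe' : sorthonormal en e'.
  split=> [i j ij|i]; last by rewrite e'E; exact: oE.2.
  by rewrite (siZl sen) (siZr sen) en_e -[J (e j)]/(E j) oE.1// !mulr0.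
have [|u [hu ue]] := @ssum_limit _ _ _ sen _ oe' (fun k => sl k * c k) M cen.
  move=> n; apply: le_trans (fM n); apply: ler_sum => i _.
  rewrite e'E exprMn slE -mulrA expr2 -[c i * c i * _]mulrA cE exprMn -expr2.
  by rewrite ler_wpM2r ?sqr_ge0// expr2 ler_peMr ?(ltW (lam0 i))// eigen_ge1.
have ueE k : en u (e k) = lam k * c k.
  have -> : e k = sl k *: e' k by rewrite scalerA mulfV ?scale1r// gt_eqF.
  by rewrite (siZr sen) ue e'E -slE -mulrA cE mulrA.
exists u, g; split=> [|v].
  apply: coef_eq => k; apply: (mulfI (lt0r_neq0 (lam0 k))).
  by rewrite -ueE (siC sen) en_e (siC sip).
have h1 := @scvg_ip _ _ _ sen _ _ hu v.
have h2 := @scvg_ip _ _ _ sip _ _ hg (J v).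
apply: (cvg_unique (@Rhausdorff R) h1).
rewrite (_ : (fun n => _) = (fun n => ip (\sum_(k < n) (lam k * c k) *: E k) (J v)))//.
apply/funext => n; rewrite (si_suml sip) (si_suml sen); apply: eq_bigr => k _.
rewrite (siZl sip) !(siZl sen) en_e.
by have := slE k; have := sl0 k; move=> s0 <-; field; rewrite gt_eqF.
Qed.

End basis.
End form.

(** * The space L^2 *)

Section sqint.
Context d (T : measurableType d) (R : realType).
Variables (mu : {measure set T -> \bar R}) (D : set T).

Definition sqint : {pred T -> R} := fun f =>
  `[< measurable_fun D f /\ (\int[mu]_(x in D) (f x ^+ 2)%:E < +oo)%E >].

Hypothesis mD : measurable D.

Lemma sqintP (f : T -> R) : reflect
  (measurable_fun D f /\ (\int[mu]_(x in D) (f x ^+ 2)%:E < +oo)%E) (f \in sqint).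
Proof. exact: asboolP. Qed.

Lemma sqint_sq f : f \in sqint -> mu.-integrable D (fun x => (f x ^+ 2)%:E).
Proof.
move=> /sqintP[mf foo]; apply/integrableP; split.
  by apply/measurable_EFinP; exact: measurable_funX.
by under eq_integral do rewrite gee0_abs ?lee_fin ?sqr_ge0//.
Qed.

Lemma sqint_mul f g : f \in sqint -> g \in sqint ->
  mu.-integrable D (fun x => (f x * g x)%:E).
Proof.
move=> hf hg; have [mf _] := sqintP _ hf; have [mg _] := sqintP _ hg.
apply: le_integrable (integrableD mD (sqint_sq hf) (sqint_sq hg)) => //.
  by apply/measurable_EFinP; exact: measurable_funM.
move=> x _; rewrite -EFinD !abse_EFin lee_fin.
rewrite [leRHS]ger0_norm ?addr_ge0 ?sqr_ge0// normrM.
rewrite -(real_normK (num_real (f x))) -(real_normK (num_real (g x))).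
by have := normr_ge0 (f x); have := normr_ge0 (g x); nra.
Qed.

Lemma sqint_le (f g : T -> R) : measurable_fun D f -> g \in sqint ->
  (forall x, D x -> `|f x| <= `|g x|) -> f \in sqint.
Proof.
move=> mf /sqintP[mg goo] fg; apply/sqintP; split=> //; apply: le_lt_trans goo.
apply: ge0_le_integral => // [x _|||x Dx].
- by rewrite lee_fin sqr_ge0.
- by apply/measurable_EFinP; exact: measurable_funX.
- by apply/measurable_EFinP; exact: measurable_funX.
- rewrite lee_fin -[leLHS]real_normK ?num_real// -[leRHS]real_normK ?num_real//.
  by rewrite ler_pXn2r ?nnegrE//; exact: fg.
Qed.

Lemma sqint_submod : submod_closed sqint.
Proof.
split=> [|a f g hf hg].
  apply/sqintP; split; first exact: measurable_cst.
  by under eq_integral do rewrite expr0n/=; rewrite integral0.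
have [mf foo] := sqintP _ hf; have [mg goo] := sqintP _ hg.
have ms : measurable_fun D (a *: f + g).
  by apply: measurable_funD => //; apply: measurable_funM => //; exact: measurable_cst.
apply/sqintP; split => //.
have hi : mu.-integrable D (fun x => ((2 * a ^+ 2)%:E * (f x ^+ 2)%:E + 2%:E * (g x ^+ 2)%:E)%E).
  by apply: integrableD => //; apply: integrableZl => //; exact: sqint_sq.
have /integrableP[_] := hi; apply: le_lt_trans.
apply: ge0_le_integral => // [x _|||x Dx].
- by rewrite lee_fin sqr_ge0.
- by apply/measurable_EFinP; exact: measurable_funX.
- by apply: measurableT_comp => //; have /integrableP[] := hi.
rewrite -!EFinM -EFinD abse_EFin lee_fin [leRHS]ger0_norm.
  have -> : (a *: f + g) x = a * f x + g x by [].
  by have := sqr_ge0 (a * f x - g x); nra.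
by rewrite addr_ge0// mulr_ge0 ?sqr_ge0// mulr_ge0// sqr_ge0.
Qed.

End sqint.

Section L2sp.
Context d (T : measurableType d) (R : realType).
Variables (mu : {measure set T -> \bar R}) (D : set T).

(** Elements are total functions with arbitrary values off D. The proof [mD] is a parameter because
    the vector space structure is built from it. *)
Record L2sp (mD : measurable D) := MkL2sp {
  L2fun :> T -> R;
  L2funP : L2fun \in sqint mu D }.

Variable mD : measurable D.

HB.instance Definition _ := GRing.isSubmodClosed.Build R (T -> R) (sqint mu D)
  (sqint_submod mu mD).
HB.instance Definition _ := [isSub for @L2fun mD].
HB.instance Definition _ := [Choice of L2sp mD by <:].
HB.instance Definition _ := [SubChoice_isSubLmodule of L2sp mD by <:].

End L2sp.

Section L2ip.
Context d (T : measurableType d) (R : realType).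
Variables (mu : {measure set T -> \bar R}) (D : set T) (mD : measurable D).
Local Notation H := (L2sp mu mD).

(* Sealed, so that conversion never unfolds the Lebesgue integral. *)
Lemma ipL2_key : {ip : H -> H -> R | forall f g, ip f g = \int[mu]_(x in D) (f x * g x)}.
Proof. by exists (fun f g => \int[mu]_(x in D) (f x * g x)). Qed.

Definition ipL2 : H -> H -> R := sval ipL2_key.

Lemma ipL2_def f g : ipL2 f g = \int[mu]_(x in D) (f x * g x).
Proof. exact: (svalP ipL2_key). Qed.

Lemma L2mul (f g : H) : mu.-integrable D (fun x => (f x * g x)%:E).
Proof. by apply: sqint_mul => //; exact: L2funP. Qed.

Lemma L2meas (f : H) : measurable_fun D f.
Proof. by have /sqintP[] := L2funP f. Qed.

Lemma ipL2_semi : semi_inner ipL2.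
Proof.
split=> [f g|a f g h|f]; rewrite !ipL2_def.
- by apply: eq_Rintegral => x _; rewrite mulrC.
- rewrite -RintegralZl//; last exact: L2mul.
  rewrite -RintegralD//; last 2 first.
  + have := integrableZl mD a (L2mul f h).
    by apply: eq_integrable => // x _; rewrite EFinM.
  + exact: L2mul.
  apply: eq_Rintegral => x _.
  have -> : (a *: f + g) x = a * f x + g x by [].
  by ring.
- by apply: Rintegral_ge0 => x _; rewrite -expr2 sqr_ge0.
Qed.

Lemma ipL2E (f : H) : (ipL2 f f)%:E = (\int[mu]_(x in D) (f x ^+ 2)%:E)%E.
Proof.
rewrite ipL2_def /Rintegral fineK; last exact: integrable_fin_num (L2mul f f).
by apply: eq_integral => x _; rewrite expr2.
Qed.

Lemma ipL2_eq0 (f : H) : ipL2 f f = 0 <-> {ae mu, forall x, D x -> f x = 0}.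
Proof.
have mf2 : measurable_fun D (fun x => (f x ^+ 2)%:E).
  by apply/measurable_EFinP; apply: measurable_funX; exact: L2meas.
have e : (ipL2 f f)%:E = (\int[mu]_(x in D) `|(f x ^+ 2)%:E|)%E.
  by rewrite ipL2E; apply: eq_integral => x _; rewrite gee0_abs// lee_fin sqr_ge0.
have := ae_eq_integral_abs mu mD mf2; rewrite -e => h; split=> [f0|f0].
  rewrite f0 in h; have := h.1 erefl; apply: filterS => x /[apply] -[]/eqP.
  by rewrite sqrf_eq0 => /eqP.
suff : (ipL2 f f)%:E = 0%E by case.
apply: h.2; move: f0; apply: filterS => x /[apply] ->.
by rewrite expr0n.
Qed.

Lemma ipL2_ae (f g : H) : ipL2 (f - g) (f - g) = 0 <->
  {ae mu, forall x, D x -> f x = g x}.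
Proof.
rewrite ipL2_eq0; split; apply: filterS => x /[apply].
  by move=> /eqP; rewrite subr_eq0 => /eqP.
move=> fg; have -> : (f - g) x = f x - g x by [].
by rewrite fg subrr.
Qed.

Lemma einf_le (u : nat -> \bar R) (c : \bar R) (K : nat) :
  (forall n, (K <= n)%N -> (u n <= c)%E) -> (limn_einf u <= c)%E.
Proof.
move=> uc; rewrite limn_einf_lim; apply: lime_le; first exact: is_cvg_einfs.
apply: nearW => n; apply: ge_ereal_inf; exists (u (maxn n K)).
  by exists (maxn n K) => //=; exact: leq_maxl.
by apply: uc; exact: leq_maxr.
Qed.

(** The factor 4^k makes the increments of order 2^-k, hence absolutely summable. *)
Lemma pointwise_cvg (x : nat -> R) (C : R) :
  (forall k, 4 ^+ k * (x k.+1 - x k) ^+ 2 <= C) -> cvgn x.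
Proof.
move=> xC.
have C0 : 0 <= C by apply: le_trans (xC 0%N); rewrite mulr_ge0 ?sqr_ge0.
have dx k : `|x k.+1 - x k| <= Num.sqrt C * (1/2) ^+ k.
  have p0 : 0 <= Num.sqrt C * (1/2) ^+ k by rewrite mulr_ge0 ?sqrtr_ge0// exprn_ge0.
  rewrite -(@ler_pXn2r _ 2)// ?nnegrE//.
  rewrite real_normK ?num_real// exprMn sqr_sqrtr// -exprM mulnC exprM.
  have -> : (1 / 2 : R) ^+ 2 = 4^-1 by field.
  by rewrite exprVn ler_pdivlMr ?exprn_gt0// mulrC.
have cs : cvgn (series (fun k => x k.+1 - x k)).
  apply: normed_cvg.
  apply: (@series_le_cvg _ _ (geometric (Num.sqrt C) (1/2))) => //.
  - by move=> k /=; exact: normr_ge0.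
  - by move=> k; rewrite /geometric/= mulr_ge0 ?sqrtr_ge0// exprn_ge0.
  - by apply: is_cvg_geometric_series; rewrite ger0_norm//; lra.
have -> : x = (fun n => x 0%N + series (fun k => x k.+1 - x k) n).
  by apply/funext => n; rewrite /series/= telescope_sumr//; ring.
by apply: is_cvgD => //; exact: is_cvg_cst.
Qed.

(** Along a subsequence whose increments have squared norm below 8^-k, the series of 4^k times the
    squared increments is integrable. It is therefore finite almost everywhere, which gives
    pointwise convergence; Fatou's lemma transfers the Cauchy estimates to the limit. *)
Lemma ipL2_complete : scomplete ipL2.
Proof.
move=> u cu.
have sb := ipL2_semi.
have hN k : exists N, forall m n, (N <= m)%N -> (N <= n)%N ->
    ipL2 (u m - u n) (u m - u n) < ((1/8) ^+ k).
  by apply: cu; rewrite exprn_gt0.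
have [N Nh] := choice hN.
pose p := fix p k := if k is k'.+1 then maxn (p k') (N k) else N 0%N.
have Np k : (N k <= p k)%N by case: k => //= k; exact: leq_maxr.
have pS k : (p k <= p k.+1)%N by exact: leq_maxl.
pose v k := u (p k).
pose g k (x : T) := 4 ^+ k * (v k.+1 x - v k x) ^+ 2.
have g0 k x : 0 <= g k x by rewrite mulr_ge0 ?sqr_ge0// exprn_ge0.
have mg k : measurable_fun D (fun x => (g k x)%:E).
  apply/measurable_EFinP; apply: measurable_funM; first exact: measurable_cst.
  by apply: measurable_funX; apply: measurable_funB; exact: L2meas.
have ig k : (\int[mu]_(x in D) (g k x)%:E <= ((1/2) ^+ k)%:E)%E.
  under eq_integral do rewrite EFinM.
  rewrite ge0_integralZl//; first last.
    by move=> x _; rewrite lee_fin sqr_ge0.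
    by apply/measurable_EFinP; apply: measurable_funX; apply: measurable_funB; exact: L2meas.
  have := ipL2E (v k.+1 - v k); have -> : (fun x => ((v k.+1 - v k) x ^+ 2)%:E) =
    (fun x => ((v k.+1 x - v k x) ^+ 2)%:E) by [].
  move=> <-; rewrite -EFinM lee_fin.
  apply: le_trans (_ : 4 ^+ k * (1/8) ^+ k <= _).
    by rewrite ler_wpM2l ?exprn_ge0// ltW// Nh// ?Np// (leq_trans (Np k)).
  by rewrite -exprMn (_ : 4 * (1/8) = 1/2 :> R)//; field.
pose S x := (\sum_(k <oo) (g k x)%:E)%E.
have mS : measurable_fun D S.
  have := @ge0_emeasurable_sum _ _ _ D (fun k x => (g k x)%:E) xpredT.
  by apply => // k x _ _; rewrite lee_fin.
have S0 x : (0 <= S x)%E by apply: nneseries_ge0 => k _ _; rewrite lee_fin.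
have iS : (\int[mu]_(x in D) S x < +oo)%E.
  rewrite integral_nneseries//; last by move=> k x _; rewrite lee_fin.
  apply: le_lt_trans (_ : (\sum_(k <oo) ((1/2) ^+ k)%:E < +oo)%E).
    apply: lee_nneseries => [k _ _|k _]; last exact: ig.
    by apply: integral_ge0 => x _; rewrite lee_fin.
  apply: le_lt_trans (ltry 2); apply: lime_le.
    by apply: is_cvg_nneseries => k _ _; rewrite lee_fin exprn_ge0.
  apply: nearW => n; rewrite sumEFin lee_fin.
  have : \sum_(0 <= i < n) (1/2 : R) ^+ i = 2 - 2 * (1/2) ^+ n.
    elim: n => [|n IH]; first by rewrite big_geq// expr0; ring.
    by rewrite big_nat_recr//= IH exprS; field.
  by move=> ->; rewrite gerBl mulr_ge0// exprn_ge0.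
have iSi : mu.-integrable D S.
  apply/integrableP; split=> //; under eq_integral do rewrite gee0_abs//.
  exact: iS.
have Sfin := integrable_ae mD iSi.
pose A := D `&` [set x | (S x < +oo)%E].
have mA : measurable A by exact: emeasurable_fun_infty_o.
have Acvg x : A x -> cvgn (v ^~ x).
  move=> [Dx /= Sx].
  apply: (@pointwise_cvg _ (fine (S x))) => k.
  rewrite -/(g k x) -lee_fin fineK ?ge0_fin_numE//.
  apply: le_trans (nneseries_lim_ge k.+1 _); last by move=> i _; rewrite lee_fin.
  by rewrite big_nat_recr//= leeDr// sume_ge0// => i _; rewrite lee_fin.
pose f x := if pselect (A x) then limn (v ^~ x) else 0.
(* Cutting with the indicator of A makes [h (v n)] converge to f at every point of D, so that f is
   measurable as a pointwise limit. *)
pose h (w : T -> R) x := \1_A x * w x.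
have mh w : measurable_fun D w -> measurable_fun D (h w).
  by move=> mw; apply: measurable_funM => //; apply: measurable_funTS; exact: measurable_indic.
have fcv x : D x -> h (v n) x @[n --> \oo] --> f x.
  move=> Dx; rewrite /f /h; case: pselect => [Ax|nAx].
    under eq_fun do rewrite indicE mem_set// mul1r.
    exact: Acvg.
  under eq_fun do rewrite indicE memNset// mul0r.
  exact: cvg_cst.
have mf : measurable_fun D f.
  by apply: (measurable_fun_cvg (h := fun n => h (v n))) => // n; apply: mh; exact: L2meas.
have main k n : (p k <= n)%N -> (\int[mu]_(x in D) ((f x - u n x) ^+ 2)%:E <= ((1/8) ^+ k)%:E)%E.
  move=> kn.
  pose G m x := ((h (v m) x - h (u n) x) ^+ 2)%:E.
  have -> : (\int[mu]_(x in D) ((f x - u n x) ^+ 2)%:E = \int[mu]_(x in D) limn_einf (G ^~ x))%E.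
    have GE x : D x -> limn_einf (G ^~ x) = ((f x - h (u n) x) ^+ 2)%:E.
      move=> Dx; suff hc : G ^~ x @ \oo --> ((f x - h (u n) x) ^+ 2)%:E.
        by rewrite is_cvg_limn_einfE; [exact: cvg_lim|exact: cvgP hc].
      apply/fine_cvgP; split; first exact: nearW.
      rewrite /comp/= /G/=; under eq_fun do rewrite expr2.
      by rewrite expr2; apply: cvgM; apply: cvgB; try exact: fcv; exact: cvg_cst.
    apply: ge0_ae_eq_integral => //.
    - by apply/measurable_EFinP; apply: measurable_funX; apply: measurable_funB => //; exact: L2meas.
    - apply: (eq_measurable_fun (fun x => ((f x - h (u n) x) ^+ 2)%:E)).
        by move=> x /set_mem Dx; rewrite GE.
      apply/measurable_EFinP; apply: measurable_funX; apply: measurable_funB => //.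
      by apply: mh; exact: L2meas.
    - by move=> x _; rewrite lee_fin sqr_ge0.
    - by move=> x Dx; rewrite GE// lee_fin sqr_ge0.
    - move: Sfin; apply: filterS => x Sx Dx; rewrite GE//.
      have Ax : A x by split=> //=; rewrite -ge0_fin_numE//; exact: Sx.
      by rewrite /h indicE mem_set// mul1r.
  apply: le_trans (fatou mu mD _ _) _.
  - move=> m; apply/measurable_EFinP; apply: measurable_funX; apply: measurable_funB; apply: mh; exact: L2meas.
  - by move=> m x _; rewrite lee_fin sqr_ge0.
  apply: (@einf_le _ _ k) => m km.
  apply: le_trans (_ : (ipL2 (v m - u n) (v m - u n))%:E <= _)%E; last first.
    rewrite lee_fin ltW// Nh// ?(leq_trans (Np k))//.
    have : {homo p : x y / (x <= y)%N} by apply: homo_leq => //; exact: leq_trans.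
    exact.
  rewrite ipL2E; apply: ge0_le_integral => //.
  - by move=> x _; rewrite lee_fin sqr_ge0.
  - apply/measurable_EFinP; apply: measurable_funX; apply: measurable_funB; apply: mh; exact: L2meas.
  - by apply/measurable_EFinP; apply: measurable_funX; apply: measurable_funB; exact: L2meas.
  - move=> x Dx; rewrite lee_fin /h -mulrBr exprMn.
    rewrite ler_piMl ?sqr_ge0// indicE; case: (_ \in _); by rewrite ?expr1n ?expr0n.
have hfu : (fun x => f x - u (p 0%N) x) \in sqint mu D.
  apply/sqintP; split; first by apply: measurable_funB => //; exact: L2meas.
  by apply: le_lt_trans (main 0%N _ (leqnn _)) _; rewrite ltry.
have hf : f \in sqint mu D.
  have -> : f = L2fun (MkL2sp mD hfu + u (p 0%N)) by apply/funext => x /=; rewrite [RHS]subrK.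
  exact: L2funP.
exists (MkL2sp mD hf); apply/cvgrPdist_lt => e e0.
have : (1/8 : R) ^+ k @[k --> \oo] --> (0 : R) by apply: cvg_expr; rewrite ger0_norm; lra.
move=> /cvgrPdist_lt/(_ _ e0)[k _ hk].
exists (p k) => // n /= kn.
rewrite sub0r normrN ger0_norm; last exact: si_ge0.
rewrite (siB_sym sb); apply: le_lt_trans (_ : (1/8) ^+ k < _).
  by rewrite -lee_fin ipL2E; exact: main.
have := hk k (leqnn k); rewrite /= sub0r normrN; apply: le_lt_trans; exact: ler_norm.
Qed.

End L2ip.

(** * Poincare's inequality on boxes *)

Section bs.
Context d (T : measurableType d) (R : realType).
Implicit Types (B : set T) (f g : T -> R).

(** Bounded measurable functions vanishing off B: once B has finite measure, every integrability and
    Fubini condition on this class is automatic. *)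
Definition bs B f := [/\ measurable_fun setT f,
  (exists M, forall x, `|f x| <= M) & forall x, ~ B x -> f x = 0].

Lemma bs_bound B f : bs B f -> exists2 M, 0 < M & forall x, `|f x| <= M.
Proof.
move=> [_ [M hM] _]; exists (`|M| + 1); first by rewrite ltr_wpDl.
by move=> x; apply: le_trans (hM x) _; apply: le_trans (ler_norm _) _; rewrite lerDl.
Qed.

Lemma bsD B f g : bs B f -> bs B g -> bs B (fun x => f x + g x).
Proof.
move=> hf hg; have [M _ hM] := bs_bound hf; have [N _ hN] := bs_bound hg.
have [mf _ f0] := hf; have [mg _ g0] := hg; split.
- exact: measurable_funD.
- by exists (M + N) => x; rewrite (le_trans (ler_normD _ _))// lerD.
- by move=> x nB; rewrite f0// g0// addr0.
Qed.

Lemma bsM B f g : bs B f -> measurable_fun setT g -> (exists M, forall x, `|g x| <= M) ->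
  bs B (fun x => f x * g x).
Proof.
move=> hf mg [N hN]; have [M M0 hM] := bs_bound hf.
have [mf _ f0] := hf; split.
- exact: measurable_funM.
- by exists (M * N) => x; rewrite normrM ler_pM.
- by move=> x nB; rewrite f0// mul0r.
Qed.

Lemma bsMl B f g : bs B f -> measurable_fun setT g -> (exists M, forall x, `|g x| <= M) ->
  bs B (fun x => g x * f x).
Proof.
move=> hf mg bg; have := bsM hf mg bg.
by congr bs; apply/funext => x; rewrite mulrC.
Qed.

Lemma indic_bounded (A : set T) : exists M : R, forall x, `|\1_A x : R| <= M.
Proof.
by exists 1 => x; rewrite indicE; case: (_ \in _); rewrite ?normr1 ?normr0.
Qed.

Lemma bsMbs B f g : bs B f -> bs B g -> bs B (fun x => f x * g x).
Proof. by move=> hf [mg bg _]; exact: bsM. Qed.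

Lemma bsX2 B f : bs B f -> bs B (fun x => f x ^+ 2).
Proof. by move=> hf; under eq_fun do rewrite expr2; exact: bsMbs. Qed.

Lemma bs_cst_mul B (c : R) f : bs B f -> bs B (fun x => c * f x).
Proof.
move=> hf; under eq_fun do rewrite mulrC.
by apply: bsM => //; exists `|c|.
Qed.

Lemma bsB B f g : bs B f -> bs B g -> bs B (fun x => f x - g x).
Proof.
move=> hf hg; under eq_fun do rewrite -mulN1r.
by apply: bsD => //; exact: bs_cst_mul.
Qed.

Lemma bs0 B : bs B (fun=> 0).
Proof. by split=> //; exists 0 => x; rewrite normr0. Qed.

Lemma bs_sum B I (r : seq I) (F : I -> T -> R) : (forall i, bs B (F i)) ->
  bs B (fun x => \sum_(i <- r) F i x).
Proof.
move=> hF; elim: r => [|i r IH].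
  by under eq_fun do rewrite big_nil; exact: bs0.
by under eq_fun do rewrite big_cons; exact: bsD.
Qed.

Lemma bs_indic B A : measurable A -> A `<=` B -> bs B (\1_A : T -> R).
Proof.
move=> mA AB; split=> [||x nB]; first exact: measurable_indic.
  exists 1 => x; rewrite indicE; case: (_ \in _); by rewrite ?normr1 ?normr0.
by rewrite indicE memNset// => /AB.
Qed.

Lemma bs_sub B B' f : B `<=` B' -> bs B f -> bs B' f.
Proof. by move=> BB [? ? f0]; split=> // x nB; apply: f0 => /BB. Qed.

Lemma bs_ind_mul B A f : measurable A -> bs B f -> bs A (fun x => \1_A x * f x).
Proof.
move=> mA [mf bf f0]; have h := bs_indic mA (@subset_refl _ A).
exact: bsM.
Qed.

Variable mu : {measure set T -> \bar R}.

Definition finmeas B := measurable B /\ (mu B < +oo)%E.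

Lemma bs_integrable B f : finmeas B -> bs B f -> mu.-integrable setT (EFin \o f).
Proof.
move=> [mB Boo] hf; have [M M0 hM] := bs_bound hf; have [mf _ f0] := hf.
have hi : mu.-integrable setT (fun x => (M%:E * (\1_B x)%:E)%E).
  apply: integrableZl => //; apply/integrableP; split.
    by apply/measurable_EFinP; exact: measurable_indic.
  under eq_integral do rewrite gee0_abs ?lee_fin//.
  by rewrite integral_indic// setIT.
apply: le_integrable hi => //; first exact/measurable_EFinP.
move=> x _; rewrite -EFinM !abse_EFin lee_fin indicE.
have [/set_mem Bx|/negP nB] := boolP (x \in B).
  by rewrite mulr1 (le_trans (hM x))// ler_norm.
by rewrite f0 ?normr0// => Bx; apply: nB; exact: mem_set.
Qed.

Lemma bs_Rint_ind A f : \int[mu]_(x in A) f x = \int[mu]_x (\1_A x * f x).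
Proof.
rewrite Rintegral_mkcond; apply: eq_Rintegral => x _.
by rewrite patchE indicE; case: (_ \in _); rewrite ?mul1r ?mul0r.
Qed.

Lemma bs_intD B f g : finmeas B -> bs B f -> bs B g ->
  \int[mu]_x (f x + g x) = \int[mu]_x f x + \int[mu]_x g x.
Proof. by move=> fB hf hg; rewrite RintegralD//; exact: bs_integrable fB _. Qed.

Lemma bs_intB B f g : finmeas B -> bs B f -> bs B g ->
  \int[mu]_x (f x - g x) = \int[mu]_x f x - \int[mu]_x g x.
Proof. by move=> fB hf hg; rewrite RintegralB//; exact: bs_integrable fB _. Qed.

Lemma bs_intZ B f c : finmeas B -> bs B f ->
  \int[mu]_x (c * f x) = c * \int[mu]_x f x.
Proof. by move=> fB hf; rewrite RintegralZl//; exact: bs_integrable fB _. Qed.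

Lemma bs_int_le B f g : finmeas B -> bs B f -> bs B g -> (forall x, f x <= g x) ->
  \int[mu]_x f x <= \int[mu]_x g x.
Proof.
by move=> fB hf hg fg; apply: le_Rintegral => //; exact: bs_integrable fB _.
Qed.

Lemma bs_int_sum B I (r : seq I) (F : I -> T -> R) : finmeas B -> (forall i, bs B (F i)) ->
  \int[mu]_x (\sum_(i <- r) F i x) = \sum_(i <- r) \int[mu]_x F i x.
Proof.
move=> fB hF; elim: r => [|i r IH].
  under eq_Rintegral do rewrite big_nil; rewrite big_nil.
  by rewrite Rintegral_cst// mul0r.
under eq_Rintegral do rewrite big_cons; rewrite big_cons.
by rewrite (bs_intD fB) ?IH//; exact: bs_sum.
Qed.

Lemma bs_int_ind A : finmeas A -> \int[mu]_x (\1_A x : R) = fine (mu A).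
Proof. by move=> [mA _]; rewrite /Rintegral integral_indic// setIT. Qed.

Lemma bs_sqint B f : finmeas B -> bs B f -> f \in sqint mu setT.
Proof.
move=> fB hf; apply/sqintP; split; first by have [] := hf.
have /integrableP[_] := bs_integrable fB (bsX2 hf).
by under eq_integral do rewrite gee0_abs ?lee_fin ?sqr_ge0//.
Qed.

Lemma bs_cs B f g : finmeas B -> bs B f -> bs B g ->
  (\int[mu]_x (f x * g x)) ^+ 2 <= \int[mu]_x (f x ^+ 2) * \int[mu]_x (g x ^+ 2).
Proof.
move=> fB hf hg.
have := si_cs (ipL2_semi mu measurableT) (MkL2sp measurableT (bs_sqint fB hf))
  (MkL2sp measurableT (bs_sqint fB hg)).
by rewrite !ipL2_def/=; under [X in _ <= X * _ -> _]eq_Rintegral do rewrite -expr2;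
  under [X in _ <= _ * X -> _]eq_Rintegral do rewrite -expr2.
Qed.

Lemma bs_jensen A B f : finmeas A -> bs B f ->
  (\int[mu]_x (\1_A x * f x)) ^+ 2 <= fine (mu A) * \int[mu]_x (\1_A x * f x ^+ 2).
Proof.
move=> fA hf; have [mA _] := fA.
have h1 := bs_indic mA (@subset_refl _ A).
have := bs_cs fA h1 (bs_ind_mul mA hf).
have E x : \1_A x * \1_A x = \1_A x :> R.
  by rewrite indicE; case: (_ \in _); rewrite ?mulr1 ?mulr0.
under eq_Rintegral do rewrite mulrA E.
under [X in _ <= X * _ -> _]eq_Rintegral do rewrite expr2 E.
rewrite (bs_int_ind fA).
by under [X in _ <= _ * X -> _]eq_Rintegral do rewrite exprMn expr2 E.
Qed.

End bs.

Section bs_fubini.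
Context d1 d2 (T1 : measurableType d1) (T2 : measurableType d2) (R : realType).
Variables (m1 : {sigma_finite_measure set T1 -> \bar R}).
Variables (m2 : {sigma_finite_measure set T2 -> \bar R}).
Variables (B1 : set T1) (B2 : set T2).
Hypotheses (fB1 : finmeas m1 B1) (fB2 : finmeas m2 B2).

Lemma finmeasX : finmeas (m1 \x m2)%E (B1 `*` B2).
Proof.
case: fB1 fB2 => [mB1 B1oo] [mB2 B2oo]; split; first exact: measurableX.
suff : (m1 B1 * m2 B2 < +oo)%E by rewrite -(product_measure1E m1 m2 mB1 mB2).
by rewrite lte_mul_pinfty// ge0_fin_numE.
Qed.

Variable f : T1 * T2 -> R.
Hypothesis hf : bs (B1 `*` B2) f.

Lemma bs_slice1 x : bs B2 (fun y => f (x, y)).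
Proof.
have [mf bf f0] := hf; split.
- by apply: (measurableT_comp mf); exact: measurable_pair1.
- by have [M hM] := bf; exists M => y.
- by move=> y ny; apply: f0 => -[].
Qed.

Lemma bs_slice2 y : bs B1 (fun x => f (x, y)).
Proof.
have [mf bf f0] := hf; split.
- by apply: (measurableT_comp mf); exact: measurable_pair2.
- by have [M hM] := bf; exists M => x.
- by move=> x nx; apply: f0 => -[].
Qed.

Let fi : (m1 \x m2)%E.-integrable setT (EFin \o f).
Proof. exact: bs_integrable finmeasX hf. Qed.

Lemma bs_fubini1 : \int[(m1 \x m2)%E]_z f z = \int[m1]_x \int[m2]_y f (x, y).
Proof.
rewrite /Rintegral -(integral12_prod_meas1 fi); congr fine.
apply: eq_integral => x _ /=; rewrite fineK//.
exact: integrable_fin_num (bs_integrable fB2 (bs_slice1 x)).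
Qed.

Lemma bs_fubini2 : \int[(m1 \x m2)%E]_z f z = \int[m2]_y \int[m1]_x f (x, y).
Proof.
rewrite /Rintegral -(integral21_prod_meas1 fi); congr fine.
apply: eq_integral => x _ /=; rewrite fineK//.
exact: integrable_fin_num (bs_integrable fB1 (bs_slice2 x)).
Qed.

Lemma bs_fubini_G : bs B2 (fun y => \int[m1]_x f (x, y)).
Proof.
have [mf bf f0] := hf; have [M M0 hM] := bs_bound hf; split.
- have := measurable_fubini_G fi.
  by move=> /(fun h => measurableT_comp (fine_measurable measurableT) h).
- exists (M * fine (m1 B1)) => x.
  have hs := bs_slice2 x; have [mB1 _] := fB1.
  have h1 : bs B1 (\1_B1 : _ -> R) by exact: bs_indic.
  apply: le_trans (le_normr_Rintegral _ (bs_integrable fB1 hs)) _ => //.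
  rewrite -(bs_int_ind fB1) -(bs_intZ _ fB1)//.
  apply: (bs_int_le fB1); last first.
  + move=> y; rewrite indicE; have [/set_mem By|/negP nB] := boolP (y \in B1).
      by rewrite mulr1.
    by rewrite mulr0 f0 ?normr0// => -[/mem_set].
  + exact: bs_cst_mul.
  + have [ms _ s0] := hs; split; first exact: measurableT_comp.
      by exists M => y; rewrite normr_id.
    by move=> y /s0 ->; rewrite normr0.
- move=> y ny; rewrite (_ : (fun x => f (x, y)) = cst 0) ?Rintegral_cst ?mul0r//.
  by apply/funext => x; rewrite f0// => -[].
Qed.

End bs_fubini.

Section poincare1.
Context {R : realType}.
Local Notation leb := (@lebesgue_measure R).

Lemma finmeas_itv (b1 b2 : bool) (a b : R) :
  finmeas leb [set` Interval (BSide b1 a) (BSide b2 b)].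
Proof.
split; first exact: measurable_itv.
suff : ((lebesgue_measure : set R -> \bar R)
    [set` Interval (BSide b1 a) (BSide b2 b)] < +oo)%E by [].
by rewrite lebesgue_measure_itv/=; case: ifP => // _; rewrite -EFinB; exact: ltry.
Qed.

Lemma itv_len (b1 b2 : bool) (a b : R) : a <= b ->
  fine (leb [set` Interval (BSide b1 a) (BSide b2 b)]) = b - a.
Proof.
move=> ab; suff : fine ((lebesgue_measure : set R -> \bar R)
    [set` Interval (BSide b1 a) (BSide b2 b)]) = b - a by [].
rewrite lebesgue_measure_itv /= lte_fin; case: ltP => // ba.
have -> : a = b by apply/eqP; rewrite eq_le ab ba.
by rewrite subrr.
Qed.

(** By Cauchy-Schwarz the squared increments of f within I are at most k = eta times the integral of
    g^2. Averaging, f stays within sqrt k of its mean m on I, and the integral of f^2 is eta m^2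
    plus that of (f - m)^2. *)
Lemma poincare1 B I (f g : R -> R) (a eta : R) : I = `[a, a + eta[%classic ->
  0 < eta -> finmeas leb B ->
  bs B f -> bs B g ->
  (forall x y, x <= y -> f y - f x = \int[leb]_(t in `[x, y]) g t) ->
  \int[leb]_t (\1_I t * f t ^+ 2) <=
    eta^-1 * (\int[leb]_t (\1_I t * f t)) ^+ 2 +
    eta ^+ 2 * \int[leb]_t (\1_I t * g t ^+ 2).
Proof.
move=> IE eta0 fB hf hg fg.
have inI t : I t <-> a <= t < a + eta by rewrite IE /= in_itv.
have fI : finmeas leb I by rewrite IE; exact: finmeas_itv.
have mI := fI.1.
have lI : fine (leb I) = eta by rewrite IE itv_len ?lerDl ?ltW//; ring.
have bI : bs I (\1_I : _ -> R) by exact: bs_indic.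
pose q := \int[leb]_t (\1_I t * g t ^+ 2); pose k := eta * q.
have bIg := bs_ind_mul mI (bsX2 hg).
have bIf := bs_ind_mul mI hf.
have bIf2 := bs_ind_mul mI (bsX2 hf).
have inc x y : I x -> I y -> (f y - f x) ^+ 2 <= k.
  wlog xy : x y / x <= y.
    move=> h Ix Iy; have [xy|/ltW xy] := leP x y; first exact: h.
    by rewrite -sqrrN opprB; exact: h.
  move=> Ix Iy; rewrite fg// bs_Rint_ind.
  have fxy := @finmeas_itv true false x y.
  apply: le_trans (bs_jensen fxy hg) _; rewrite itv_len// /k.
  move: Ix Iy => /inI/andP[ax xa] /inI/andP[ay ya].
  apply: ler_pM; [by rewrite subr_ge0| |lra|].
    by apply: Rintegral_ge0 => t _; rewrite mulr_ge0 ?sqr_ge0.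
  apply: (bs_int_le fI) => //.
    apply: bs_sub (bs_ind_mul fxy.1 (bsX2 hg)).
    by move=> t; rewrite /= in_itv/= => /andP[? ?]; apply/inI/andP; split; lra.
  move=> t; rewrite ler_wpM2r ?sqr_ge0// !indicE ler_nat.
  case: (boolP (t \in _)) => // /set_mem; rewrite /= in_itv/= => /andP[xt ty].
  by rewrite mem_set//; apply/inI/andP; split; lra.
pose m := eta^-1 * \int[leb]_t (\1_I t * f t).
have k0 : 0 <= k.
  by rewrite mulr_ge0 ?(ltW eta0)//; apply: Rintegral_ge0 => t _; rewrite mulr_ge0 ?sqr_ge0.
have dev y : I y -> (f y - m) ^+ 2 <= k.
  move=> Iy.
  have E : eta * (f y - m) = \int[leb]_x (\1_I x * (f y - f x)).
    under eq_Rintegral do rewrite mulrBr [X in X - _]mulrC.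
    rewrite (bs_intB fI)//; last exact: bs_cst_mul.
    rewrite (bs_intZ _ fI)// bs_int_ind// lI /m; field.
    by rewrite gt_eqF.
  have hcf : bs I (fun x => \1_I x * (f y - f x)).
    under eq_fun do rewrite mulrBr [X in X - _]mulrC.
    by apply: bsB => //; exact: bs_cst_mul.
  have : (eta * (f y - m)) ^+ 2 <= eta * (eta * k).
    rewrite E.
    have E2 x : \1_I x * (f y - f x) = \1_I x * (\1_I x * (f y - f x)) :> R.
      by rewrite indicE; case: (_ \in _); rewrite ?mul1r ?mul0r.
    under eq_Rintegral do rewrite E2.
    apply: le_trans (bs_jensen fI hcf) _; rewrite lI ler_wpM2l ?(ltW eta0)//.
    apply: le_trans (_ : \int[leb]_x (k * \1_I x) <= _); last first.
      by rewrite (bs_intZ _ fI)// bs_int_ind// lI mulrC.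
    apply: (bs_int_le fI) => [||x]; first exact: bs_ind_mul (bsX2 hcf).
      exact: bs_cst_mul.
    rewrite indicE; have [/set_mem Ix|_] := boolP (x \in I); last by rewrite !mul0r mulr0.
    by rewrite !mul1r mulr1; exact: inc.
  by rewrite exprMn [X in _ <= X]mulrA -expr2 ler_pM2l ?exprn_gt0.
have E3 t : \1_I t * (f t - m) ^+ 2 =
    \1_I t * f t ^+ 2 + ((- 2 * m) * (\1_I t * f t) + m ^+ 2 * \1_I t) by ring.
have h1 : \int[leb]_t (\1_I t * (f t - m) ^+ 2) <= eta * k.
  apply: le_trans (_ : \int[leb]_x (k * \1_I x) <= _); last first.
    by rewrite (bs_intZ _ fI)// bs_int_ind// lI mulrC.
  apply: (bs_int_le fI) => [||x].
  - under eq_fun do rewrite E3.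
    by apply: bsD => //; apply: bsD; exact: bs_cst_mul.
  - exact: bs_cst_mul.
  - rewrite indicE; have [/set_mem Ix|_] := boolP (x \in I); last by rewrite mul0r mulr0.
    by rewrite mul1r mulr1; exact: dev.
have : \int[leb]_t (\1_I t * (f t - m) ^+ 2) =
    \int[leb]_t (\1_I t * f t ^+ 2) - eta * m ^+ 2.
  under eq_Rintegral do rewrite E3.
  rewrite (bs_intD fI)//; last by apply: bsD; exact: bs_cst_mul.
  rewrite (bs_intD fI) ?(bs_intZ _ fI)//; try exact: bs_cst_mul.
  rewrite bs_int_ind// lI.
  have -> : \int[leb]_t (\1_I t * f t) = eta * m by rewrite /m mulVKf// gt_eqF.
  by ring.
have -> : eta^-1 * (\int[leb]_t (\1_I t * f t)) ^+ 2 = eta * m ^+ 2.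
  by rewrite /m; field; rewrite gt_eqF.
have -> : eta ^+ 2 * \int[leb]_t (\1_I t * g t ^+ 2) = eta * k.
  by rewrite /k expr2 mulrA.
move=> E; rewrite E in h1; lra.
Qed.

End poincare1.

(** * Integration on R^n one coordinate at a time *)

Section rV.
Context {R : realType}.
Local Notation leb := (@lebesgue_measure R).
Local Notation mu n := (lebesgue_rV (R := R) n).

Definition setc n (x : 'rV[R]_n) (i : 'I_n) (t : R) : 'rV[R]_n :=
  \row_j if j == i then t else x ord0 j.

(** Parametrized by the half side, so that [cube L] is convertible to [box (L / 2)]. *)
Definition box n (L : R) : set 'rV[R]_n := [set x | forall i, - L < x ord0 i < L].

Lemma setc_cons0 n t (x : 'rV[R]_n) s : setc (rV_cons (t, x)) ord0 s = rV_cons (s, x).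
Proof.
apply/rowP => j; rewrite !mxE; case: (unliftP ord0 j) => [k ->|->] /=.
  by [].
by [].
Qed.

Lemma setc_consS n t (x : 'rV[R]_n) i s :
  setc (rV_cons (t, x)) (lift ord0 i) s = rV_cons (t, setc x i s).
Proof.
apply/rowP => j; rewrite !mxE; case: (unliftP ord0 j) => [k ->|->] /=.
  by rewrite (inj_eq lift_inj) !mxE.
by [].
Qed.

Lemma setc_id n (x : 'rV[R]_n) i : setc x i (x ord0 i) = x.
Proof. by apply/rowP => j; rewrite !mxE; case: eqP => [->|]. Qed.

Lemma setcE n (x : 'rV[R]_n) i t j : setc x i t ord0 j = if j == i then t else x ord0 j.
Proof. by rewrite mxE. Qed.

Lemma rV_consE0 n (p : R * 'rV[R]_n) : rV_cons p ord0 ord0 = p.1.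
Proof. by rewrite mxE unlift_none. Qed.

Lemma rV_consES n (p : R * 'rV[R]_n) j : rV_cons p ord0 (lift ord0 j) = p.2 ord0 j.
Proof. by rewrite mxE liftK. Qed.

Lemma rV_unconsK n : cancel (@rV_uncons R n) (@rV_cons R n).
Proof.
move=> x; apply/rowP => j; case: (unliftP ord0 j) => [k ->|->].
  by rewrite rV_consES mxE.
by rewrite rV_consE0.
Qed.

Lemma box_cons n L : @rV_cons R n @^-1` (@box n.+1 L) = `]-L, L[ `*` @box n L.
Proof.
apply/seteqP; split=> -[t x] /=.
  move=> h; split=> [|i]; first by rewrite in_itv/=; have := h ord0; rewrite rV_consE0.
  by have := h (lift ord0 i); rewrite rV_consES.
move=> [tL h] i; case: (unliftP ord0 i) => [k ->|->]; rewrite ?rV_consES ?rV_consE0//.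
Qed.

Lemma measurable_box n L : measurable (@box n L).
Proof.
elim: n => [|n IH].
  rewrite (_ : @box 0 L = setT)//; apply/seteqP; split=> // x _ i; by case: i.
have -> : @box n.+1 L = @rV_uncons R n @^-1` (`]-L, L[ `*` @box n L).
  rewrite -box_cons -comp_preimage (_ : _ \o _ = id) ?preimage_id//.
  by apply/funext => x; exact: rV_unconsK.
rewrite -[X in measurable X]setTI; apply: measurable_rV_uncons => //.
exact: measurableX.
Qed.

Lemma finmeas_box n L : finmeas (mu n) (@box n L).
Proof.
split; first exact: measurable_box.
elim: n => [|n IH]; first by rewrite /= diracE; case: (_ \in _); rewrite ltry.
have : ((leb \x mu n)%E (@rV_cons R n @^-1` (@box n.+1 L)) < +oo)%E.
  rewrite box_cons; apply: (finmeasX (m1 := leb) (m2 := mu n) _ _).2.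
    exact: finmeas_itv.
  by split; first exact: measurable_box.
exact.
Qed.

Lemma bs_cons n L (F : 'rV[R]_n.+1 -> R) : bs (@box n.+1 L) F -> bs (`]-L, L[ `*` @box n L) (F \o @rV_cons R n).
Proof.
move=> [mF [M bF] F0]; split.
- by apply: measurableT_comp => //; exact: measurable_rV_cons.
- by exists M => x; exact: bF.
- by move=> p np; apply: F0; rewrite -box_cons in np.
Qed.

Lemma Rint_cons n L (F : 'rV[R]_n.+1 -> R) : bs (@box n.+1 L) F ->
  \int[mu n.+1]_x F x = \int[(leb \x mu n)%E]_p F (rV_cons p).
Proof.
move=> hF; have [mF _ _] := hF; rewrite /Rintegral; congr fine.
pose M : {measure set _ -> \bar R} := (leb \x mu n)%E.
have := @integral_pushforward _ _ (measurableTypeR R * 'rV[R]_n)%type 'rV[R]_n.+1 R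
  (@rV_cons R n) (@measurable_rV_cons R n) M setT (EFin \o F).
rewrite preimage_setT => -> //; first exact/measurable_EFinP.
by apply: (bs_integrable (finmeasX (finmeas_itv _ _ _ _) (finmeas_box n L)) (bs_cons hF)).
Qed.

Lemma Rint_cons1 n L (F : 'rV[R]_n.+1 -> R) : bs (@box n.+1 L) F ->
  \int[mu n.+1]_x F x = \int[leb]_t \int[mu n]_x F (rV_cons (t, x)).
Proof.
move=> hF; rewrite (Rint_cons hF).
exact: (bs_fubini1 (finmeas_itv _ _ _ _) (finmeas_box n L) (bs_cons hF)).
Qed.

Lemma Rint_cons2 n L (F : 'rV[R]_n.+1 -> R) : bs (@box n.+1 L) F ->
  \int[mu n.+1]_x F x = \int[mu n]_x \int[leb]_t F (rV_cons (t, x)).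
Proof.
move=> hF; rewrite (Rint_cons hF).
exact: (bs_fubini2 (finmeas_itv _ _ _ _) (finmeas_box n L) (bs_cons hF)).
Qed.

Lemma bs_cons_x n L (F : 'rV[R]_n.+1 -> R) t : bs (@box n.+1 L) F -> bs (@box n L) (fun x => F (rV_cons (t, x))).
Proof. by move=> hF; exact: (bs_slice1 (bs_cons hF)). Qed.

Lemma bs_cons_t n L (F : 'rV[R]_n.+1 -> R) x : bs (@box n.+1 L) F -> bs `]-L, L[ (fun t => F (rV_cons (t, x))).
Proof. by move=> hF; exact: (bs_slice2 (bs_cons hF)). Qed.

(* Functions that are absolutely continuous on the lines parallel to the axes,
   with bounded partial derivatives g; unlike C^1 functions, they are stable
   under partial integration by Fubini's theorem alone. *)
Definition acl n L (F : 'rV[R]_n -> R) (g : 'I_n -> 'rV[R]_n -> R) :=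
  [/\ bs (box L) F, forall i, bs (box L) (g i) &
      forall i x a b, a <= b ->
        F (setc x i b) - F (setc x i a) = \int[leb]_(t in `[a, b]) g i (setc x i t)].

(** Fubini puts the coordinate i innermost, by induction when it is not the first. The fundamental
    theorem then leaves the values of F at -L and L, which vanish because the box is open. *)
Lemma acl_int0 n L F g i : 0 <= L -> @acl n L F g -> \int[mu n]_x g i x = 0.
Proof.
move=> L0; elim: n F g i => [|n IH] F g i; first by case: i.
move=> [hF hg hl]; case: (unliftP ord0 i) => [j ->|->].
  rewrite (Rint_cons1 (hg _)).
  under eq_Rintegral => t _.
    rewrite (IH (fun x => F (rV_cons (t, x))) (fun j x => g (lift ord0 j) (rV_cons (t, x)))).
    over.
    split=> [|k|k x a b ab]; [exact: bs_cons_x|exact: bs_cons_x|].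
    by rewrite -!setc_consS hl//; apply: eq_Rintegral => s _; rewrite setc_consS.
  by rewrite Rintegral_cst// mul0r.
rewrite (Rint_cons2 (hg _)).
under eq_Rintegral => x _.
  rewrite (_ : \int[leb]_t _ = 0); first over.
  have h := bs_cons_t x (hg ord0).
  have -> : \int[leb]_t g ord0 (rV_cons (t, x)) =
      \int[leb]_(t in `[- L, L]) g ord0 (rV_cons (t, x)).
    rewrite [RHS]bs_Rint_ind; apply: eq_Rintegral => t _.
    rewrite indicE; have [_|/negP nI] := boolP (t \in _); first by rewrite mul1r.
    rewrite mul0r; have [_ _ ->] := h => //= tL; apply: nI; apply/mem_set.
    by move: tL; rewrite /= !in_itv/= => /andP[/ltW -> /ltW ->].
  have -> : \int[leb]_(t in `[- L, L]) g ord0 (rV_cons (t, x)) =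
      F (setc (rV_cons (0, x)) ord0 L) - F (setc (rV_cons (0, x)) ord0 (- L)).
    rewrite hl; last lra.
    by apply: eq_Rintegral => t _; rewrite setc_cons0.
  rewrite !setc_cons0.
  have [_ _ F0] := hF; rewrite !F0 ?subrr// => /(_ ord0); rewrite rV_consE0 ltxx//.
  by rewrite andbF.
by rewrite Rintegral_cst// mul0r.
Qed.

End rV.

Section poincare.
Context {R : realType}.
Local Notation leb := (@lebesgue_measure R).
Local Notation mu n := (lebesgue_rV (R := R) n).

Lemma Rint_rV0 (F : 'rV[R]_0 -> R) : measurable_fun setT F -> \int[mu 0]_x F x = F 0.
Proof.
move=> mF; rewrite /Rintegral /= integral_dirac//; last exact/measurable_EFinP.
by rewrite diracT mul1e.
Qed.

Lemma cells_indic (L eta : R) k t : 0 < eta ->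
  \sum_(m < k) (\1_`[- L + m%:R * eta, - L + m%:R * eta + eta[%classic t : R) =
  \1_`[- L, - L + k%:R * eta[%classic t.
Proof.
move=> e0; elim: k => [|k IH].
  by rewrite big_ord0 indicE memNset//= in_itv/= mul0r addr0 => /andP[? ?]; lra.
have E (i : interval R) : (t \in [set` i]) = (t \in i).
  by apply/idP/idP => [/set_mem|/mem_set].
rewrite big_ord_recr/= IH !indicE !E !in_itv/=.
have -> : - L + k.+1%:R * eta = - L + k%:R * eta + eta by rewrite -natr1; ring.
have k0 : 0 <= k%:R * eta by rewrite mulr_ge0 ?ler0n ?(ltW e0).
have -> : - L + k%:R * eta + eta = - L + (k%:R * eta + eta) by ring.
case: (ltP t (- L + k%:R * eta)) => h; case: (leP (- L) t) => h2;
  case: (ltP t (- L + (k%:R * eta + eta))) => h3 //=;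
  by [rewrite ?addr0 ?add0r|exfalso; lra].
Qed.

Lemma measurable_consline n (x : 'rV[R]_n) j :
  measurable_fun setT (fun p : R * R => rV_cons (p.1, setc x j p.2)).
Proof.
apply: measurable_fun_rVP => i; case: (unliftP ord0 i) => [k ->|->].
  under eq_fun do rewrite rV_consES setcE.
  case: eqP => _; [exact: measurable_snd|exact: measurable_cst].
under eq_fun do rewrite rV_consE0.
exact: measurable_fst.
Qed.

Section cell.
Variables (n : nat) (L : R) (I : set R).
Hypotheses (fI : finmeas leb I).

Let mI : measurable_fun setT (\1_I : R -> R).
Proof. exact: measurable_indic fI.1. Qed.

Definition slab (F : 'rV[R]_n.+1 -> R) x := \int[leb]_t (\1_I t * F (rV_cons (t, x))).

Lemma bs_slabp (F : 'rV[R]_n.+1 -> R) : bs (@box R n.+1 L) F ->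
  bs (`]-L, L[ `*` @box R n L) (fun p : R * 'rV[R]_n => \1_I p.1 * F (rV_cons p)).
Proof.
move=> hF; rewrite (_ : (fun p => _) = (fun p => F (rV_cons p) * \1_I p.1)); last first.
  by apply/funext => p; rewrite mulrC.
apply: bsM; first exact: (bs_cons hF).
  by apply: (measurableT_comp mI).
by exists 1 => p; rewrite indicE; case: (_ \in _); rewrite ?normr1 ?normr0.
Qed.

Lemma bs_slab (F : 'rV[R]_n.+1 -> R) : bs (@box R n.+1 L) F -> bs (@box R n L) (slab F).
Proof.
move=> hF; exact: (bs_fubini_G (finmeas_itv _ _ _ _) (finmeas_box n L) (bs_slabp hF)).
Qed.

Lemma measurable_slabw (h : 'rV[R]_n -> R) : measurable_fun setT h ->
  measurable_fun setT (fun z : 'rV[R]_n.+1 => \1_I (z ord0 ord0) * h (rV_uncons z).2).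
Proof.
move=> mh; apply: measurable_funM.
  by apply: (measurableT_comp mI); exact: measurable_coord.
apply: (measurableT_comp mh); apply: measurableT_comp => //.
exact: measurable_rV_uncons.
Qed.

Lemma slabw_bounded (h : 'rV[R]_n -> R) : (exists M, forall x, `|h x| <= M) ->
  exists M, forall z : 'rV[R]_n.+1, `|\1_I (z ord0 ord0) * h (rV_uncons z).2| <= M.
Proof.
move=> [M hM]; exists `|M| => z; rewrite normrM indicE.
have := hM (rV_uncons z).2; have := ler_norm M.
by case: (_ \in _); rewrite ?normr1 ?normr0 ?mul1r ?mul0r//; lra.
Qed.

Lemma slab_mul (F : 'rV[R]_n.+1 -> R) (h : 'rV[R]_n -> R) : bs (@box R n.+1 L) F ->
  measurable_fun setT h -> (exists M, forall x, `|h x| <= M) ->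
  \int[mu n]_x (slab F x * h x) =
  \int[mu n.+1]_z (F z * (\1_I (z ord0 ord0) * h (rV_uncons z).2)).
Proof.
move=> hF mh bh.
have hG : bs (@box R n.+1 L) (fun z => F z * (\1_I (z ord0 ord0) * h (rV_uncons z).2)).
  by apply: bsM => //; [exact: measurable_slabw|exact: slabw_bounded].
rewrite (Rint_cons2 hG); apply: eq_Rintegral => x _.
rewrite /slab mulrC -(bs_intZ _ (finmeas_itv false true (-L) L)); last first.
  exact: (bs_slice2 (bs_slabp hF)).
by apply: eq_Rintegral => t _; rewrite rV_consK/= rV_consE0; ring.
Qed.

Lemma acl_slab F g : acl L F g -> acl L (slab F) (fun j => slab (g (lift ord0 j))).
Proof.
move=> [hF hg hl]; split=> [|j|j x a b ab]; [exact: bs_slab|exact: bs_slab|].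
have s y : bs `]-L, L[ (fun t => \1_I t * F (rV_cons (t, y))) := bs_slice2 (bs_slabp hF) y.
rewrite /slab -(bs_intB (finmeas_itv _ _ _ _) (s _) (s _)).
(* Both sides are iterated integrals of K, whose cut-offs make it a bounded function of bounded
   support. *)
pose K (p : R * R) := \1_I p.1 * (\1_`[a, b]%classic p.2 * g (lift ord0 j) (rV_cons (p.1, setc x j p.2))).
have [mg [M hM] g0] := hg (lift ord0 j).
have mK : measurable_fun setT (fun p : R * R => g (lift ord0 j) (rV_cons (p.1, setc x j p.2))).
  by apply: (measurableT_comp mg); exact: measurable_consline.
have hK : bs (`]-L, L[ `*` `[a, b]) K.
  split.
  - apply: measurable_funM.
      by apply: (measurableT_comp mI).
    apply: measurable_funM => //.
    by apply: measurableT_comp => //; apply: measurable_indic.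
  - exists `|M| => p; rewrite /K !normrM !indicE.
    have := hM (rV_cons (p.1, setc x j p.2)); have := ler_norm M.
    by case: (_ \in _); case: (_ \in _); rewrite ?normr1 ?normr0 ?mul1r ?mul0r//; lra.
  - move=> [t u] nb; rewrite /K/= !indicE.
    have [/set_mem uab|] := boolP (u \in _); last by rewrite mul0r mulr0.
    rewrite g0 ?mulr0// => h; apply: nb; split=> //=.
    by have := h ord0; rewrite rV_consE0/= in_itv.
have E1 : \int[leb]_t (\1_I t * F (rV_cons (t, setc x j b)) -
    \1_I t * F (rV_cons (t, setc x j a))) = \int[leb]_t \int[leb]_u K (t, u).
  apply: eq_Rintegral => t _; rewrite -mulrBr -!setc_consS hl// bs_Rint_ind.
  have hs : bs `[a, b] (fun u => \1_`[a, b]%classic u * g (lift ord0 j) (setc (rV_cons (t, x)) (lift ord0 j) u)).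
    apply: (@bs_ind_mul _ _ _ setT) => //; split; [|by exists M|by move=> y []].
    have m2 : measurable_fun setT (fun u : R => (t, u)) by exact: measurable_pair1.
    have := measurableT_comp mK m2.
    by under eq_fun do rewrite /= -setc_consS.
  rewrite -(bs_intZ _ (finmeas_itv true false a b) hs).
  by apply: eq_Rintegral => u _; rewrite /K/= setc_consS.
rewrite E1 -(bs_fubini1 (finmeas_itv _ _ _ _) (finmeas_itv _ _ _ _) hK).
rewrite (bs_fubini2 (finmeas_itv _ _ _ _) (finmeas_itv _ _ _ _) hK).
rewrite [RHS]bs_Rint_ind; apply: eq_Rintegral => u _.
rewrite -(bs_intZ _ (finmeas_itv false true (-L) L)); last first.
  exact: (bs_slice2 (bs_slabp (hg _))).
by apply: eq_Rintegral => t _; rewrite /K/=; ring.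
Qed.

Lemma slab_jensen (F : 'rV[R]_n.+1 -> R) : bs (@box R n.+1 L) F ->
  \int[mu n]_x (slab F x) ^+ 2 <= fine (leb I) * \int[mu n]_x (slab (fun z => F z ^+ 2) x).
Proof.
move=> hF; have h2 := bsX2 hF.
rewrite -(bs_intZ _ (finmeas_box n L)); last exact: bs_slab.
apply: (bs_int_le (finmeas_box n L)); first exact: bsX2 (bs_slab hF).
  by apply: bs_cst_mul; exact: bs_slab.
by move=> x; exact: bs_jensen fI (bs_cons_t x hF).
Qed.

End cell.

(** Induction on the dimension. The first axis is cut into cells of length eta, [poincare1] is
    applied on each line of each cell, and the induction hypothesis to the integrals of F over the
    cell, which are again of class [acl] in the remaining variables. *)
Lemma poincare n (L eps : R) : 0 < L -> 0 < eps ->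
  exists (I : finType) (h : I -> 'rV[R]_n -> R),
  (forall i, measurable_fun setT (h i) /\ exists M, forall x, `|h i x| <= M) /\
  forall F g, acl L F g ->
    \int[mu n]_x (F x ^+ 2) <= \sum_i (\int[mu n]_x (F x * h i x)) ^+ 2 +
       eps * \sum_i \int[mu n]_x (g i x ^+ 2).
Proof.
move=> L0 eps0; elim: n => [|n [J [h [mh hP]]]].
  exists unit, (fun _ _ => 1); split=> [i|F g [[mF _ _] _ _]].
    by split; [exact: measurable_cst|exists 1 => x; rewrite normr1].
  have e1 : \int[mu 0]_x (F x * 1) = F 0.
    rewrite Rint_rV0 ?mulr1//; apply: measurable_funM => //; exact: measurable_cst.
  rewrite big_ord0 mulr0 addr0 Rint_rV0; last exact: measurable_funX.
  by under eq_bigr do rewrite e1; rewrite big_const card_unit/= addr0.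
(* This makes eta = 2 L / N at most 1 and at most eps, whence eta^2 <= eps. *)
pose N := (Num.truncn (2 * L + 2 * L / eps)).+1.
have N0 : 0 < N%:R :> R by rewrite ltr0n.
have hN : 2 * L + 2 * L / eps < N%:R by exact: truncnS_gt.
have Le0 : 0 < 2 * L / eps by rewrite divr_gt0// mulr_gt0.
pose eta := 2 * L / N%:R.
have eta0 : 0 < eta by rewrite divr_gt0// mulr_gt0.
have eta1 : eta <= 1 by rewrite /eta ler_pdivrMr// mul1r; lra.
have etae : eta <= eps.
  have : 2 * L / eps <= N%:R by lra.
  by rewrite ler_pdivrMr// [N%:R * eps]mulrC => h'; rewrite /eta ler_pdivrMr.
have eta2 : eta ^+ 2 <= eps by rewrite expr2; nra.
pose cell (m : nat) := `[- L + m%:R * eta, - L + m%:R * eta + eta[%classic : set R.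
have fc m : finmeas leb (cell m) by exact: finmeas_itv.
have lc m : fine (leb (cell m)) = eta by rewrite itv_len; [ring|lra].
have mI m : measurable_fun setT (\1_(cell m) : R -> R).
  exact: measurable_indic (fc m).1.
have part (f : R -> R) : bs `]-L, L[ f ->
    \sum_(m < N) \int[leb]_t (\1_(cell m) t * f t) = \int[leb]_t f t.
  move=> hf.
  rewrite -(@bs_int_sum _ _ _ leb `]-L, L[ _ (index_enum 'I_N)
     (fun m t => \1_(cell m) t * f t) (finmeas_itv false true (-L) L)); last first.
    by move=> m; apply: (bsMl hf (mI m)); exact: indic_bounded.
  apply: eq_Rintegral => t _; rewrite -mulr_suml cells_indic//.
  have -> : N%:R * eta = 2 * L by rewrite /eta mulrC divfK// gt_eqF.
  have [_ _ f0] := hf; rewrite indicE.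
  have [_|/negP nt] := boolP (t \in _); first by rewrite mul1r.
  rewrite mul0r f0//= => tL; apply: nt; apply/mem_set; move: tL => /=.
  by rewrite !in_itv/= => /andP[? ?]; apply/andP; split; lra.
have parti (G : 'rV[R]_n.+1 -> R) : bs (@box R n.+1 L) G ->
    \sum_(m < N) \int[mu n]_x slab (cell m) G x = \int[mu n.+1]_z G z.
  move=> hG; rewrite (Rint_cons2 hG).
  rewrite -(@bs_int_sum _ _ _ (mu n) (box L) _ (index_enum 'I_N)
     (fun m x => slab (cell m) G x) (finmeas_box n L)); last by move=> m; exact: bs_slab.
  by apply: eq_Rintegral => x _; apply: part; exact: bs_cons_t.
(* The normalization by the square root of eta reproduces the factor 1 / eta in front of the squared
   means in [poincare1]. *)
exists (('I_N * J)%type : finType), (fun (p : 'I_N * J) (z : 'rV[R]_n.+1) => (Num.sqrt eta)^-1 *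
  (\1_(cell p.1) (z ord0 ord0) * h p.2 (rV_uncons z).2)).
split=> [[m i]|F g hFg].
  have [mhi bhi] := mh i; split.
    by apply: measurable_funM => //; exact: measurable_slabw.
  have [M hM] := slabw_bounded (cell m) bhi.
  by exists (`|(Num.sqrt eta)^-1| * M) => z; rewrite normrM ler_wpM2l.
have [hF hg hl] := hFg.
have h0 := hg ord0.
pose A := \sum_(m < N) eta^-1 * \int[mu n]_x (slab (cell m) F x) ^+ 2.
have step1 : \int[mu n.+1]_x (F x ^+ 2) <= A + eta ^+ 2 * \int[mu n.+1]_z (g ord0 z ^+ 2).
  rewrite -(parti _ (bsX2 hF)) -(parti _ (bsX2 h0)) /A mulr_sumr -big_split/=.
  apply: ler_sum => m _.
  rewrite -(bs_intZ _ (finmeas_box n L)); last exact: bsX2 (bs_slab (fc m) hF).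
  rewrite -(bs_intZ _ (finmeas_box n L)); last exact: (bs_slab (fc m) (bsX2 h0)).
  rewrite -(bs_intD (finmeas_box n L)); last 2 first.
  - by apply: bs_cst_mul; exact: bsX2 (bs_slab (fc m) hF).
  - by apply: bs_cst_mul; exact: (bs_slab (fc m) (bsX2 h0)).
  apply: (bs_int_le (finmeas_box n L)).
  - exact: (bs_slab (fc m) (bsX2 hF)).
  - apply: bsD; apply: bs_cst_mul; first exact: bsX2 (bs_slab (fc m) hF).
    exact: (bs_slab (fc m) (bsX2 h0)).
  move=> x; apply: (poincare1 (erefl _) eta0 (finmeas_itv false true (-L) L)
    (bs_cons_t x hF) (bs_cons_t x h0)) => a b ab.
  rewrite -(setc_cons0 0 x b) -(setc_cons0 0 x a) hl//.
  by apply: eq_Rintegral => t _; rewrite setc_cons0.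
have step2 : A <= \sum_(m < N) \sum_i eta^-1 * (\int[mu n]_x (slab (cell m) F x * h i x)) ^+ 2 +
    eps * \sum_(j < n) \int[mu n.+1]_z (g (lift ord0 j) z ^+ 2).
  have -> : eps * \sum_(j < n) \int[mu n.+1]_z (g (lift ord0 j) z ^+ 2) =
     \sum_(m < N) eps * \sum_(j < n) \int[mu n]_x slab (cell m) (fun z => g (lift ord0 j) z ^+ 2) x.
    rewrite -mulr_sumr exchange_big/=; congr (_ * _); apply: eq_bigr => j _.
    by rewrite (parti _ (bsX2 (hg _))).
  rewrite -big_split/=; apply: ler_sum => m _.
  rewrite -mulr_sumr.
  have ie0 : 0 <= eta^-1 by rewrite invr_ge0 ltW.
  (* In the gradient terms the factor 1 / eta is cancelled by [slab_jensen], the cell having length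
     eta. *)
  apply: le_trans (ler_wpM2l ie0 (hP _ _ (acl_slab (fc m) hFg))) _.
  rewrite mulrDr lerD2l mulrCA ler_wpM2l ?(ltW eps0)// mulr_sumr.
  apply: ler_sum => j _; rewrite mulrC ler_pdivrMr// mulrC -(lc m).
  exact: slab_jensen.
rewrite big_ord_recl mulrDr.
have step3 : \sum_(i : 'I_N * J) (\int[mu n.+1]_x (F x * ((Num.sqrt eta)^-1 *
   (\1_(cell i.1) (x ord0 ord0) * h i.2 (rV_uncons x).2)))) ^+ 2 =
   \sum_(m < N) \sum_i eta^-1 * (\int[mu n]_x (slab (cell m) F x * h i x)) ^+ 2.
  rewrite pair_big; apply: eq_bigr => -[m i] _.
  have [mhi bhi] := mh i.
  rewrite (slab_mul (fc m) hF mhi bhi).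
  have hb : bs (@box R n.+1 L) (fun z => F z * (\1_(cell m) (z ord0 ord0) * h i (rV_uncons z).2)).
    by apply: bsM => //; [exact: measurable_slabw|exact: slabw_bounded].
  set c := (Num.sqrt eta)^-1.
  transitivity ((c * \int[mu n.+1]_z (F z * (\1_(cell m) (z ord0 ord0) * h i (rV_uncons z).2))) ^+ 2).
    congr (_ ^+ 2); apply: etrans (bs_intZ c (finmeas_box _ _) hb).
    by apply: eq_Rintegral => x _; rewrite mulrCA.
  by rewrite exprMn exprVn sqr_sqrtr// ltW.
rewrite step3.
have : eta ^+ 2 * \int[mu n.+1]_z (g ord0 z ^+ 2) <= eps * \int[mu n.+1]_z (g ord0 z ^+ 2).
  by rewrite ler_wpM2r//; apply: Rintegral_ge0 => z _; exact: sqr_ge0.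
lra.
Qed.

End poincare.

(** * Smooth functions and density of test functions *)

Section lines.
Context {R : realType} {V : normedModType R}.

Lemma is_derive_line (f : V -> R) (x v : V) (t df : R) :
  is_derive (t *: v + x) v f df <-> is_derive t 1 (fun s : R => f (s *: v + x)) df.
Proof.
have E : (fun h : R => h^-1 *: (((fun s : R => f (s *: v + x)) \o shift t) (h *: 1) - f (t *: v + x))) =
         (fun h : R => h^-1 *: ((f \o shift (t *: v + x)) (h *: v) - f (t *: v + x))).
  apply/funext => h /=; congr (_ *: (f _ - _)).
  by rewrite scalerDl addrA -[h *: 1]/(h * 1) mulr1.
split=> -[d e]; split.
- by rewrite /derivable E.
- by rewrite /derive E.
- by move: d; rewrite /derivable E.
- by move: e; rewrite /derive E.
Qed.

End lines.

Section smooth.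
Context {R : realType} {d : nat}.
Local Notation E := 'rV[R]_d.
Implicit Types f g h : E -> R.

(** A graded form of [smooth]: closure properties are proved by induction on the order instead of
    along words of partial derivatives. *)
Fixpoint Ck (k : nat) f : Prop :=
  continuous f /\
  if k is k'.+1 then forall i, (forall x, derivable f x (delta_mx ord0 i)) /\ Ck k' (partial i f)
  else True.

Lemma Ck_cont k f : Ck k f -> continuous f.
Proof. by case: k => [|k] []. Qed.

Lemma CkW k f : Ck k.+1 f -> Ck k f.
Proof.
elim: k f => [|k IH] f [heat_coef hf]; split=> // i.
by have [df /IH] := hf i.
Qed.

Lemma smoothP f : smooth f <-> forall k, Ck k f.
Proof.
split=> [sf k|Cf s].
  elim: k f sf => [|k IH] f sf.
    by split=> //; have := sf [::] => -[].
  split=> [|i]; first by have := sf [::] => -[].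
  split=> [x|]; first by have := sf [::] => -[_]; exact.
  apply: IH => s; have := sf (rcons s i).
  by rewrite -cats1 foldr_cat.
suff h k : Ck k (foldr partial f s).
  split; first exact: Ck_cont (h 0%N).
  by move=> i x; have [_ /(_ i)[]] := h 1%N.
elim: s k => [|i s IH] k /=; first by exact: Cf.
by have [_ /(_ i)[]] := IH k.+1.
Qed.

Lemma partialD (a : R) f g i : (forall x, derivable f x (delta_mx ord0 i)) ->
  (forall x, derivable g x (delta_mx ord0 i)) ->
  partial i (fun x => a * f x + g x) = (fun x => a * partial i f x + partial i g x).
Proof.
move=> df dg; apply/funext => x; rewrite /partial.
have h := deriveD (@derivableZ _ _ _ f a x _ (df x)) (dg x).
by rewrite deriveZ in h.
Qed.

Lemma partialM f g i : (forall x, derivable f x (delta_mx ord0 i)) ->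
  (forall x, derivable g x (delta_mx ord0 i)) ->
  partial i (fun x => f x * g x) = (fun x => f x * partial i g x + g x * partial i f x).
Proof.
by move=> df dg; apply/funext => x; rewrite /partial (deriveM (df x) (dg x)).
Qed.

Lemma derivable_lin (a : R) f g x v : derivable f x v -> derivable g x v ->
  derivable (fun x => a * f x + g x) x v.
Proof. by move=> df dg; exact: (derivableD (@derivableZ _ _ _ f a x _ df) dg). Qed.

Lemma contM f g : continuous f -> continuous g -> continuous (fun x => f x * g x).
Proof. by move=> heat_coef cg x; exact: (continuousM (heat_coef x) (cg x)). Qed.

Lemma contD f g : continuous f -> continuous g -> continuous (fun x => f x + g x).
Proof. by move=> heat_coef cg x; exact: (continuousD (heat_coef x) (cg x)). Qed.

Lemma cont_lin (a : R) f g : continuous f -> continuous g ->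
  continuous (fun x => a * f x + g x).
Proof.
move=> heat_coef cg; apply: contD => //; apply: contM => //; exact: cst_continuous.
Qed.

Lemma Ck_lin k (a : R) f g : Ck k f -> Ck k g -> Ck k (fun x => a * f x + g x).
Proof.
elim: k f g => [|k IH] f g [heat_coef hf] [cg hg]; split=> //; try exact: cont_lin.
move=> i; have [df Cf] := hf i; have [dg Cg] := hg i; split=> [x|].
  exact: derivable_lin.
by rewrite partialD//; exact: IH.
Qed.

Lemma CkM k f g : Ck k f -> Ck k g -> Ck k (fun x => f x * g x).
Proof.
elim: k f g => [|k IH] f g Cf Cg.
  by split=> //; apply: contM; [exact: Ck_cont Cf|exact: Ck_cont Cg].
have [heat_coef hf] := Cf; have [cg hg] := Cg.
split=> [|i]; first exact: contM.
have [df Cdf] := hf i; have [dg Cdg] := hg i; split=> [x|].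
  exact: derivableM (df x) (dg x).
rewrite partialM//.
have -> : (fun x => f x * partial i g x + g x * partial i f x) =
  (fun x => 1 * (f x * partial i g x) + g x * partial i f x).
  by apply/funext => x; rewrite mul1r.
by apply: Ck_lin; apply: IH => //; exact: CkW.
Qed.

Lemma smooth_lin (a : R) f g : smooth f -> smooth g -> smooth (fun x => a * f x + g x).
Proof. by move=> /smoothP sf /smoothP sg; apply/smoothP => k; exact: Ck_lin. Qed.

Lemma smoothM f g : smooth f -> smooth g -> smooth (fun x => f x * g x).
Proof. by move=> /smoothP sf /smoothP sg; apply/smoothP => k; exact: CkM. Qed.

Lemma partial_cst (c : R) i : partial i ((fun=> c) : E -> R) = (fun=> 0).
Proof. by apply/funext => x; rewrite /partial derive_val. Qed.

Lemma smooth_cst (c : R) : smooth ((fun=> c) : E -> R).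
Proof.
apply/smoothP => k; elim: k c => [|k IH] c; (split; first exact: cst_continuous) => //.
move=> i; split; first by move=> x; exact: derivable_cst.
by rewrite partial_cst.
Qed.

Lemma smooth_prod (I : Type) (r : seq I) (F : I -> E -> R) : (forall i, smooth (F i)) ->
  smooth (fun x => \prod_(i <- r) F i x).
Proof.
move=> sF; elim: r => [|i r IH].
  rewrite (_ : (fun x => _) = (fun=> 1)); first exact: smooth_cst.
  by apply/funext => x; rewrite big_nil.
rewrite (_ : (fun x => _) = (fun x => F i x * \prod_(i <- r) F i x)); first exact: smoothM.
by apply/funext => x; rewrite big_cons.
Qed.

Lemma smooth_partial f i : smooth f -> smooth (partial i f).
Proof. by move=> sf s; have := sf (rcons s i); rewrite -cats1 foldr_cat. Qed.

Lemma smooth_cont f : smooth f -> continuous f.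
Proof. by move=> /(_ [::])[]. Qed.

Lemma smooth_derivable f i x : smooth f -> derivable f x (delta_mx ord0 i).
Proof. by move=> /(_ [::])[_]. Qed.

End smooth.

Section bump.
Context {R : realType}.

(** Coefficient by coefficient, from s^(i+1) / (i+1)! <= exp s. The gain 1 / s is what the
    difference quotient of [flat] at 0 requires. *)
Lemma poly_exp_bound (Q : {poly R}) : exists2 C, 0 <= C &
  forall s : R, 0 < s -> `|Q.[s] * expR (- s)| <= C / s.
Proof.
exists (\sum_(i < size Q) `|Q`_i| * (i.+1)`!%:R).
  by apply: sumr_ge0 => i _; rewrite mulr_ge0.
move=> s s0; rewrite horner_coef mulr_suml mulr_suml.
apply: le_trans (ler_norm_sum _ _ _) _; apply: ler_sum => i _.
rewrite -!mulrA normrM ler_wpM2l// ger0_norm; last first.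
  by rewrite mulr_ge0 ?expR_ge0// exprn_ge0// ltW.
rewrite ler_pdivlMr// mulrAC -exprSr expRN ler_pdivrMr ?expR_gt0//.
have := expR_ge1Dxn i (ltW s0) => h.
have f0 : 0 < (i.+1)`!%:R :> R by rewrite ltr0n fact_gt0.
rewrite mulrC -ler_pdivrMr//; lra.
Qed.

(* The functions P(1/t) exp(-1/t) are stable under derivation, hence smooth by
   a single induction over all P. *)
Definition flat (P : {poly R}) (t : R) : R :=
  if t <= 0 then 0 else P.[t^-1] * expR (- t^-1).

Lemma is_derive_flat (P : {poly R}) (t : R) :
  is_derive t 1 (flat P) (flat ('X^2 * (P - P^`())) t).
Proof.
have [t0|t0|->] := ltgtP t 0.
- have nt : {near t, flat P =1 cst 0}.
    near=> s; rewrite /flat ifT// ltW//; near: s; exact: lt_nbhsl.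
  rewrite /flat ifT ?ltW//.
  by apply: near_eq_is_derive (is_derive_cst (0 : R) t 1); near do apply/esym.
- have nt : {near t, flat P =1 (fun s => P.[s^-1] * expR (- s^-1))}.
    near=> s; rewrite /flat leNgt ifF//; apply/negbTE; rewrite negbK; near: s; exact: lt_nbhsr.
  have -> : flat ('X^2 * (P - P^`())) t =
      P.[t^-1] *: (expR (- t^-1) *: - (- t ^- 2 *: 1)) + expR (- t^-1) *: (P^`().[t^-1] *: (- t ^- 2 *: 1)).
    rewrite /flat leNgt t0/= hornerM hornerXn hornerD hornerN.
    by rewrite /GRing.scale/= -exprVn; ring.
  have dV : is_derive t 1 (fun s : R => s^-1) (- t ^- 2 *: 1).
    by apply: is_deriveV; rewrite gt_eqF.
  have dN : is_derive t 1 (fun s : R => - s^-1) (- (- t ^- 2 *: 1)) by exact: is_deriveN.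
  have dE : is_derive t 1 (fun s : R => expR (- s^-1)) (expR (- t^-1) *: - (- t ^- 2 *: 1)).
    exact: (@is_derive1_comp _ expR (fun s => - s^-1)).
  have dP : is_derive t 1 (fun s : R => P.[s^-1]) (P^`().[t^-1] *: (- t ^- 2 *: 1)).
    exact: (@is_derive1_comp _ (horner P) (fun s => s^-1)).
  have dM := is_deriveM dP dE.
  by apply: near_eq_is_derive dM; near do apply/esym.
- rewrite {2}/flat lexx.
  (* For h > 0 the difference quotient at 0 is (X P)(1 / h) exp(- 1 / h), which is at most C h in
     absolute value. *)
  have [C C0 hC] := poly_exp_bound ('X * P).
  have h : (fun h : R => h^-1 *: ((flat P \o shift 0) (h *: 1) - flat P 0)) @ 0^' --> (0 : R).
    apply/cvgrPdist_lt => e e0.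
    near=> h; have hn0 : h != 0 by near: h; exact: nbhs_dnbhs_neq.
    rewrite sub0r normrN /= addr0 {2}/flat lexx subr0.
    rewrite -[h *: 1]/(h * 1) mulr1 -[_ *: _]/(_ * _) /flat; case: (leP h 0) => h0.
      by rewrite mulr0 normr0.
    rewrite mulrA; have := hC h^-1; rewrite invr_gt0 => /(_ h0).
    rewrite hornerM hornerX invrK => /le_lt_trans; apply.
    have hs : `|h| < e / (C + 1).
      by near: h; apply: dnbhs0_lt; rewrite divr_gt0// ltr_wpDl.
    rewrite gtr0_norm// ltr_pdivlMr ?ltr_wpDl// in hs.
    by apply: le_lt_trans hs; rewrite mulrC ler_wpM2l ?(ltW h0)// lerDl.
  split; first by apply/cvg_ex; exists 0.
  exact: cvg_lim.
Unshelve. all: by end_near.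
Qed.

Lemma partial_line (d : nat) (f : 'rV[R]_d -> R) i x (t df : R) :
  is_derive t 1 (fun s => f (setc x i s)) df -> is_derive (setc x i t) (delta_mx ord0 i) f df.
Proof.
have E s : setc x i s = s *: delta_mx ord0 i + setc x i 0.
  apply/rowP => j; rewrite !mxE eqxx/=; case: eqP => _; first by rewrite mulr1 addr0.
  by rewrite mulr0 add0r.
rewrite E => h; apply/is_derive_line.
by under eq_fun do rewrite -E.
Qed.

Lemma line_partial (d : nat) (f : 'rV[R]_d -> R) i x (t df : R) :
  is_derive (setc x i t) (delta_mx ord0 i) f df -> is_derive t 1 (fun s => f (setc x i s)) df.
Proof.
have E s : setc x i s = s *: delta_mx ord0 i + setc x i 0.
  apply/rowP => j; rewrite !mxE eqxx/=; case: eqP => _; first by rewrite mulr1 addr0.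
  by rewrite mulr0 add0r.
under eq_fun do rewrite E.
by rewrite E => /is_derive_line.
Qed.

Lemma is_derive_flat_coord (d : nat) (P : {poly R}) (a b : R) (i j : 'I_d) x :
  is_derive x (delta_mx ord0 j) (fun x : 'rV[R]_d => flat P (a * x ord0 i + b))
    (if i == j then flat (a *: ('X^2 * (P - P^`()))) (a * x ord0 i + b) else 0).
Proof.
rewrite -{1}(setc_id x j); apply: partial_line.
under eq_fun do rewrite setcE.
case: eqP => [->|_]; last exact: is_derive_cst.
have dA : is_derive (x ord0 j) 1 (fun s : R => a * s + b) a.
  have := is_deriveD (is_deriveZ a (is_derive_id (x ord0 j) 1)) (is_derive_cst b (x ord0 j) 1).
  by move=> h; apply: is_derive_eq h _; rewrite addr0 -[_ *: _]/(_ * _) mulr1.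
have dF := is_derive_flat P (a * x ord0 j + b).
have h := @is_derive1_comp _ (flat P) (fun s => a * s + b) _ _ _ dF dA.
apply: is_derive_eq h _.
rewrite /flat; case: ifP => _; first by rewrite mul0r.
by rewrite hornerZ; ring.
Qed.

Lemma flat_cont (P : {poly R}) : continuous (flat P).
Proof.
move=> x; have := is_derive_flat P x; case => h _.
by apply/differentiable_continuous/derivable1_diffP.
Qed.

Lemma smooth_flat (d : nat) (P : {poly R}) (a b : R) (i : 'I_d) :
  smooth (fun x : 'rV[R]_d => flat P (a * x ord0 i + b)).
Proof.
apply/smoothP => k; elim: k P => [|k IH] P; (split; [|try by []]).
- move=> x; apply: (@continuous_comp _ _ _ (fun x : 'rV[R]_d => a * x ord0 i + b)); last exact: flat_cont.
  apply: contD; last exact: cst_continuous.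
  by apply: contM; [exact: cst_continuous|exact: coord_continuous].
- move=> x; apply: (@continuous_comp _ _ _ (fun x : 'rV[R]_d => a * x ord0 i + b)); last exact: flat_cont.
  apply: contD; last exact: cst_continuous.
  by apply: contM; [exact: cst_continuous|exact: coord_continuous].
- move=> j; split=> [x|]; first by have [] := is_derive_flat_coord P a b i j x.
  have E : partial j (fun x : 'rV[R]_d => flat P (a * x ord0 i + b)) =
    (fun x => if i == j then flat (a *: ('X^2 * (P - P^`()))) (a * x ord0 i + b) else 0).
    by apply/funext => x; rewrite /partial; have [_ ->] := is_derive_flat_coord P a b i j x.
  rewrite E; case: eqP => _; first exact: IH.
  by have /smoothP := smooth_cst (d := d) (0 : R); exact.
Qed.

(* Converges pointwise to the indicator of the open box with corners [a] and [b],
   with support in its interior. *)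
Definition bump (d : nat) (k : nat) (a b x : 'rV[R]_d) : R :=
  \prod_(i < d) (flat 1 (k.+1%:R * x ord0 i + (- (k.+1%:R * a ord0 i) - 1)) *
                 flat 1 (- k.+1%:R * x ord0 i + (k.+1%:R * b ord0 i - 1))).

Lemma bumpE d k (a b x : 'rV[R]_d) : bump k a b x =
  \prod_(i < d) (flat 1 (k.+1%:R * (x ord0 i - a ord0 i) - 1) *
                 flat 1 (k.+1%:R * (b ord0 i - x ord0 i) - 1)).
Proof. by apply: eq_bigr => i _; congr (flat _ _ * flat _ _); ring. Qed.

Lemma smooth_bump d k (a b : 'rV[R]_d) : smooth (bump k a b).
Proof. by apply: smooth_prod => i; apply: smoothM; exact: smooth_flat. Qed.

Lemma flat1_ge0 (t : R) : 0 <= flat 1 t.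
Proof. by rewrite /flat; case: ifP => // _; rewrite hornerC mul1r expR_ge0. Qed.

Lemma flat1_le1 (t : R) : flat 1 t <= 1.
Proof.
rewrite /flat; case: ifPn => //; rewrite -ltNge => t0.
by rewrite hornerC mul1r -expR0 ler_expR oppr_le0 invr_ge0 ltW.
Qed.

Lemma flat1_cvg (t : R) : flat 1 (k.+1%:R * t - 1) @[k --> \oo] --> ((0 < t)%R%:R : R).
Proof.
have [t0|t0] := ltP 0 t; last first.
  rewrite (_ : (fun k => _) = cst 0); first exact: cvg_cst.
  apply/funext => k; rewrite /flat ifT//.
  have : k.+1%:R * t <= 0 by rewrite mulr_ge0_le0.
  lra.
have yoo : k.+1%:R * t - 1 @[k --> \oo] --> +oo.
  apply/cvgryPge => M; exists (Num.truncn ((`|M| + 1) / t)) => // k /= kM.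
  have : (`|M| + 1) / t < k.+1%:R.
    by apply: lt_le_trans (truncnS_gt _) _; rewrite ler_nat ltnS.
  by rewrite ltr_pdivrMr// => h; have := ler_norm M; lra.
have y0 : \forall k \near \oo, 0 < k.+1%:R * t - 1 by move/cvgryPgt : yoo; exact.
have h : - (k.+1%:R * t - 1)^-1 @[k --> \oo] --> - 0.
  by apply: cvgN; apply/gtr0_cvgV0.
rewrite oppr0 in h.
rewrite (_ : true%:R = expR (0 : R)); last by rewrite expR0.
have := cvg_comp _ _ h (@continuous_expR R 0).
apply: cvg_trans; apply: near_eq_cvg; move: y0; apply: filterS => k k0 /=.
by rewrite /flat leNgt k0/= hornerC mul1r.
Qed.

Lemma bump_ge0 d k (a b x : 'rV[R]_d) : 0 <= bump k a b x.
Proof. by rewrite bumpE; apply: prodr_ge0 => i _; rewrite mulr_ge0 ?flat1_ge0. Qed.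

Lemma bump_le1 d k (a b x : 'rV[R]_d) : bump k a b x <= 1.
Proof.
suff /andP[] : 0 <= bump k a b x <= 1 by [].
apply: (big_ind (fun y : R => 0 <= y <= 1)) => [|u v /andP[? ?] /andP[? ?]|i _].
- by rewrite ler01 lexx.
- by rewrite mulr_ge0//= mulr_ile1.
- by rewrite mulr_ge0 ?flat1_ge0//= mulr_ile1 ?flat1_ge0 ?flat1_le1.
Qed.

Definition obox d (a b : 'rV[R]_d) : set 'rV[R]_d :=
  [set x | forall i, a ord0 i < x ord0 i < b ord0 i].

Definition cbox d (k : nat) (a b : 'rV[R]_d) : set 'rV[R]_d :=
  [set x | forall i, `[a ord0 i + k.+1%:R^-1, b ord0 i - k.+1%:R^-1]%classic (x ord0 i)].

Lemma cbox_obox d k (a b : 'rV[R]_d) : cbox k a b `<=` obox a b.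
Proof.
move=> x h i; have := h i; rewrite /= in_itv/=.
have : 0 < k.+1%:R^-1 :> R by rewrite invr_gt0.
by move: (k.+1%:R^-1) => q k0 /andP[? ?]; apply/andP; split; lra.
Qed.

Lemma cbox_compact d k (a b : 'rV[R]_d) : compact (cbox k a b).
Proof.
exact: (rV_compact (A := fun i => `[a ord0 i + k.+1%:R^-1, b ord0 i - k.+1%:R^-1]%classic)
  (fun i => @segment_compact _ _ _)).
Qed.

Lemma bump_out d k (a b x : 'rV[R]_d) : ~ cbox k a b x -> bump k a b x = 0.
Proof.
move=> /existsNP[i /negP]; rewrite /= in_itv/= negb_and -!ltNge => h.
rewrite bumpE (bigD1 i)//= [X in X * _](_ : _ = 0) ?mul0r//.
have k0 : 0 < k.+1%:R :> R by [].
have kk : k.+1%:R * k.+1%:R^-1 = 1 :> R by rewrite mulfV// gt_eqF.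
case/orP : h => h.
  rewrite [X in X * _](_ : _ = 0) ?mul0r// /flat ifT//.
  rewrite -[X in _ - X]kk -mulrBr pmulr_rle0//.
  by move: (k.+1%:R^-1) h => q; lra.
rewrite [X in _ * X](_ : _ = 0) ?mulr0// /flat ifT//.
rewrite -[X in _ - X]kk -mulrBr pmulr_rle0//.
by move: (k.+1%:R^-1) h => q; lra.
Qed.

Lemma bump_cvg d (a b x : 'rV[R]_d) :
  bump k a b x @[k --> \oo] --> (\1_(obox a b) x : R).
Proof.
rewrite indicE; have [/set_mem xin|/negP xout] := boolP (x \in obox a b); last first.
  rewrite (_ : (fun k => _) = cst 0); first exact: cvg_cst.
  by apply/funext => k; rewrite bump_out// => /cbox_obox/mem_set.
rewrite (_ : (true%:R : R) = \prod_(i < d) (1 * 1)); last by rewrite big1// => i _; rewrite mulr1.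
pose F i k : R := flat 1 (k.+1%:R * (x ord0 i - a ord0 i) - 1) *
                 flat 1 (k.+1%:R * (b ord0 i - x ord0 i) - 1).
rewrite (_ : (fun k => _) = (fun k => \prod_(i < d) F i k)); last first.
  by apply/funext => k; rewrite bumpE.
elim: (index_enum _) => [|i r IH].
  by apply: cvg_near_cst; exists 0%N => // k _; rewrite !big_nil.
rewrite (_ : (fun k => _) = (fun k => F i k * \prod_(j <- r) F j k)); last first.
  by apply/funext => k; rewrite big_cons.
have /andP[ax xb] := xin i.
rewrite big_cons; apply: cvgM => //; apply: cvgM.
  by have := @flat1_cvg (x ord0 i - a ord0 i); rewrite subr_gt0 ax.
by have := @flat1_cvg (b ord0 i - x ord0 i); rewrite subr_gt0 xb.
Qed.

End bump.

(** * Open sets and open boxes in the coordinate sigma-algebra *)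

Section rV_measurable.
Context {R : realType} {n : nat}.
Local Notation E := 'rV[R]_n.

Lemma rV_ball_measurable (x : E) e : measurable (ball x e).
Proof.
have [e0|e0] := leP e 0.
  rewrite (_ : ball x e = set0) //; apply/seteqP; split=> // y.
  by rewrite mx_norm_ball /= => h; have := le_lt_trans (normr_ge0 _) h; rewrite ltNge e0.
rewrite (_ : ball x e = \bigcap_(i in [set: 'I_n]) ((fun y : E => y ord0 i) @^-1` ball (x ord0 i) e)).
  apply: fin_bigcap_measurable; first exact: finite_finset.
  move=> i _; rewrite -[X in measurable X]setTI.
  by apply: measurable_coord => //; exact: measurable_ball.
apply/seteqP; split=> y.
  by move=> [_ h] i _; exact: h.
by move=> h; split=> // i j; rewrite ord1; exact: h.
Qed.

(** The sigma-algebra is generated by the coordinates, not by the topology; an open set is a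
    countable union of balls with rational centers and radii 1 / (k + 1), and sup-norm balls are
    products of intervals. *)
Lemma rV_open_measurable (U : set E) : open U -> measurable U.
Proof.
move=> oU.
pose Q := ('rV[rat]_n * nat)%type.
pose c (q : Q) : E := \row_i ratr (q.1 ord0 i).
pose B (q : Q) := ball (c q) q.2.+1%:R^-1.
rewrite (_ : U = \bigcup_(q : Q) (if `[< B q `<=` U >] then B q else set0)).
  apply: countable_bigcupT_measurable; first exact: countableP.
  by move=> q; case: asboolP => _; [exact: rV_ball_measurable|exact: measurable0].
apply/seteqP; split=> [x Ux|x [q _]]; last by case: asboolP => // h /h.
have /nbhs_ballP[e /= e0 he] : nbhs x U by exact: open_nbhs_nbhs.
pose k := Num.truncn (2 / e).
have ke : k.+1%:R^-1 < e / 2.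
  by rewrite invf_plt ?posrE ?divr_gt0// invf_div; exact: truncnS_gt.
have hq i : exists q : rat, x ord0 i - k.+1%:R^-1 < ratr q < x ord0 i + k.+1%:R^-1.
  have h : x ord0 i - k.+1%:R^-1 < x ord0 i + k.+1%:R^-1.
    by rewrite ltrD2l; apply: (@lt_trans _ _ 0); rewrite ?oppr_lt0 invr_gt0.
  by have [q hq] := rat_in_itvoo h; exists q; move: hq; rewrite in_itv.
have [q qx] := choice hq.
exists (\row_i q i, k) => //=; case: asboolP => [_|[]].
  split=> [|i j]; first by rewrite invr_gt0.
  rewrite /c mxE mxE ord1 -ball_normE /= ltr_norml.
  by have /andP[] := qx j; move: (_^-1) => y *; apply/andP; split; lra.
move=> y [_ hy]; apply: he; split=> // i j; rewrite ord1 -ball_normE /=.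
have := hy 0 j; rewrite /c !mxE -ball_normE /= !ltr_norml.
have /andP[] := qx j; move: (_^-1) ke => r *; apply/andP; split; lra.
Qed.

Lemma rV_cont_measurable (f : E -> R) : continuous f -> measurable_fun setT f.
Proof.
move=> /continuousP heat_coef; apply: (measurability _ (RGenOpens.measurableE R)).
move=> _ [_ [a [b ->] <-]]; rewrite setTI; apply: rV_open_measurable.
exact/heat_coef/interval_open.
Qed.

Lemma obox_measurable (a b : E) : measurable (obox a b).
Proof.
rewrite (_ : obox a b = \bigcap_(i in [set: 'I_n]) ((fun y : E => y ord0 i) @^-1` `]a ord0 i, b ord0 i[)).
  apply: fin_bigcap_measurable; first exact: finite_finset.
  move=> i _; rewrite -[X in measurable X]setTI.
  by apply: measurable_coord => //; exact: measurable_itv.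
apply/seteqP; split=> x h i; last by have := h i I; rewrite /= in_itv.
by move=> _; rewrite /= in_itv; exact: h.
Qed.

(** Open boxes form a pi-system and their indicators are limits of bumps, so generation reduces
    [test_dense] to them. *)
Lemma obox_generate : @measurable _ E = <<s [set A | exists a b : E, A = obox a b] >>.
Proof.
set G := [set A | _].
apply/seteqP; split.
  apply: smallest_sub => //.
  rewrite -bigcup_seq => A [i _ [B mB <-]].
  have : measurable_fun (setT : set (g_sigma_algebraType G)) (fun x : E => x ord0 i : R).
    apply: (measurability _ (RGenOInfty.measurableE R)) => _ [_ [s ->] <-].
    rewrite setTI.
    rewrite (_ : _ @^-1` _ = \bigcup_(k : nat) obox (\row_j if j == i then s else - k%:R) (\row_j (k%:R : R))).
      apply: bigcup_measurable => k _; apply: sub_sigma_algebra.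
      by exists (\row_j if j == i then s else - k%:R), (\row_j k%:R).
    apply/seteqP; split=> x /=.
      rewrite in_itv/= andbT => sx.
      exists (Num.truncn (\sum_j `|x ord0 j|)).+1 => //= j.
      have : `|x ord0 j| < (Num.truncn (\sum_j `|x ord0 j|)).+1%:R.
        apply: le_lt_trans (truncnS_gt _).
        by rewrite (bigD1 j)//= lerDl sumr_ge0.
      rewrite ltr_norml => /andP[h1 h2]; rewrite !mxE h2 andbT.
      by case: eqP => [->|].
    move=> [k _ h]; rewrite in_itv/= andbT.
    by have /andP[] := h i; rewrite !mxE eqxx.
  by move=> /(_ measurableT _ mB).
apply: smallest_sub; first exact: sigma_algebra_measurable.
by move=> _ [a [b ->]]; exact: obox_measurable.
Qed.

End rV_measurable.

Section rtest.
Context {R : realType} {n : nat}.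
Local Notation E := 'rV[R]_n.
Local Notation leb := (@lebesgue_measure R).
Local Notation mu := (lebesgue_rV (R := R) n).
Implicit Types (f g h : E -> R) (D : set E).

Definition rtest D f := smooth f /\
  exists K, [/\ compact K, K `<=` D & forall x, ~ K x -> f x = 0].

Lemma rtest_lin D (a : R) f g : rtest D f -> rtest D g -> rtest D (fun x => a * f x + g x).
Proof.
move=> [sf [K [cK KD f0]]] [sg [K' [cK' KD' g0]]]; split; first exact: smooth_lin.
exists (K `|` K'); split; [exact: compactU|by rewrite subUset|].
by move=> x /not_orP[/f0 -> /g0 ->]; rewrite mulr0 addr0.
Qed.

Lemma rtestM D f g : rtest D f -> rtest D g -> rtest D (fun x => f x * g x).
Proof.
move=> [sf [K [cK KD f0]]] [sg _]; split; first exact: smoothM.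
by exists K; split=> // x /f0 ->; rewrite mul0r.
Qed.

Lemma rtest0 D : rtest D (fun=> 0).
Proof.
split; first exact: smooth_cst.
by exists set0; split=> //; exact: compact0.
Qed.

Lemma rtest_partial D f i : rtest D f -> rtest D (partial i f).
Proof.
move=> [sf [K [cK KD f0]]]; split; first exact: smooth_partial.
exists K; split=> // x Kx.
have oK : open (~` K).
  by rewrite openC; apply: compact_closed => //; exact: norm_hausdorff.
have nx : \forall y \near x, f y = (cst 0 : E -> R) y.
  have h : nbhs x (~` K) by exact: open_nbhs_nbhs.
  by move: h; apply: filterS => y; exact: f0.
by rewrite /partial (near_eq_derive _ nx) derive_val.
Qed.

Lemma rtest_bounded D f : rtest D f -> exists M, forall x, `|f x| <= M.
Proof.
move=> [sf [K [cK KD f0]]].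
have cfK : compact (f @` K).
  by apply: continuous_compact => //; apply: continuous_subspaceT; exact: smooth_cont.
have [M [_ hM]] := compact_bounded cfK.
exists (`|M| + 1) => x; have [Kx|nK] := pselect (K x).
  by apply: (hM (`|M| + 1)); [by have := ler_norm M; lra|exists x].
by rewrite f0// normr0.
Qed.

Variable L : R.

Lemma rtest_bs f : rtest (box L) f -> bs (box L) f.
Proof.
move=> tf; split; last 2 first.
- exact: rtest_bounded tf.
- by case: tf => _ [K [_ KL f0]] x xL; apply: f0 => /KL.
- by apply: rV_cont_measurable; apply: smooth_cont; case: tf.
Qed.

Lemma rtest_acl f : rtest (box L) f -> acl L f (fun i => partial i f).
Proof.
move=> tf; have [sf _] := tf.
split=> [|i|i x a b]; [exact: rtest_bs|exact/rtest_bs/rtest_partial|].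
rewrite le_eqVlt => /predU1P[->|ab].
  by rewrite subrr set_itv1 Rintegral_set1.
have dl (h : E -> R) (t : R) : smooth h ->
    is_derive t (1 : R) (fun s => h (setc x i s)) (partial i h (setc x i t)).
  move=> sh; apply: line_partial; apply: derivableP; exact: smooth_derivable.
have cl (h : E -> R) : smooth h -> continuous (fun s => h (setc x i s)).
  move=> sh t; apply/differentiable_continuous/derivable1_diffP.
  by have [] := dl h t sh.
rewrite /Rintegral (@continuous_FTC2 _ _ (fun s => f (setc x i s)))//.
- by apply: continuous_subspaceT; apply: cl; exact: smooth_partial.
- split.
  + by move=> t _; have [] := dl f t sf.
  + by apply: cvg_at_right_filter; exact: cl.
  + by apply: cvg_at_left_filter; exact: cl.
- by move=> t _; rewrite derive1E; have [_] := dl f t sf.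
Qed.

Lemma rtest_ibp f g i : 0 <= L -> rtest (box L) f -> rtest (box L) g ->
  \int[mu]_x (f x * partial i g x) = - \int[mu]_x (g x * partial i f x).
Proof.
move=> L0 tf tg.
have h := acl_int0 i L0 (rtest_acl (rtestM tf tg)).
have [sf _] := tf; have [sg _] := tg.
rewrite partialM in h; try by move=> x; exact: smooth_derivable.
have bf := rtest_bs tf; have bg := rtest_bs tg.
have bpf := rtest_bs (rtest_partial i tf); have bpg := rtest_bs (rtest_partial i tg).
have := bs_intD (finmeas_box n L) (bsMbs bf bpg) (bsMbs bg bpf).
by rewrite h => /esym/eqP; rewrite addr_eq0 => /eqP.
Qed.

Lemma rtest_bump k (a b : E) : obox a b `<=` box L -> rtest (box L) (bump k a b).
Proof.
move=> ab; split; first exact: smooth_bump.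
exists (cbox k a b); split; [exact: cbox_compact| |exact: bump_out].
by apply: subset_trans ab; exact: cbox_obox.
Qed.

End rtest.

Section density.
Context {R : realType} {n : nat}.
Local Notation E := 'rV[R]_n.
Local Notation mu := (lebesgue_rV (R := R) n : {measure set E -> \bar R}).
Variable L : R.
Local Notation D := (@box R n L).

Lemma sqint_integrable (f : E -> R) : f \in sqint mu D -> mu.-integrable D (EFin \o f).
Proof.
move=> hf; have [mD Doo] := finmeas_box (R := R) n L.
have h1 : (fun=> 1 : R) \in sqint mu D.
  apply/sqintP; split; first exact: measurable_cst.
  by under eq_integral do rewrite expr1n; rewrite integral_cst// mul1e.
have := sqint_mul mD hf h1.
by apply: eq_integrable => // x _; rewrite /= mulr1.
Qed.

(** The integral of f vanishes over boxes inside D, by dominated convergence of bumps, then over all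
    measurable subsets by Dynkin induction. *)
Lemma test_dense (f : E -> R) : f \in sqint mu D ->
  (forall g, rtest D g -> \int[mu]_(x in D) (f x * g x) = 0) ->
  {ae mu, forall x, D x -> f x = 0}.
Proof.
move=> hf fg.
have [mD Doo] := finmeas_box (R := R) n L.
have fi := sqint_integrable hf.
have fmf := measurable_int _ fi.
have mf : measurable_fun D f by exact/measurable_EFinP.
pose P (A : set E) := (\int[mu]_(x in D `&` A) (f x)%:E = 0)%E.
have PA : forall A, measurable A -> P A.
  move=> A mA.
  have PB (a b : E) : obox a b `<=` D -> P (obox a b).
    move=> abD.
    have cv := @dominated_cvg _ E R mu D mD (fun k x => (f x * bump k a b x)%:E)
      (fun x => (f x * \1_(obox a b) x)%:E) (fun x => `|(f x)%:E|%E).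
    have z k : (\int[mu]_(x in D) (f x * bump k a b x)%:E = 0)%E.
      have hb := fg _ (rtest_bump k abD).
      rewrite -[LHS]fineK; first by rewrite -[fine _]/(Rintegral _ _ _) hb.
      apply: integrable_fin_num => //; apply: sqint_mul => //.
      apply: (@sqint_le _ _ _ mu D mD _ (fun=> 1)) => // [||x _].
      - apply: measurable_funTS; apply: rV_cont_measurable; apply: smooth_cont.
        exact: smooth_bump.
      - apply/sqintP; split; first exact: measurable_cst.
        by under eq_integral do rewrite expr1n; rewrite integral_cst// mul1e.
      - by rewrite normr1 ger0_norm ?bump_ge0// bump_le1.
    have -> : P (obox a b) = (\int[mu]_(x in D) (f x * \1_(obox a b) x)%:E = 0)%E.
      rewrite /P integral_mkcondr; congr (_ = _); apply: eq_integral => x _.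
      by rewrite patchE indicE; case: (_ \in _); rewrite ?mulr1 ?mulr0.
    suff : (fun k => \int[mu]_(x in D) (f x * bump k a b x)%:E)%E @ \oo -->
        (\int[mu]_(x in D) (f x * \1_(obox a b) x)%:E)%E.
      under eq_fun do rewrite z.
      by move=> h; apply: (cvg_unique _ h); [exact: ereal_hausdorff|exact: cvg_cst].
    apply: cv.
    - move=> k; apply/measurable_EFinP; apply: measurable_funM => //.
      by apply: measurable_funTS; apply: rV_cont_measurable; apply: smooth_cont; exact: smooth_bump.
    - move=> x Dx; apply/fine_cvgP; split; first exact: nearW.
      by rewrite /comp/=; apply: cvgM; [exact: cvg_cst|exact: bump_cvg].
    - by move=> x _; rewrite abse_fin_num.
    - exact: integrable_abse.
    - move=> k x Dx; rewrite !abse_EFin lee_fin normrM.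
      by rewrite -[leRHS]mulr1 ler_wpM2l// ger0_norm ?bump_ge0 ?bump_le1.
  have PB' (a b : E) : P (obox a b).
    (* Intersecting with D clips the corners and reduces an arbitrary box to one inside D. *)
    have -> : P (obox a b) = P (obox (\row_i Num.max (a ord0 i) (- L)) (\row_i Num.min (b ord0 i) L)).
      rewrite /P; congr (_ = _); congr integral; apply/seteqP; split=> x [xD xab]; split=> // i.
        by have := xD i; have := xab i; rewrite !mxE gt_max lt_min => /andP[-> ->] /andP[-> ->].
      by have := xab i; rewrite !mxE gt_max lt_min => /andP[/andP[-> _] /andP[-> _]].
    apply: PB => x xab i; have := xab i.
    by rewrite !mxE gt_max lt_min => /andP[/andP[_ ->] /andP[_ ->]].
  have PT : P setT.
    have -> : P setT = P (obox (\row_i (- L)) (\row_i L)).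
      rewrite /P; congr (_ = _); congr integral; apply/seteqP; split=> x [xD _]; split=> // i.
      by rewrite !mxE; exact: xD.
    exact: PB'.
  move: A mA; rewrite obox_generate.
  apply: (@dynkin_induction _ _ _ P) => //.
  - exact: obox_generate.
  - move=> _ _ [a [b ->]] [a' [b' ->]].
    exists (\row_i Num.max (a ord0 i) (a' ord0 i)), (\row_i Num.min (b ord0 i) (b' ord0 i)).
    apply/seteqP; split=> x.
      by move=> [h h'] i; rewrite !mxE gt_max lt_min; have /andP[-> ->] := h i; have /andP[-> ->] := h' i.
    by move=> h; split=> i; have := h i; rewrite !mxE gt_max lt_min => /andP[/andP[h1 h2] /andP[h3 h4]];
      rewrite ?h1 ?h2 ?h3 ?h4.
  - by move=> _ [a [b ->]]; exact: PB'.
  - move=> S mS PS.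
    have mSD : measurable (D `&` S) by exact: measurableI.
    have mSCD : measurable (D `&` ~` S) by apply: measurableI => //; exact: measurableC.
    have := @integral_setU _ _ _ mu (D `&` S) (D `&` ~` S) (EFin \o f) mSD mSCD.
    rewrite -setIUr setUv setIT => h.
    have PD : (\int[mu]_(x in D) (f x)%:E = 0)%E by move: PT; rewrite /P setIT.
    have := h fmf; rewrite disj_set2E setIACA setICr setI0 eqxx PD => /(_ isT).
    rewrite (_ : (\int[mu]_(x in D `&` S) (EFin \o f) x)%E = 0%E); last exact: PS.
    by rewrite add0e => h0; exact: esym h0.
  - move=> F mF tF PF.
    rewrite /P setI_bigcupr integral_bigcup//.
    + by rewrite eseries0// => k _ _; exact: PF.
    + exact: trivIset_setIl.
    + by move=> k; exact: measurableI.
    + by rewrite -setI_bigcupr; apply: integrableS fi => //; apply: measurableI => //; exact: bigcup_measurable.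
have : ae_eq mu D (EFin \o f) (cst 0).
  apply: integral_ae_eq => // A AD mA.
  rewrite integral0; have := PA A mA; rewrite /P.
  by rewrite (setIidr AD).
by apply: filterS => x /[apply] -[].
Qed.

End density.

Lemma cvg_sumr (R : realType) (I : finType) (F : I -> nat -> R) (l : I -> R) :
  (forall i, F i k @[k --> \oo] --> l i) -> \sum_i F i k @[k --> \oo] --> \sum_i l i.
Proof.
move=> Fl; elim: (index_enum I) => [|i r IH].
  under eq_fun do rewrite big_nil; rewrite big_nil; exact: cvg_cst.
under eq_fun do rewrite big_cons; rewrite big_cons.
by apply: cvgD.
Qed.

(** * The Dirichlet form *)

Section form_space.
Context {R : realType} {n : nat} (L : R).
Local Notation E := 'rV[R]_n.
Local Notation mu := (lebesgue_rV (R := R) n : {measure set E -> \bar R}).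
Local Notation D := (@box R n L).
Let mD : measurable D := @measurable_box R n L.

Definition boxL2 := L2sp mu (@measurable_box R n L).
HB.instance Definition _ := GRing.Lmodule.on boxL2.
Local Notation H := boxL2.
Local Notation ip := (@ipL2 _ _ _ mu D mD : H -> H -> R).

Lemma ip_semi : semi_inner ip. Proof. exact: ipL2_semi. Qed.

Lemma ip_cvg (u : nat -> H) l w : scvg ip u l -> ip (u k) w @[k --> \oo] --> ip l w.
Proof. by move=> h; exact: (@scvg_ip _ _ _ ip_semi _ _ h w). Qed.

Lemma ip_complete : scomplete ip. Proof. exact: ipL2_complete. Qed.

Record tst := MkTst { tfun :> E -> R; tfunP : rtest D tfun }.

Lemma tst_sqint (f : E -> R) : rtest D f -> f \in sqint mu D.
Proof.
move=> /rtest_bs tf; have /sqintP[mf foo] := bs_sqint (finmeas_box n L) tf.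
apply/sqintP; split; first exact: measurable_funTS.
apply: le_lt_trans foo; apply: ge0_subset_integral => //.
- by apply/measurable_EFinP; exact: measurable_funX.
- by move=> x _; rewrite lee_fin sqr_ge0.
Qed.

Definition tH (t : tst) : H := MkL2sp mD (tst_sqint (tfunP t)).
Definition tpart i (t : tst) : tst := MkTst (rtest_partial i (tfunP t)).
Definition tlin (a : R) (t s : tst) : tst := MkTst (rtest_lin a (tfunP t) (tfunP s)).
Definition t0 : tst := MkTst (rtest0 D).

Lemma tlinE a t s : tH (tlin a t s) = a *: tH t + tH s.
Proof. by apply/val_inj. Qed.

Lemma tpart_lin a t s i : tH (tpart i (tlin a t s)) = a *: tH (tpart i t) + tH (tpart i s).
Proof.
apply/val_inj; rewrite /= partialD//; move=> x; apply: smooth_derivable.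
  by case: (tfunP t).
by case: (tfunP s).
Qed.

Lemma ip_tstf (t : tst) (f : H) : ip (tH t) f = \int[mu]_x (t x * f x).
Proof.
rewrite ipL2_def bs_Rint_ind; apply: eq_Rintegral => x _ /=.
rewrite indicE; have [|/negP nD] := boolP (x \in D); first by rewrite mul1r.
by have [_ _ ->] := rtest_bs (tfunP t); rewrite ?mul0r// => /mem_set.
Qed.

Lemma ip_tst2 (t s : tst) : ip (tH t) (tH s) = \int[mu]_x (t x * s x).
Proof. exact: ip_tstf. Qed.

Lemma tst_ibp (t s : tst) i : 0 <= L ->
  ip (tH t) (tH (tpart i s)) = - ip (tH s) (tH (tpart i t)).
Proof.
move=> L0; rewrite !ip_tst2; exact: (rtest_ibp i L0 (tfunP t) (tfunP s)).
Qed.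

(** Diagonal extraction for finitely many components at once: the same [p m] must serve a function
    and all its partial derivatives. *)
Lemma scvg_diag (I : finType) (u : nat -> I -> H) (l : I -> H) (a : nat -> nat -> I -> H) :
  (forall m i, scvg ip (fun k => a m k i) (u m i)) -> (forall i, scvg ip (u ^~ i) (l i)) ->
  exists p : nat -> nat, forall i, scvg ip (fun m => a m (p m) i) (l i).
Proof.
move=> au ul.
have hm m : exists k, forall i, ip (a m k i - u m i) (a m k i - u m i) < m.+1%:R^-1.
  have hN i : exists N, forall k, (N <= k)%N -> ip (a m k i - u m i) (a m k i - u m i) < m.+1%:R^-1.
    have m0 : 0 < m.+1%:R^-1 :> R by rewrite invr_gt0.
    have /cvgrPdist_lt/(_ _ m0)[N _ hN] := au m i; exists N => k /hN/=.
    by rewrite sub0r normrN ger0_norm// (si_ge0 ip_semi).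
  have [N hN'] := choice hN.
  by exists (\max_i N i) => i; apply: hN'; exact: leq_bigmax.
have [p hp] := choice hm; exists p => i.
have h : 2 * m.+1%:R^-1 + 2 * ip (u m i - l i) (u m i - l i) @[m --> \oo] --> 2 * 0 + 2 * (0 : R).
  apply: cvgD; apply: cvgM; try exact: cvg_cst; [exact: cvg_harmonic|exact: ul].
rewrite !mulr0 addr0 in h.
apply: (squeeze_cvgr _ (cvg_cst 0) h); apply: nearW => m.
rewrite (si_ge0 ip_semi)/= (le_trans (siB_tri ip_semi _ (u m i) _))//.
by rewrite lerD2r ler_pM2l// ltW.
Qed.

(** [None] stands for the function and [Some i] for its i-th derivative, so that a graph point is a
    family over one finite index set. *)
Definition fcoord (p : H * ('I_n -> H)) (o : option 'I_n) : H :=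
  if o is Some i then p.2 i else p.1.

Definition tcoord (t : tst) (o : option 'I_n) : H :=
  if o is Some i then tH (tpart i t) else tH t.

(* The closure in L^2 of the graph of the gradient on test functions. *)
Definition formdom : {pred H * ('I_n -> H)} := fun p =>
  `[< exists t : nat -> tst, forall o, scvg ip (fun k => tcoord (t k) o) (fcoord p o) >].

Lemma tcoord_lin a t s o : tcoord (tlin a t s) o = a *: tcoord t o + tcoord s o.
Proof. by case: o => [i|]; [exact: tpart_lin|exact: tlinE]. Qed.

Lemma formdom_submod : submod_closed formdom.
Proof.
split=> [|a p q /asboolP[t ht] /asboolP[s hs]]; apply/asboolP.
  exists (fun=> tlin (-1) t0 t0) => o; have -> : fcoord 0 o = 0 by case: o.
  under eq_fun do rewrite tcoord_lin scaleN1r addNr.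
  exact: (scvg_cst ip_semi).
exists (fun k => tlin a (t k) (s k)) => o.
under eq_fun do rewrite tcoord_lin.
have -> : fcoord (a *: p + q) o = a *: fcoord p o + fcoord q o by case: o.
exact: (scvgD ip_semi).
Qed.

HB.instance Definition _ := GRing.isSubmodClosed.Build R (H * ('I_n -> H))%type formdom
  formdom_submod.

(** The weak gradient is part of the data, which makes it linear by definition. *)
Record form := MkForm { fpair : H * ('I_n -> H); fpairP : fpair \in formdom }.
HB.instance Definition _ := [isSub for fpair].
HB.instance Definition _ := [Choice of form by <:].
HB.instance Definition _ := [SubChoice_isSubLmodule of form by <:].
Local Notation X := form.

Definition fJ (u : X) : H := (fpair u).1.
Definition fG (u : X) (i : 'I_n) : H := (fpair u).2 i.

Lemma fJ_is_linear : linear fJ. Proof. by []. Qed.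
HB.instance Definition _ := GRing.isLinear.Build R X H *:%R fJ fJ_is_linear.

Lemma fG_lin a u v i : fG (a *: u + v) i = a *: fG u i + fG v i. Proof. by []. Qed.

Lemma tX_proof t : (tH t, fun i => tH (tpart i t)) \in formdom.
Proof. by apply/asboolP; exists (fun=> t) => -[i|]; exact: (scvg_cst ip_semi). Qed.

Definition tX t : X := MkForm (tX_proof t).

Lemma form_approx (u : X) : exists t : nat -> tst,
  scvg ip (fun k => tH (t k)) (fJ u) /\ forall i, scvg ip (fun k => tH (tpart i (t k))) (fG u i).
Proof.
have /asboolP[t ht] := fpairP u; exists t; split=> [|i]; first exact: (ht None).
exact: (ht (Some i)).
Qed.

Lemma form_closed (u : nat -> X) (l : H) (g : 'I_n -> H) :
  scvg ip (fJ \o u) l -> (forall i, scvg ip (fun k => fG (u k) i) (g i)) ->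
  (l, g) \in formdom.
Proof.
move=> ul ug.
have ht m : exists t : nat -> tst, forall o, scvg ip (fun k => tcoord (t k) o) (fcoord (fpair (u m)) o).
  by have /asboolP := fpairP (u m).
have [t htt] := choice ht.
have [||p hp] := @scvg_diag (option 'I_n) (fun m => fcoord (fpair (u m))) (fcoord (l, g))
    (fun m k => tcoord (t m k)).
- by move=> m o; exact: htt.
- by case=> [i|]; [exact: ug|exact: ul].
by apply/asboolP; exists (fun m => t m (p m)).
Qed.

Section weight.
Variable w : E -> R.
Hypothesis mw : measurable_fun setT w.
Variable B : R.
Hypothesis wB : forall x, `|w x| <= B.

Lemma wmul_sqint (f : H) : (fun x => w x * f x) \in sqint mu D.
Proof.
apply: (@sqint_le _ _ _ mu D mD _ (B *: (f : H) : E -> R)).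
- by apply: measurable_funM; [exact: measurable_funTS|exact: L2meas].
- exact: (L2funP (B *: f : L2sp mu mD)).
- move=> x _; have -> : (B *: f) x = B * f x by [].
  rewrite !normrM ler_wpM2r//.
  by rewrite (le_trans (wB x))// ler_norm.
Qed.

Definition wmul (f : H) : H := MkL2sp mD (wmul_sqint f).

Lemma wmul_lin a f g : wmul (a *: f + g) = a *: wmul f + wmul g.
Proof.
apply/val_inj/funext => x.
have -> : val (wmul (a *: f + g)) x = w x * (a * f x + g x) by [].
have -> : val (a *: wmul f + wmul g) x = a * (w x * f x) + w x * g x by [].
by ring.
Qed.

Lemma wmulC f g : ip (wmul f) g = ip (wmul g) f.
Proof. by rewrite !ipL2_def; apply: eq_Rintegral => x _ /=; ring. Qed.

Lemma wmul_le (c : R) f : {ae mu, forall x, D x -> c <= w x} ->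
  c * ip f f <= ip (wmul f) f.
Proof.
move=> wc; rewrite -(siZl ip_semi) -subr_ge0 -(siBl ip_semi).
rewrite ipL2_def /Rintegral; apply: fine_ge0.
have h := L2mul (wmul f - c *: f : L2sp mu mD) f.
rewrite (_ : (\int[mu]_(x in D) _)%E = (\int[mu]_(x in D) `|((wmul f - c *: f) x * f x)%:E|)%E).
  exact: integral_ge0.
apply: ae_eq_integral => //.
- exact: measurable_int h.
- by apply: measurableT_comp => //; exact: measurable_int h.
move: wc; apply: filterS => x wx Dx; rewrite gee0_abs// lee_fin.
have -> : (wmul f - c *: f) x = w x * f x - c * f x by [].
rewrite -mulrBl -mulrA; apply: mulr_ge0; first by rewrite subr_ge0; exact: wx.
by rewrite -expr2 sqr_ge0.
Qed.

Lemma wmul_ge f : ip (wmul f) f <= B * ip f f.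
Proof.
rewrite -(siZl ip_semi) -subr_ge0 -(siBl ip_semi) ipL2_def; apply: Rintegral_ge0 => x _.
have -> : (B *: f - wmul f) x = B * f x - w x * f x by [].
rewrite -mulrBl -mulrA; apply: mulr_ge0; last by rewrite -expr2 sqr_ge0.
by rewrite subr_ge0 (le_trans (ler_norm _)).
Qed.

(** Used with w = V for the operator itself, and with w = [Vw], which is at least 1, as the energy
    inner product. *)
Definition en (u v : X) : R := \sum_i ip (fG u i) (fG v i) + ip (wmul (fJ u)) (fJ v).

Hypothesis w1 : {ae mu, forall x, D x -> 1 <= w x}.

Lemma wmul_ge1 f : ip f f <= ip (wmul f) f.
Proof. by have := wmul_le f w1; rewrite mul1r. Qed.

Lemma en_semi : semi_inner en.
Proof.
have s := ip_semi; split=> [u v|a u v z|u]; rewrite /en.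
- congr (_ + _); last exact: wmulC.
  by apply: eq_bigr => i _; rewrite (siC s).
- rewrite mulrDr addrACA; congr (_ + _).
    by rewrite mulr_sumr -big_split; apply: eq_bigr => i _; rewrite fG_lin (si_lin s).
  by rewrite linearP wmul_lin (si_lin s).
- rewrite addr_ge0 ?sumr_ge0// => [i _|]; first exact: (si_ge0 s).
  by apply: le_trans (wmul_ge1 _); exact: (si_ge0 s).
Qed.

Lemma en_geG u : \sum_i ip (fG u i) (fG u i) <= en u u.
Proof.
by rewrite /en lerDl; apply: le_trans (wmul_ge1 _); exact: (si_ge0 ip_semi).
Qed.

Lemma en_geGi u i : ip (fG u i) (fG u i) <= en u u.
Proof.
apply: le_trans (en_geG u); rewrite (bigD1 i)//= lerDl.
by apply: sumr_ge0 => j _; exact: (si_ge0 ip_semi).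
Qed.

Lemma en_ge u : ip (fJ u) (fJ u) <= en u u.
Proof.
rewrite /en; have := wmul_ge1 (fJ u).
have : 0 <= \sum_i ip (fG u i) (fG u i) by apply: sumr_ge0 => j _; exact: (si_ge0 ip_semi).
lra.
Qed.

(** The energy dominates every component, so a Cauchy sequence converges componentwise, with limit
    in the closed graph; the upper bound B on w turns this back into convergence in energy. *)
Lemma en_complete : scomplete en.
Proof.
move=> u cu; have s := ip_semi.
have [l ul] : exists l, scvg ip (fJ \o u) l.
  apply: ip_complete => e e0; have [N hN] := cu e e0; exists N => m k Nm Nk /=.
  by rewrite -linearB; apply: le_lt_trans (en_ge _) (hN _ _ Nm Nk).
have hg i : exists g, scvg ip (fun k => fG (u k) i) g.
  apply: ip_complete => e e0; have [N hN] := cu e e0; exists N => m k Nm Nk.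
  have -> : fG (u m) i - fG (u k) i = fG (u m - u k) i by [].
  by apply: le_lt_trans (en_geGi _ _) (hN _ _ Nm Nk).
have [g ug] := choice hg.
exists (MkForm (form_closed ul ug)); set v := MkForm _.
have h : \sum_i ip (fG (u k) i - g i) (fG (u k) i - g i) + B * ip (fJ (u k) - l) (fJ (u k) - l)
    @[k --> \oo] --> \sum_(i < n) (0 : R) + B * 0.
  apply: cvgD; last by apply: cvgM; [exact: cvg_cst|exact: ul].
  by apply: cvg_sumr => i; exact: ug.
rewrite big1// mulr0 addr0 in h.
apply: (squeeze_cvgr _ (cvg_cst 0) h); apply: nearW => k.
by rewrite (si_ge0 en_semi)/= /en lerD2l; exact: wmul_ge.
Qed.

Hypothesis L0 : 0 < L.

(** Poincare's inequality holds for test functions, and both of its sides are continuous along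
    [form_approx]. *)
Lemma en_compact (eps : R) : 0 < eps -> exists s : seq H,
  forall u, ip (fJ u) (fJ u) <= \sum_(h <- s) ip (fJ u) h ^+ 2 + eps * en u u.
Proof.
move=> eps0; have s := ip_semi.
have [I [h [mh hP]]] := @poincare R n L eps L0 eps0.
have hs i : h i \in sqint mu D.
  have [mhi [M hM]] := mh i; have [_ Doo] := finmeas_box (R := R) n L.
  apply: (@sqint_le _ _ _ mu D mD _ (fun=> M)).
  - exact: measurable_funTS.
  - apply/sqintP; split; first exact: measurable_cst.
    by rewrite integral_cst// lte_mul_pinfty ?lee_fin ?sqr_ge0.
  - by move=> x _; rewrite (le_trans (hM x))// ler_norm.
pose hH i : H := MkL2sp mD (hs i).
exists [seq hH i | i <- index_enum I] => u.
apply: le_trans (_ : \sum_(h <- [seq hH i | i <- index_enum I]) ip (fJ u) h ^+ 2 +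
   eps * \sum_i ip (fG u i) (fG u i) <= _); last first.
  by rewrite lerD2l ler_wpM2l ?(ltW eps0)// en_geG.
rewrite big_map.
have [t [tJ tG]] := form_approx u.
have c1 := scvg_sq s tJ.
have c2 : \sum_i ip (tH (t k)) (hH i) ^+ 2 + eps * \sum_i ip (tH (tpart i (t k))) (tH (tpart i (t k)))
    @[k --> \oo] --> \sum_i ip (fJ u) (hH i) ^+ 2 + eps * \sum_i ip (fG u i) (fG u i).
  apply: cvgD.
    apply: cvg_sumr => i; rewrite expr2.
    rewrite (_ : (fun k => _) = (fun k => ip (tH (t k)) (hH i) * ip (tH (t k)) (hH i))); last first.
      by apply/funext => k; rewrite expr2.
    by apply: cvgM; exact: (scvg_ip s tJ).
  apply: cvgM; first exact: cvg_cst.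
  by apply: cvg_sumr => i; exact: (scvg_sq s (tG i)).
suff h' k : ip (tH (t k)) (tH (t k)) <= \sum_i ip (tH (t k)) (hH i) ^+ 2 +
    eps * \sum_i ip (tH (tpart i (t k))) (tH (tpart i (t k))).
  have := ler_lim (cvgP _ c1) (cvgP _ c2) (nearW _ h').
  by rewrite (cvg_lim _ c1)// (cvg_lim _ c2)//; apply.
rewrite ip_tst2; under [X in _ <= _ + _ * X]eq_bigr do rewrite ip_tst2.
under [X in _ <= X + _]eq_bigr do rewrite ip_tstf.
have := hP _ _ (rtest_acl (tfunP (t k))).
under eq_Rintegral do rewrite expr2; move=> /le_trans; apply.
by rewrite lerD2l ler_pM2l//; apply: ler_sum => i _.
Qed.

End weight.

Lemma fJ_dense (g : H) : (forall v : X, ip g (fJ v) = 0) -> ip g g = 0.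
Proof.
move=> h; apply/ipL2_eq0; apply: test_dense => [|t tt]; first exact: L2funP.
by have := h (tX (MkTst tt)); rewrite ipL2_def.
Qed.

Lemma fG_ibp (L0 : 0 <= L) (u : X) i (s : tst) :
  ip (fJ u) (tH (tpart i s)) = - ip (fG u i) (tH s).
Proof.
have [t [tJ tG]] := form_approx u.
have c1 := @ip_cvg _ _ (tH (tpart i s)) tJ.
have c2 := cvgN (@ip_cvg _ _ (tH s) (tG i)).
apply: (cvg_unique (@Rhausdorff R) c1).
suff -> : (fun k => ip (tH (t k)) (tH (tpart i s))) = - (fun k => ip (tH (tpart i (t k))) (tH s)).
  exact: c2.
by apply/funext => k; rewrite tst_ibp// (siC ip_semi).
Qed.

Definition lapl (t : tst) : H := \sum_i tH (tpart i (tpart i t)).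

(** Links the distributional Laplacian to the form: one integration by parts moves a derivative off
    the test function, and approximation by test functions extends the identity to the whole form
    domain. *)
Lemma weak_laplacian (L0 : 0 <= L) (x : X) (w : H) :
  (forall t, ip (fJ x) (lapl t) = ip w (tH t)) <->
  (forall v, \sum_i ip (fG x i) (fG v i) = - ip w (fJ v)).
Proof.
have lapE t : ip (fJ x) (lapl t) = - \sum_i ip (fG x i) (tH (tpart i t)).
  rewrite /lapl (si_sumr ip_semi) -sumrN; apply: eq_bigr => i _; exact: fG_ibp.
split=> h.
  move=> v; have [t [tJ tG]] := form_approx v.
  have c1 : \sum_i ip (fG x i) (tH (tpart i (t k))) @[k --> \oo] --> \sum_i ip (fG x i) (fG v i).
    apply: cvg_sumr => i; rewrite (siC ip_semi).
    under eq_fun do rewrite (siC ip_semi).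
    exact: (scvg_ip ip_semi (tG i)).
  have c2 := cvgN (@ip_cvg _ _ w tJ).
  rewrite (siC ip_semi w); apply: (cvg_unique (@Rhausdorff R) c1).
  suff -> : (fun k => \sum_i ip (fG x i) (tH (tpart i (t k)))) = - (fun k => ip (tH (t k)) w).
    exact: c2.
  by apply/funext => k; rewrite -[LHS]opprK -lapE h (siC ip_semi).
by move=> t; rewrite lapE (h (tX t)) opprK.
Qed.

End form_space.

(** * Complex functions and the Schrodinger operator *)

Section cpart.
Context {R : realType}.
Local Notation C := R[i].

(** Booleans index the imaginary part ([true]) and the real part ([false]), so that one statement
    about real functions covers both. *)
Definition cpart (b : bool) (z : C) : R := if b then complex.Im z else complex.Re z.

Lemma cpartD b z z' : cpart b (z + z') = cpart b z + cpart b z'.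
Proof. by case: b z z' => -[? ?] [? ?]. Qed.

Lemma cpartN b z : cpart b (- z) = - cpart b z.
Proof. by case: b z => -[? ?]. Qed.

Lemma cpartB b z z' : cpart b (z - z') = cpart b z - cpart b z'.
Proof. by rewrite cpartD cpartN. Qed.

Lemma cpartZ b (r : R) z : cpart b (r%:C%C * z) = r * cpart b z.
Proof. by case: b z => -[x y] /=; ring. Qed.

Lemma cpart_sum b (I : Type) (r : seq I) (F : I -> C) :
  cpart b (\sum_(i <- r) F i) = \sum_(i <- r) cpart b (F i).
Proof. by apply: (big_morph (cpart b)); [exact: cpartD|case: b]. Qed.

Lemma cpart_eq z z' : (forall b, cpart b z = cpart b z') -> z = z'.
Proof. by case: z z' => [x y] [x' y'] h; have := h true; have := h false => /= -> ->. Qed.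

Definition mkC (T : Type) (p : bool -> T -> R) (x : T) : C := Complex (p false x) (p true x).

Lemma cpart_mkC T b (p : bool -> T -> R) x : cpart b (mkC p x) = p b x.
Proof. by case: b. Qed.

End cpart.

Lemma Complex_inj0 (R : realType) (a b c d e f g h : R) : e = 0 -> f = 0 -> g = 0 -> h = 0 ->
  Complex (a + e) (b - f) = Complex (c + g) (d - h) -> a = c /\ b = d.
Proof. by move=> -> -> -> ->; rewrite !addr0 !subr0 => -[-> ->]. Qed.

Section bridge.
Context {R : realType} {n : nat} {L : R}.
Local Notation E := 'rV[R]_n.
Local Notation C := R[i].
Local Notation mu := (lebesgue_rV (R := R) n : {measure set E -> \bar R}).
Local Notation D := (@box R n L).
Local Notation H := (@boxL2 R n L).
Local Notation X := (@form R n L).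
Let mD : measurable D := @measurable_box R n L.
Local Notation ip := (@ipL2 _ _ _ mu D mD : H -> H -> R).
Let sip : semi_inner ip := @ip_semi R n L.

Lemma L2P (f : E -> C) : L2 D f <-> forall b, (fun x => cpart b (f x)) \in sqint mu D.
Proof.
have sE : measurable_fun D (fun x => complex.Re (f x)) ->
    measurable_fun D (fun x => complex.Im (f x)) -> sqnorm D f =
   (\int[mu]_(x in D) (complex.Re (f x) ^+ 2)%:E + \int[mu]_(x in D) (complex.Im (f x) ^+ 2)%:E)%E.
  move=> mr mi; rewrite /sqnorm /sqmod; under eq_integral do rewrite EFinD.
  rewrite ge0_integralD//.
  - by move=> x _; rewrite lee_fin sqr_ge0.
  - by apply/measurable_EFinP; exact: measurable_funX.
  - by move=> x _; rewrite lee_fin sqr_ge0.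
  - by apply/measurable_EFinP; exact: measurable_funX.
have ge0 (g : E -> R) : (0 <= \int[mu]_(x in D) (g x ^+ 2)%:E)%E.
  by apply: integral_ge0 => x _; rewrite lee_fin sqr_ge0.
split.
  move=> [mr mi]; rewrite sE// => foo [] /=; apply/sqintP; split=> //.
    by apply: le_lt_trans foo; rewrite leeDr.
  by apply: le_lt_trans foo; rewrite leeDl.
move=> h; have /sqintP[mi ii] := h true; have /sqintP[mr ir] := h false.
by split=> //; rewrite sE// lte_add_pinfty.
Qed.

(** [insubd] makes [pt] total, with value 0 when the selected part is not square integrable. *)
Lemma pt_key : {p : bool -> (E -> C) -> H |
  forall b f, p b f = insubd (0 : H) (fun x => cpart b (f x))}.
Proof. by exists (fun b f => insubd (0 : H) (fun x => cpart b (f x))). Qed.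

Definition pt : bool -> (E -> C) -> H := sval pt_key.

Lemma pt_def b f : pt b f = insubd (0 : H) (fun x => cpart b (f x)).
Proof. exact: (svalP pt_key). Qed.

Lemma ptE b f : L2 D f -> (pt b f : E -> R) = (fun x => cpart b (f x)).
Proof. by move=> /L2P/(_ b) hf; rewrite pt_def; exact: (@insubdK _ _ H). Qed.

Lemma pt_eq b f (h : H) : (forall x, cpart b (f x) = h x) -> pt b f = h.
Proof.
move=> fh; rewrite pt_def (_ : (fun x => _) = val h) ?valKd//.
by apply/funext => x; rewrite fh.
Qed.

Definition ofH (p : bool -> H) : E -> C := mkC (fun b => p b : E -> R).

Lemma pt_ofH b p : pt b (ofH p) = p b.
Proof. by apply: pt_eq => x; rewrite cpart_mkC. Qed.

Lemma L2_ofH p : L2 D (ofH p).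
Proof.
apply/L2P => b; rewrite (_ : (fun x => _) = (p b : E -> R)); first exact: L2funP.
by apply/funext => x; rewrite cpart_mkC.
Qed.

Lemma ofHK f : L2 D f -> ofH (pt ^~ f) = f.
Proof.
move=> hf; apply/funext => x; apply: cpart_eq => b.
by rewrite cpart_mkC ptE.
Qed.

Lemma ptB b f g : L2 D f -> L2 D g -> pt b (f \- g) = pt b f - pt b g.
Proof.
move=> hf hg; apply: pt_eq => x; rewrite cpartB.
have -> : (pt b f - pt b g) x = pt b f x - pt b g x by [].
by rewrite !ptE.
Qed.

Lemma L2_lin (a : R) f g : L2 D f -> L2 D g -> L2 D (fun x => a%:C%C * f x + g x).
Proof.
move=> hf hg; rewrite -(ofHK hf) -(ofHK hg).
rewrite (_ : (fun x => _) = ofH (fun b => a *: pt b f + pt b g)); first exact: L2_ofH.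
by apply/funext => x; apply: cpart_eq => b; rewrite cpartD cpartZ !cpart_mkC.
Qed.

Lemma L2B f g : L2 D f -> L2 D g -> L2 D (f \- g).
Proof.
move=> hf hg; rewrite -(ofHK hf) -(ofHK hg).
rewrite (_ : _ \- _ = ofH (fun b => pt b f - pt b g)); first exact: L2_ofH.
by apply/funext => x; apply: cpart_eq => b; rewrite cpartB !cpart_mkC.
Qed.

Definition nsq (f : E -> C) : R := ip (pt false f) (pt false f) + ip (pt true f) (pt true f).

Lemma nsq_ge0 f : 0 <= nsq f.
Proof. by rewrite addr_ge0// (si_ge0 sip). Qed.

Lemma pt_le_nsq b f : ip (pt b f) (pt b f) <= nsq f.
Proof. rewrite /nsq; case: b; [rewrite lerDr|rewrite lerDl]; exact: (si_ge0 sip). Qed.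

Lemma sqnormE f : L2 D f -> sqnorm D f = (nsq f)%:E.
Proof.
have e b : L2 D f -> (ip (pt b f) (pt b f))%:E = (\int[mu]_(x in D) (cpart b (f x) ^+ 2)%:E)%E.
  by move=> hf; rewrite ipL2E (ptE b hf).
move=> hf; rewrite /nsq EFinD; apply: etrans; last first.
  by apply: f_equal2; apply/esym/e.
rewrite -ge0_integralD.
- by [].
- exact: mD.
- by move=> x _; rewrite lee_fin sqr_ge0.
- by apply/measurable_EFinP/measurable_funX; case: hf.
- by move=> x _; rewrite lee_fin sqr_ge0.
- by apply/measurable_EFinP/measurable_funX; case: hf.
Qed.

Lemma eq_L2P f g : L2 D f -> L2 D g ->
  eq_L2 D f g <-> forall b, ip (pt b f - pt b g) (pt b f - pt b g) = 0.
Proof.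
move=> hf hg; split=> [h b|h].
  apply/ipL2_eq0; move: h; apply: filterS => x fg Dx.
  have -> : (pt b f - pt b g) x = pt b f x - pt b g x by [].
  by rewrite !ptE// fg// subrr.
have /ipL2_eq0 h1 := h true; have /ipL2_eq0 h2 := h false.
move: h1 h2; apply: filterS2 => x h1 h2 Dx; apply: cpart_eq => b.
have : (pt b f - pt b g) x = 0 by case: b; [exact: h1|exact: h2].
have -> : (pt b f - pt b g) x = pt b f x - pt b g x by [].
by rewrite !ptE// => /eqP; rewrite subr_eq0 => /eqP.
Qed.

Lemma innerE f g : L2 D f -> L2 D g -> inner D f g =
  Complex (ip (pt false f) (pt false g) + ip (pt true f) (pt true g))
          (ip (pt true f) (pt false g) - ip (pt false f) (pt true g)).
Proof.
move=> hf hg; rewrite /inner; congr Complex.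
  rewrite !ipL2_def -RintegralD//; try exact: L2mul.
  apply: eq_Rintegral => x _; rewrite !ptE//.
  by case: (f x) (g x) => [a b] [c e] /=; ring.
rewrite !ipL2_def -RintegralB//; try exact: L2mul.
apply: eq_Rintegral => x _; rewrite !ptE//.
by case: (f x) (g x) => [a b] [c e] /=; ring.
Qed.

Lemma cvg_pt (f : nat -> E -> C) g : (forall k, L2 D (f k)) -> L2 D g ->
  (sqnorm D (f k \- g) @[k --> \oo] --> 0%E) <->
  (forall b, scvg ip (fun k => pt b (f k)) (pt b g)).
Proof.
move=> hf hg; have fE : (fun k => sqnorm D (f k \- g)) = EFin \o (fun k => nsq (f k \- g)).
  by apply/funext => k /=; rewrite sqnormE//; exact: L2B.
rewrite fE; split.
  move=> /fine_cvgP[_ h] b; apply: (squeeze_cvgr _ (cvg_cst 0) h).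
  by apply: nearW => k; rewrite (si_ge0 sip)/= -ptB// pt_le_nsq.
move=> h; apply: cvg_EFin; first exact: nearW.
rewrite (_ : _ \o _ = (fun k => nsq (f k \- g)))//.
rewrite (_ : (fun k => _) = (fun k => ip (pt false (f k) - pt false g) (pt false (f k) - pt false g) +
   ip (pt true (f k) - pt true g) (pt true (f k) - pt true g))).
  rewrite -[0]addr0; apply: cvgD; exact: h.
by apply/funext => k; rewrite /nsq !ptB.
Qed.

Lemma test_functionP (f : E -> C) :
  test_function D f <-> forall b, rtest D (fun x => cpart b (f x)).
Proof.
split=> [[sr si [K [cK KD f0]]] b|h].
  split; first by case: b.
  by exists K; split=> // x /f0 ->; case: b.
have [sr [K [cK KD r0]]] := h false; have [si [K' [cK' KD' i0]]] := h true.
split=> //; exists (K `|` K'); split; [exact: compactU|by rewrite subUset|].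
move=> x /not_orP[Kx K'x]; apply: cpart_eq => -[]; first by rewrite i0.
by rewrite r0.
Qed.

Lemma cpart_partialC b i (f : E -> C) x :
  cpart b (partialC i f x) = partial i (fun y => cpart b (f y)) x.
Proof. by case: b. Qed.

Definition ctst (t : bool -> tst (n := n) L) : E -> C := mkC (fun b => t b : E -> R).

Lemma cpart_ctst b t : (fun x => cpart b (ctst t x)) = t b :> (E -> R).
Proof. by apply/funext => x; rewrite cpart_mkC. Qed.

Lemma test_ctst t : test_function D (ctst t).
Proof. by apply/test_functionP => b; rewrite cpart_ctst; exact: tfunP. Qed.

Lemma test_ctstP f : test_function D f -> exists t, f = ctst t.
Proof.
move=> /test_functionP h; exists (fun b => MkTst (h b)).
by apply/funext => x; apply: cpart_eq => b; rewrite cpart_mkC.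
Qed.

Lemma ctstE t : ctst t = ofH (fun b => tH (t b)).
Proof. by []. Qed.

Lemma L2_ctst t : L2 D (ctst t).
Proof. rewrite ctstE; exact: L2_ofH. Qed.

Lemma pt_ctst b t : pt b (ctst t) = tH (t b).
Proof. by rewrite ctstE pt_ofH. Qed.

Lemma partialC_ctst i t : partialC i (ctst t) = ctst (fun b => tpart i (t b)).
Proof.
apply/funext => x; apply: cpart_eq => b; rewrite cpart_partialC cpart_ctst.
by case: b.
Qed.

Lemma laplaceC_ctst t : laplaceC (ctst t) = ofH (fun b => lapl (t b)).
Proof.
apply/funext => x; apply: cpart_eq => b; rewrite cpart_mkC /laplaceC cpart_sum.
have -> : lapl (t b) x = \sum_i tH (tpart i (tpart i (t b))) x.
  by rewrite /lapl; apply: (big_morph (fun h : H => h x)).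
by apply: eq_bigr => i _; rewrite partialC_ctst partialC_ctst cpart_mkC.
Qed.

Lemma H10P (u : E -> C) : H10 D u <-> L2 D u /\ exists x : bool -> X, forall b, fJ (x b) = pt b u.
Proof.
split.
  move=> [phi [g [hu hg tphi phiu phig]]]; split=> //.
  have [t tE] := choice (fun k => test_ctstP (tphi k)).
  have c0 : forall b, scvg ip (fun k => tH (t k b)) (pt b u).
    have tu k : phi k = ofH (fun b => tH (t k b)) by rewrite tE.
    move/cvg_pt: phiu => /(_ _ hu) h b.
    have /h /(_ b) : forall k, L2 D (phi k) by move=> k; rewrite tu; exact: L2_ofH.
    by under eq_fun do rewrite tu pt_ofH.
  have cg i : forall b, scvg ip (fun k => tH (tpart i (t k b))) (pt b (g i)).
    have tu k : partialC i (phi k) = ofH (fun b => tH (tpart i (t k b))).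
      by rewrite tE partialC_ctst.
    move/cvg_pt: (phig i) => /(_ _ (hg i)) h b.
    have /h /(_ b) : forall k, L2 D (partialC i (phi k)) by move=> k; rewrite tu; exact: L2_ofH.
    by under eq_fun do rewrite tu pt_ofH.
  have fd b : (pt b u, fun i => pt b (g i)) \in formdom (R := R) (n := n) (L := L).
    by apply/asboolP; exists (fun k => t k b) => -[i|]; [exact: cg|exact: c0].
  by exists (fun b => MkForm (fd b)).
move=> [hu [x xu]].
have [t ht] := choice (fun b => form_approx (x b)).
exists (fun k => ctst (fun b => t b k)), (fun i => ofH (fun b => fG (x b) i)); split=> //.
- by move=> i; exact: L2_ofH.
- by move=> k; exact: test_ctst.
- apply/cvg_pt => //.
    by move=> k; rewrite ctstE; exact: L2_ofH.
  move=> b; under eq_fun do rewrite ctstE pt_ofH; rewrite -xu; exact: (ht b).1.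
- move=> i; apply/cvg_pt => //.
  + by move=> k; rewrite partialC_ctst ctstE; exact: L2_ofH.
  + exact: L2_ofH.
  + move=> b; under eq_fun do rewrite partialC_ctst ctstE pt_ofH.
    by rewrite pt_ofH; exact: (ht b).2.
Qed.

Lemma dirichlet_laplacianP (u v : E -> C) : 0 <= L -> dirichlet_laplacian D u v <->
  [/\ L2 D u, L2 D v & exists x : bool -> X, forall b, fJ (x b) = pt b u /\
     forall z, \sum_i ip (fG (x b) i) (fG z i) = - ip (pt b v) (fJ z)].
Proof.
move=> L0; split.
  move=> [/H10P[hu [x xu]] hv h]; split=> //; exists x => b; split=> //.
  apply/weak_laplacian => // t; rewrite xu.
  (* Testing against a real test function separates the real and imaginary equations. *)
  pose ct b := if b then t0 L else t.
  have := h _ (test_ctst ct).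
  rewrite laplaceC_ctst (innerE hu (L2_ofH _)) (innerE hv (L2_ctst _)).
  rewrite !pt_ofH !pt_ctst /ct/=.
  have -> : lapl (t0 L) = 0 :> H.
    rewrite /lapl big1// => i _; apply/val_inj/funext => y.
    have p0 j : partial j (fun=> 0 : R) = (fun=> 0) :> (E -> R) by rewrite partial_cst.
    by rewrite /= p0 p0.
  have -> : tH (t0 L) = 0 :> H by apply/val_inj.
  case/(Complex_inj0 (si0r sip _) (si0r sip _) (si0r sip _) (si0r sip _)) => h1 h2.
  case: b; [exact: h2|exact: h1].
move=> [hu hv [x hx]]; split=> //.
  by apply/H10P; split=> //; exists x => b; case: (hx b).
move=> phi /test_ctstP[t ->].
rewrite laplaceC_ctst (innerE hu (L2_ofH _)) (innerE hv (L2_ctst _)) !pt_ofH !pt_ctst.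
have hw b s : ip (pt b u) (lapl s) = ip (pt b v) (tH s).
  by have [<- /weak_laplacian] := hx b; apply.
by rewrite !hw.
Qed.

Section potential.
Variables (V : E -> R) (mV : measurable_fun setT V) (B : R) (bV : forall x, `|V x| <= B).

(** The graph of - Delta + V on real functions, in weak form. *)
Definition opgraph (u g : H) : Prop :=
  exists2 x : X, fJ x = u & forall v, en mV bV x v = ip g (fJ v).

Lemma schrodingerP (u g : E -> C) : 0 <= L -> schrodinger D V u g <->
  [/\ L2 D u, L2 D g & forall b, opgraph (pt b u) (pt b g)].
Proof.
move=> L0; split.
  move=> [hg [w /dirichlet_laplacianP[//|hu hw [x hx]] gw]]; split=> // b.
  have [xu xw] := hx b; exists (x b) => // v; rewrite /en xw xu.
  have -> : - ip (pt b w) (fJ v) + ip (wmul mV bV (pt b u)) (fJ v) =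
     ip (wmul mV bV (pt b u) - pt b w) (fJ v) by rewrite (siBl sip); ring.
  suff h : ip (wmul mV bV (pt b u) - pt b w - pt b g)
     (wmul mV bV (pt b u) - pt b w - pt b g) = 0.
    by have /eqP := si_null sip (fJ v) h; rewrite (siBl sip) subr_eq0 => /eqP.
  apply/ipL2_ae; apply: filterS gw => y gy Dy.
  have -> : (wmul mV bV (pt b u) - pt b w) y = V y * pt b u y - pt b w y by [].
  rewrite (ptE b hu) (ptE b hw) (ptE b hg) gy// cpartD cpartN cpartZ; ring.
move=> [hu hg hx]; split=> //.
pose w : E -> C := ofH (fun b => wmul mV bV (pt b u) - pt b g).
exists w.
  apply/dirichlet_laplacianP => //; split=> //; first exact: L2_ofH.
  have hx' b : exists x : X, fJ x = pt b u /\ forall v, en mV bV x v = ip (pt b g) (fJ v).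
    by have [x] := hx b; exists x.
  have [x xP] := choice hx'; exists x => b; have [xu xv] := xP b; split=> // z.
  by have := xv z; rewrite /en pt_ofH (siBl sip) xu; lra.
apply: aeW => x _; apply: cpart_eq => b; rewrite cpartD cpartN cpartZ cpart_mkC.
have -> : (wmul mV bV (pt b u) - pt b g) x = V x * pt b u x - pt b g x by [].
by rewrite !ptE//; ring.
Qed.

End potential.
End bridge.

(** * The spectral resolution *)

Section atomic_measure.
Context {R : realType}.
Variables (a : nat -> {nonneg R}) (x : nat -> R).
Local Notation T := (measurableTypeR R).

Definition atomic : {measure set T -> \bar R} :=
  mseries (fun k => mscale (a k) (dirac (x k : T))) 0.

Lemma ge0_integral_atomic (f : R -> R) : measurable_fun setT f -> (forall y, 0 <= f y) ->
  (\int[atomic]_(y in setT) (f y)%:E = \sum_(k <oo) ((a k)%:num * f (x k))%:E)%E.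
Proof.
move=> mf f0; have mf' : measurable_fun [set: T] (EFin \o f) by exact/measurable_EFinP.
rewrite ge0_integral_measure_series//; last by move=> y _; rewrite lee_fin.
apply: eq_eseriesr => k _.
rewrite ge0_integral_mscale//; last by move=> y _; rewrite lee_fin.
by rewrite integral_dirac// diracT mul1e EFinM.
Qed.

Lemma atomicE A : measurable A ->
  (atomic A = \sum_(k <oo) ((a k)%:num * \1_A (x k))%:E)%E.
Proof. by move=> mA; apply: eq_eseriesr => k _. Qed.

End atomic_measure.

Lemma eseries_lim (R : realType) (r : nat -> R) (l : R) :
  \sum_(k < n) r k @[n --> \oo] --> l -> (\sum_(k <oo) (r k)%:E = l%:E)%E.
Proof.
move=> h; apply: cvg_lim => //.
rewrite (_ : (fun n => _) = EFin \o (fun n => \sum_(k < n) r k)); last first.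
  by apply/funext => n /=; rewrite big_mkord sumEFin.
by apply: cvg_EFin => //; exact: nearW.
Qed.

Lemma ge0_series_bounded (R : realType) (r : nat -> R) (M : R) : (forall k, 0 <= r k) ->
  (forall n, \sum_(k < n) r k <= M) -> exists l : R, \sum_(k < n) r k @[n --> \oo] --> l.
Proof.
move=> r0 rM.
exists (limn (fun n => \sum_(k < n) r k)); apply: nondecreasing_is_cvgn.
  by apply/nondecreasing_seqP => n; rewrite big_ord_recr/= lerDl.
by exists M => _ [n _ <-].
Qed.

Lemma eseries_ltyP (R : realType) (r : nat -> R) : (forall k, 0 <= r k) ->
  (\sum_(k <oo) (r k)%:E < +oo)%E <-> exists M, forall n, \sum_(k < n) r k <= M.
Proof.
move=> r0; split.
  move=> h; have h0 : (0 <= \sum_(k <oo) (r k)%:E)%E.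
    by apply: nneseries_ge0 => k _ _; rewrite lee_fin.
  exists (fine (\sum_(k <oo) (r k)%:E)%E) => n.
  rewrite -lee_fin fineK ?ge0_fin_numE// -sumEFin -(big_mkord xpredT (fun k => (r k)%:E)).
  by apply: nneseries_lim_ge => k _ _; rewrite lee_fin.
by move=> [M /(ge0_series_bounded r0)[l /eseries_lim ->]]; exact: ltry.
Qed.

(** Absolute summability makes the series of the positive and negative parts converge separately,
    each being the integral of a nonnegative function. *)
Lemma Rintegral_atomic (R : realType) (a : nat -> {nonneg R}) (x : nat -> R) (f : R -> R) (M l : R) :
  measurable_fun setT f ->
  (forall n, \sum_(k < n) (a k)%:num * `|f (x k)| <= M) ->
  \sum_(k < n) (a k)%:num * f (x k) @[n --> \oo] --> l ->
  \int[atomic a x]_y f y = l.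
Proof.
move=> mf fM fl.
pose p y := Num.max (f y) 0; pose q y := Num.max (- f y) 0.
have mp : measurable_fun setT p by apply: measurable_maxr => //; exact: measurable_cst.
have mq : measurable_fun setT q.
  by apply: measurable_maxr; [exact: measurableT_comp|exact: measurable_cst].
have p0 y : 0 <= p y by rewrite le_max lexx orbT.
have q0 y : 0 <= q y by rewrite le_max lexx orbT.
have pf y : p y <= `|f y| by rewrite ge_max ler_norm normr_ge0.
have qf y : q y <= `|f y| by rewrite ge_max ler_normr lexx orbT normr_ge0.
have pq y : p y - q y = f y.
  by rewrite /p /q /Num.max; do 2 case: ifPn; rewrite -?leNgt; lra.
have hcv (g : R -> R) : (forall y, 0 <= g y) -> (forall y, g y <= `|f y|) ->
    exists l : R, \sum_(k < n) (a k)%:num * g (x k) @[n --> \oo] --> l.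
  move=> g0 gf; apply: (@ge0_series_bounded _ (fun k => (a k)%:num * g (x k)) M) => [k|n]; first exact: mulr_ge0.
  by apply: le_trans (fM n); apply: ler_sum => k _; exact: ler_wpM2l.
have [lp hp] := hcv p p0 pf; have [lq hq] := hcv q q0 qf.
have ll : l = lp - lq.
  apply: (cvg_unique (@Rhausdorff R) fl).
  suff -> : (fun n => \sum_(k < n) (a k)%:num * f (x k)) =
     (fun n => \sum_(k < n) (a k)%:num * p (x k)) \- (fun n => \sum_(k < n) (a k)%:num * q (x k)).
    exact: cvgB hp hq.
  by apply/funext => n /=; rewrite -sumrB; apply: eq_bigr => k _; rewrite -mulrBr pq.
have ep : (\int[atomic a x]_y (p y)%:E = lp%:E)%E by rewrite ge0_integral_atomic// (eseries_lim hp).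
have eq : (\int[atomic a x]_y (q y)%:E = lq%:E)%E by rewrite ge0_integral_atomic// (eseries_lim hq).
transitivity (fine (\int[atomic a x]_y (p y)%:E - \int[atomic a x]_y (q y)%:E)%E); last first.
  by rewrite ep eq ll.
rewrite /Rintegral integralE; congr fine; congr (_ - _)%E; apply: eq_integral => y _.
  by rewrite funeposE -EFin_max.
by rewrite funenegE -EFinN -EFin_max.
Qed.

Section spectral_projection.
Context {R : realType} {H X : lmodType R}.
Variables (ip : H -> H -> R) (en : X -> X -> R) (J : {linear X -> H}).
Hypotheses (sip : semi_inner ip) (sen : semi_inner en).
Hypotheses (cip : scomplete ip) (cen : scomplete en).
Hypothesis en_ge : forall u, ip (J u) (J u) <= en u u.
Variables (e : nat -> X) (lam : nat -> R).
Hypothesis eb : eigenbasis ip en J e lam.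
Hypothesis dens : forall g, (forall v, ip g (J v) = 0) -> ip g g = 0.
Variable c : R.

Let E k := J (e k).
(** The eigenvalues of the operator itself, [lam] being those of its form shifted by c. *)
Definition shifted (k : nat) : R := lam k - c.
Local Notation mu := shifted.

Let oE : sorthonormal ip E. Proof. by case: eb. Qed.

Lemma proj_ex (B : set R) f : exists g, forall k, ip g (E k) = \1_B (mu k) * ip f (E k).
Proof.
have [|g [_ hg]] := basis_synth sip cip eb (c := fun k => \1_B (mu k) * ip f (E k)) (M := ip f f).
  move=> n; apply: le_trans (bessel sip oE n f); apply: ler_sum => k _.
  rewrite exprMn -mulrA (expr2 (ip f (E k))) -mulrA (coef_norm sip oE) -expr2.
  by rewrite ler_piMl ?sqr_ge0// indicE; case: (_ \in _); rewrite ?expr1n ?expr0n.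
by exists g => k; rewrite hg -mulrA (coef_norm sip oE).
Qed.

Lemma proj_key : {P : set R -> H -> H |
  forall B f k, ip (P B f) (E k) = \1_B (mu k) * ip f (E k)}.
Proof.
by exists (fun B f => projT1 (cid (proj_ex B f))) => B f k; case: cid.
Qed.

Definition proj : set R -> H -> H := sval proj_key.

Lemma projE B f k : ip (proj B f) (E k) = \1_B (mu k) * ip f (E k).
Proof. exact: (svalP proj_key). Qed.

Lemma proj_eq f g : (forall k, ip f (E k) = ip g (E k)) -> ip (f - g) (f - g) = 0.
Proof. exact: (coef_eq sip sen eb dens). Qed.

Lemma proj_sq B f : \sum_(k < n) \1_B (mu k) * ip f (E k) ^+ 2 @[n --> \oo] -->
  ip (proj B f) (proj B f).
Proof.
have := parseval_sq sip sen cip eb dens (f := proj B f).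
rewrite (_ : (fun n => _) = (fun n => \sum_(k < n) \1_B (mu k) * ip f (E k) ^+ 2))//.
apply/funext => n; apply: eq_bigr => k _.
by rewrite projE exprMn indicE; case: (_ \in _); rewrite ?expr1n ?expr0n.
Qed.

Lemma proj_sa B f g : ip (proj B f) g = ip f (proj B g).
Proof.
have h1 := parseval sip sen cip eb dens (f := proj B f) (g := g).
have h2 := parseval sip sen cip eb dens (f := f) (g := proj B g).
apply: (cvg_unique (@Rhausdorff R) h1).
suff <- : (fun n => \sum_(k < n) ip f (E k) * ip (proj B g) (E k)) =
          (fun n => \sum_(k < n) ip (proj B f) (E k) * ip g (E k)) by exact: h2.
by apply/funext => n; apply: eq_bigr => k _; rewrite !projE; ring.
Qed.

(** Undoes the shift: [en] is the form of the operator plus c. *)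
Definition sgraph (u g : H) : Prop :=
  exists2 x, J x = u & forall v, en x v = ip (g + c *: u) (J v).

Lemma sgraph_coef u g k : sgraph u g -> ip g (E k) = mu k * ip u (E k).
Proof.
move=> [x <- /(form_coef sip sen eb)/(_ k)].
by rewrite (siDl sip) (siZl sip) /mu -/(E k); lra.
Qed.

(** As lam = mu + c, square summability weighted by mu passes to lam, Bessel's inequality handling
    the term in c; then [form_regular] applies. *)
Lemma sgraph_domain f (M : R) : (forall n, \sum_(k < n) (mu k * ip f (E k)) ^+ 2 <= M) ->
  exists x g, ip (J x - f) (J x - f) = 0 /\ forall v, en x v = ip (g + c *: J x) (J v).
Proof.
move=> hM.
have [|x [g [xf xg]]] := form_regular sip sen cip cen eb dens (f := f)
    (M := 2 * M + 2 * c ^+ 2 * ip f f).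
  move=> n; apply: le_trans (_ : 2 * (\sum_(k < n) (mu k * ip f (E k)) ^+ 2) +
     2 * c ^+ 2 * (\sum_(k < n) ip f (E k) ^+ 2) <= _); last first.
    apply: lerD; first by rewrite ler_pM2l.
    by apply: ler_wpM2l; [rewrite mulr_ge0// sqr_ge0|exact: (bessel sip oE)].
  rewrite !mulr_sumr -big_split/=; apply: ler_sum => k _.
  rewrite -/(E k) /mu; move: (ip _ _) => t.
  by have := sqr_ge0 ((lam k - c) * t - c * t); lra.
exists x, (g - c *: J x); split=> // v.
by rewrite subrK.
Qed.

Lemma sgraph_eigen (m : R) u k : sgraph u (m *: u) -> mu k != m -> ip u (E k) = 0.
Proof.
move=> /(@sgraph_coef _ _ k); rewrite (siZl sip) => h km.
have /eqP : (m - mu k) * ip u (E k) = 0 by rewrite mulrBl h subrr.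
by rewrite mulf_eq0 subr_eq0 eq_sym (negbTE km)/= => /eqP.
Qed.

Lemma sgraph_basis k : sgraph (E k) (mu k *: E k).
Proof.
exists (e k) => // v; have [_ -> _ _ _] := eb.
by rewrite -scalerDl /mu subrK (siZl sip).
Qed.

Lemma shifted_oo (b : R) : exists K, forall k, (K <= k)%N -> b < mu k.
Proof.
have [_ _ _ h _] := eb; have [K hK] := h (b + c).
by exists K => k /hK; rewrite /mu; lra.
Qed.

End spectral_projection.

Lemma cvg_ext (R : realType) (u v : nat -> R) (l : R) : (forall k, u k = v k) ->
  u k @[k --> \oo] --> l -> v k @[k --> \oo] --> l.
Proof. by move=> uv; rewrite (_ : v = u) //; apply/funext => k. Qed.

Section schrodinger_spectrum.
Context {R : realType} {n : nat} {L : R}.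
Local Notation E := 'rV[R]_n.
Local Notation C := R[i].
Local Notation mu := (lebesgue_rV (R := R) n : {measure set E -> \bar R}).
Local Notation D := (@box R n L).
Local Notation H := (@boxL2 R n L).
Local Notation X := (@form R n L).
Let mD : measurable D := @measurable_box R n L.
Local Notation ip := (@ipL2 _ _ _ mu D mD : H -> H -> R).
Let sip : semi_inner ip := @ip_semi R n L.
Let cip : scomplete ip := @ip_complete R n L.
Hypothesis L0 : 0 < L.
Let L0' : 0 <= L := ltW L0.
Variables (V : E -> R) (mV : measurable_fun setT V) (B : R) (bV : forall x, `|V x| <= B).
Variables (nu : R) (nu0 : 0 <= nu) (nuV : {ae mu, forall x, `|V x| <= nu}).

Lemma form_ae (p : H * ('I_n -> H)) (f : H) : p \in formdom (R := R) (n := n) (L := L) ->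
  ip (p.1 - f) (p.1 - f) = 0 -> (f, p.2) \in formdom (R := R) (n := n) (L := L).
Proof.
move=> /asboolP[t ht] pf; apply/asboolP; exists t => -[i|]; first exact: (ht (Some i)).
have h := ht None.
have h2 : 2 * ip (tH (t k) - p.1) (tH (t k) - p.1) + 2 * ip (p.1 - f) (p.1 - f)
    @[k --> \oo] --> 2 * 0 + 2 * (0 : R).
  by rewrite pf; apply: cvgD; [apply: cvgM; [exact: cvg_cst|exact: h]|rewrite !mulr0; exact: cvg_cst].
rewrite !mulr0 addr0 in h2.
apply: (squeeze_cvgr _ (cvg_cst 0) h2); apply: nearW => k.
by rewrite (si_ge0 sip)/=; exact: (siB_tri sip).
Qed.

Lemma wmul_ae f g : ip (f - g) (f - g) = 0 ->
  ip (wmul mV bV f - wmul mV bV g) (wmul mV bV f - wmul mV bV g) = 0.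
Proof.
move=> /ipL2_ae h; apply/ipL2_ae; apply: filterS h => x h Dx.
by rewrite -[LHS]/(V x * f x) -[RHS]/(V x * g x) h.
Qed.

Lemma ip_null_eq (f g h : H) : ip (f - g) (f - g) = 0 -> ip f h = ip g h.
Proof. by move=> fg; have /eqP := si_null sip h fg; rewrite (siBl sip) subr_eq0 => /eqP. Qed.

(** Coefficients determine a function only up to a null one, whereas the domain of the operator is
    stated for a given function; this lemma passes between the two. *)
Lemma opgraph_ae u u' g g' : opgraph mV bV u g -> ip (u - u') (u - u') = 0 ->
  ip (g - g') (g - g') = 0 -> opgraph mV bV u' g'.
Proof.
move=> [x <- xg] uu' gg'.
exists (MkForm (form_ae (fpairP x) uu')) => // v.
rewrite -(ip_null_eq _ gg') -xg /en; congr (_ + _).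
by apply/esym/ip_null_eq/wmul_ae.
Qed.

(* After the shift by nu + 1 the form dominates the L^2 norm. *)
Definition shiftV : R := nu + 1.
Definition Vw : E -> R := fun x => V x + shiftV.

Lemma mVw : measurable_fun setT Vw.
Proof. by apply: measurable_funD => //; exact: measurable_cst. Qed.

Lemma bVw x : `|Vw x| <= B + shiftV.
Proof.
rewrite /Vw (le_trans (ler_normD _ _))// lerD ?bV// ger0_norm//.
by apply: addr_ge0.
Qed.

Lemma Vw1 : {ae mu, forall x, D x -> 1 <= Vw x}.
Proof.
apply: filterS nuV => x; rewrite ler_norml /Vw /shiftV => /andP[h _] _.
lra.
Qed.

Local Notation fJl := (@fJ R n L : {linear X -> H}).
Local Notation ew := (en (L := L) mVw bVw).
Let sew : semi_inner ew. Proof. exact: en_semi Vw1. Qed.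
Let cew : scomplete ew. Proof. exact: en_complete Vw1. Qed.
Let dens (g : H) : (forall v : X, ip g (fJ v) = 0) -> ip g g = 0.
Proof. exact: fJ_dense. Qed.

Lemma box_spectral : exists e lam, eigenbasis ip ew fJl e lam.
Proof.
apply: form_spectral => // [u|eps eps0]; first exact: en_ge Vw1 _.
by apply: (en_compact _ _ Vw1 L0 eps0).
Qed.

Lemma ew_shift x v : ew x v = en mV bV x v + shiftV * ip (fJ x) (fJ v).
Proof.
rewrite /en -addrA; congr (_ + _); rewrite -(siZl sip) -(siDl sip).
by congr (ip _ _); apply/val_inj/funext => y; rewrite /= mulrDl.
Qed.

Lemma opgraph_sgraph u g : opgraph mV bV u g <-> sgraph ip ew fJl shiftV u g.
Proof.
split=> -[x <- xg]; exists x => // v.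
  by rewrite ew_shift xg (siDl sip) (siZl sip).
by have := xg v; rewrite ew_shift (siDl sip) (siZl sip) => /addIr.
Qed.

Variables (e : nat -> X) (lam : nat -> R).
Hypothesis eb : eigenbasis ip ew fJl e lam.
Local Notation m := (shifted lam shiftV).
Local Notation PB := (proj sip cip eb shiftV).

(* [specm] is the spectral resolution of - Delta + V; its scalar spectral measures
   are the [specw], atomic with masses |(f, e_k)|^2 at the points [m k]. *)
Definition specm (A : set R) (f : E -> C) : E -> C := ofH (fun b => PB A (pt b f)).

Definition basisE k : H := fJ (e k).

Lemma pt_specm A b f : pt b (specm A f) = PB A (pt b f).
Proof. exact: pt_ofH. Qed.

Lemma specmE A b f k : ip (pt b (specm A f)) (basisE k) = \1_A (m k) * ip (pt b f) (basisE k).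
Proof. rewrite pt_specm; exact: projE. Qed.

Lemma L2_specm A f : L2 D (specm A f).
Proof. exact: L2_ofH. Qed.

Lemma eq_L2_coef f g : L2 D f -> L2 D g ->
  (forall b k, ip (pt b f) (basisE k) = ip (pt b g) (basisE k)) -> eq_L2 D f g.
Proof.
move=> hf hg h; apply/eq_L2P => // b.
apply: (@proj_eq _ _ _ _ _ _ sip sew _ _ eb dens) => k; exact: h.
Qed.

Lemma specm_sq A b f : \sum_(k < n0) \1_A (m k) * ip (pt b f) (basisE k) ^+ 2 @[n0 --> \oo] -->
  ip (pt b (specm A f)) (pt b (specm A f)).
Proof. by rewrite pt_specm; exact: (@proj_sq _ _ _ _ _ _ sip sew cip _ _ eb dens). Qed.

Lemma pt_linC b (a : C) f g : L2 D f -> L2 D g -> pt b (fun x => a * f x + g x) =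
  complex.Re a *: pt b f + (if b then complex.Im a else - complex.Im a) *: pt (~~ b) f + pt b g :> H.
Proof.
move=> hf hg; apply: pt_eq => x.
have -> (p q : R) (f1 f2 f3 : H) : (p *: f1 + q *: f2 + f3) x = p * f1 x + q * f2 x + f3 x by [].
rewrite !ptE//; case: b; case: a (f x) (g x) => [a1 a2] [b1 b2] [c1 c2] /=; ring.
Qed.

Lemma L2_linC (a : C) f g : L2 D f -> L2 D g -> L2 D (fun x => a * f x + g x).
Proof.
move=> hf hg; rewrite -(ofHK hf) -(ofHK hg).
suff -> : (fun x => a * @ofH R n L (pt ^~ f) x + @ofH R n L (pt ^~ g) x) =
  @ofH R n L (fun b => (complex.Re a *: pt b f +
    (if b then complex.Im a else - complex.Im a) *: pt (~~ b) f + pt b g)).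
  exact: L2_ofH.
apply/funext => x; apply: cpart_eq => b; rewrite cpart_mkC.
have -> (p q : R) (f1 f2 f3 : H) : (p *: f1 + q *: f2 + f3) x = p * f1 x + q * f2 x + f3 x by [].
rewrite /ofH /mkC; case: b; case: a => [a1 a2] /=; ring.
Qed.

Lemma specm_projection A : orthogonal_projection D (specm A).
Proof.
split=> [f _|a f g hf hg|f g hf hg|f hf]; first exact: L2_specm.
- apply: eq_L2_coef => [||b k]; [exact: L2_specm|by apply: L2_linC; exact: L2_specm|].
  rewrite specmE (pt_linC _ _ hf hg) (pt_linC _ _ (L2_specm A f) (L2_specm A g)).
  rewrite !(siDl sip) !(siZl sip) !specmE; ring.
- rewrite (innerE (L2_specm A f) hg) (innerE hf (L2_specm A g)) !pt_specm.
  have h b b' : ip (PB A (pt b f)) (pt b' g) = ip (pt b f) (PB A (pt b' g)).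
    exact: (proj_sa sip sew cip eb dens).
  by congr Complex; [congr (_ + _)|congr (_ - _)]; exact: h.
- apply: eq_L2_coef => [||b k]; try exact: L2_specm.
  by rewrite !specmE mulrA indicE; case: (_ \in _); rewrite ?mul1r ?mul0r.
Qed.

Lemma ip_sqr_sum (h : H) : \sum_(k < n0) ip h (basisE k) ^+ 2 @[n0 --> \oo] --> ip h h.
Proof. exact: (@parseval_sq _ _ _ _ _ _ sip sew cip _ _ eb dens). Qed.

Lemma specw_ge0 (f : E -> C) k :
  0 <= ip (pt false f) (basisE k) ^+ 2 + ip (pt true f) (basisE k) ^+ 2.
Proof. by rewrite addr_ge0 ?sqr_ge0. Qed.

Definition specw (f : E -> C) k : {nonneg R} := NngNum (specw_ge0 f k).

Lemma specm_measure (f : E -> C) A : measurable A ->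
  atomic (specw f) m A = sqnorm D (specm A f).
Proof.
move=> mA; rewrite (sqnormE (L2_specm A f)) atomicE//; apply: eseries_lim.
apply: (cvg_ext _ (cvgD (@specm_sq A false f) (@specm_sq A true f))) => N0 /=.
by rewrite -[LHS]/(_ + _) -big_split/=; apply: eq_bigr => k _; rewrite mulrDl !(mulrC (\1_A _)).
Qed.

(** If g is the image of f, its coefficients are [m k] times those of f, and Bessel bounds the sum.
    Conversely [sgraph_domain] finds a domain element equal to f almost everywhere, and [opgraph_ae]
    transports the graph to f. *)
Lemma specm_domain (f : E -> C) : L2 D f ->
  (exists g, schrodinger D V f g) <->
  (\int[atomic (specw f) m]_x ((x : R) ^+ 2)%:E < +oo)%E.
Proof.
move=> hf; rewrite (ge0_integral_atomic _ _ (f := fun x => x ^+ 2)); last 2 first.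
- exact: measurable_funX.
- by move=> y; exact: sqr_ge0.
have -> : (exists g, schrodinger D V f g) <->
    forall b, exists g, sgraph ip ew fJl shiftV (pt b f) g.
  split=> [[g /(schrodingerP mV bV _ _ L0')[_ hg h]] b|h].
    by exists (pt b g); apply/opgraph_sgraph.
  have [g hg] := choice h; exists (ofH g); apply/(schrodingerP mV bV _ _ L0').
  split=> //; first exact: L2_ofH.
  by move=> b; rewrite pt_ofH; apply/opgraph_sgraph.
rewrite eseries_ltyP; last by move=> k; rewrite mulr_ge0// sqr_ge0.
have sE b k : (m k * ip (pt b f) (basisE k)) ^+ 2 <=
    (ip (pt false f) (basisE k) ^+ 2 + ip (pt true f) (basisE k) ^+ 2) * m k ^+ 2.
  rewrite exprMn mulrC ler_wpM2r ?sqr_ge0//.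
  by case: b; rewrite ?lerDl ?lerDr sqr_ge0.
split=> [h|[M hM] b].
  have hb b : exists M, forall N0, \sum_(k < N0) (m k * ip (pt b f) (basisE k)) ^+ 2 <= M.
    have [g hg] := h b; exists (ip g g) => N0.
    have oE : sorthonormal ip basisE by case: eb.
    apply: le_trans (bessel sip oE N0 g); apply: ler_sum => k _.
    by rewrite -(sgraph_coef sip sew eb k hg).
  have [M0 h0] := hb false; have [M1 h1] := hb true.
  exists (M0 + M1) => N0; apply: le_trans (lerD (h0 N0) (h1 N0)).
  by rewrite -big_split; apply: ler_sum => k _ /=; rewrite mulrDl !exprMn !(mulrC (m k ^+ 2)).
have [|x [g [xf xg]]] := @sgraph_domain _ _ _ _ _ _ sip sew cip cew _ _ eb dens shiftV (pt b f) M.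
  by move=> N0; apply: le_trans (hM N0); apply: ler_sum => k _; exact: sE.
exists g; apply/opgraph_sgraph.
have o : opgraph mV bV (fJ x) g by apply/opgraph_sgraph; exists x.
by apply: (opgraph_ae o xf); rewrite subrr (si0l sip).
Qed.

Lemma specm_form (f g : E -> C) : schrodinger D V f g ->
  inner D g f = (\int[atomic (specw f) m]_x (x : R))%:C%C.
Proof.
move=> sg; have fdom : exists g, schrodinger D V f g by exists g.
have [hf hg gr] := (schrodingerP mV bV f g L0').1 sg.
have co b k : ip (pt b g) (basisE k) = m k * ip (pt b f) (basisE k).
  by apply: (sgraph_coef sip sew eb); apply/opgraph_sgraph; exact: gr.
have pv b b' : \sum_(k < N0) m k * (ip (pt b f) (basisE k) * ip (pt b' f) (basisE k))
    @[N0 --> \oo] --> ip (pt b g) (pt b' f).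
  have := @parseval _ _ _ _ _ _ sip sew cip _ _ eb dens (pt b g) (pt b' f).
  apply: cvg_trans; apply: near_eq_cvg; apply: nearW => N0 /=.
  by apply: eq_bigr => k _; rewrite co mulrA.
rewrite (innerE hg hf).
(* Symmetry of the real operator, read on coefficients, kills the imaginary part. *)
have -> : ip (pt true g) (pt false f) = ip (pt false g) (pt true f).
  apply: (cvg_unique (@Rhausdorff R) (pv true false)).
  suff -> : (fun N0 => \sum_(k < N0) m k * (ip (pt true f) (basisE k) * ip (pt false f) (basisE k)))
    = (fun N0 => \sum_(k < N0) m k * (ip (pt false f) (basisE k) * ip (pt true f) (basisE k))).
    exact: pv.
  by apply/funext => N0; apply: eq_bigr => k _; congr (_ * _); rewrite mulrC.
rewrite subrr; congr Complex; apply/esym.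
have /(specm_domain hf) := fdom.
rewrite (ge0_integral_atomic _ _ (f := fun x => x ^+ 2)); last 2 first.
- exact: measurable_funX.
- by move=> y; exact: sqr_ge0.
rewrite eseries_ltyP; last by move=> k; rewrite mulr_ge0// sqr_ge0.
move=> [M hM].
apply: (@Rintegral_atomic _ _ _ _ (M + nsq f)) => //.
  (* Absolute summability of the first moment follows from |m| <= m^2 + 1, a finite second moment
     and Bessel's inequality. *)
  move=> N0; apply: le_trans (_ : \sum_(k < N0) (specw f k)%:num * m k ^+ 2 +
      (\sum_(k < N0) ip (pt false f) (basisE k) ^+ 2 +
       \sum_(k < N0) ip (pt true f) (basisE k) ^+ 2) <= _); last first.
    have oE : sorthonormal ip basisE by case: eb.
    by apply: lerD => //; apply: lerD; exact: (bessel sip oE).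
  rewrite -!big_split; apply: ler_sum => k _ /=.
  move: (addr_ge0 (sqr_ge0 (ip (pt false f) (basisE k))) (sqr_ge0 (ip (pt true f) (basisE k)))).
  move: (_ + _) => a a0; rewrite -[X in _ <= _ + X]mulr1 -mulrDr; apply: ler_wpM2l => //.
  have := sqr_ge0 (`|m k| - 2^-1); rewrite -(real_normK (num_real (m k))); lra.
apply: (cvg_ext _ (cvgD (pv false false) (pv true true))) => N0 /=.
by rewrite -[LHS]/(_ + _) -big_split/=; apply: eq_bigr => k _; rewrite -mulrDr mulrC -!expr2.
Qed.

Lemma spectral_specm : spectral_measure D (schrodinger D V) specm.
Proof.
split=> [A mA|f hf|A A' f mA mA' hf|f hf].
- exact: specm_projection.
- apply: eq_L2_coef => [||b k]; [exact: L2_specm|by []|].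
  by rewrite specmE indicE in_setT mul1r.
- apply: eq_L2_coef => [||b k]; try exact: L2_specm.
  by rewrite !specmE indicI/= mulrA.
- exists (atomic (specw f) m); split=> [A mA||g sg].
  + exact: specm_measure.
  + exact: specm_domain.
  + exact: specm_form.
Qed.

(** [specm] supplies the spectral measure demanded by [spectral_subspace]; on coefficients its
    projection up to [b0] is the identity here. *)
Lemma low_spectral_subspace (b0 : R) (h : bool -> H) :
  (forall b k, b0 < m k -> ip (h b) (basisE k) = 0) ->
  spectral_subspace D (schrodinger D V) b0 (ofH h).
Proof.
move=> hb; split; first exact: L2_ofH.
exists specm; first exact: spectral_specm.
apply: eq_L2_coef => [||b k]; [exact: L2_specm|exact: L2_ofH|].
rewrite specmE pt_ofH indicE mem_setE in_itv/=.
by case: ltP => [/hb ->|_]; rewrite ?mulr0 ?mul1r.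
Qed.

End schrodinger_spectrum.

(** * Rescaling and unique continuation *)

Section scaling_measure.
Context {R : realType}.
Local Notation leb := (@lebesgue_measure R).
Local Notation mu n := (lebesgue_rV (R := R) n).
Local Open Scope ereal_scope.

Lemma ge0_int_cons n (F : 'rV[R]_n.+1 -> \bar R) : measurable_fun setT F -> (forall x, 0 <= F x) ->
  \int[mu n.+1]_x F x = \int[leb]_t \int[mu n]_x F (rV_cons (t, x)).
Proof.
move=> mF F0; rewrite [LHS]/=.
pose M : {measure set _ -> \bar R} := (leb \x mu n)%E.
have := @ge0_integral_pushforward _ _ (measurableTypeR R * 'rV[R]_n)%type 'rV[R]_n.+1 R
  (@rV_cons R n) (@measurable_rV_cons R n) M setT F measurableT mF.
rewrite preimage_setT => /(_ _)/= h; apply: etrans (h _) _; first by move=> x _; exact: F0.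
have mc : measurable_fun setT (F \o @rV_cons R n).
  by apply: measurableT_comp => //; exact: measurable_rV_cons.
have := @fubini_tonelli1 _ _ _ _ _ leb (mu n) (F \o @rV_cons R n) mc.
by apply=> x; exact: F0.
Qed.

Lemma ge0_int_slice n (F : 'rV[R]_n.+1 -> \bar R) : measurable_fun setT F -> (forall x, 0 <= F x) ->
  measurable_fun setT (fun t : measurableTypeR R => \int[mu n]_x F (rV_cons (t, x))).
Proof.
move=> mF F0.
apply: (@measurable_fun_fubini_tonelli_F _ _ _ _ _ _ (F \o @rV_cons R n)).
  by apply: measurableT_comp => //; exact: measurable_rV_cons.
by move=> x; exact: F0.
Qed.

(** Lebesgue measure agrees with s times its image under multiplication by s on intervals, hence
    everywhere by uniqueness. *)
Lemma leb_scale (s : R) (F : R -> \bar R) : (0 < s)%R -> measurable_fun setT F ->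
  (forall x, 0 <= F x) -> \int[leb]_t F (s * t)%R = (s^-1)%:E * \int[leb]_t F t.
Proof.
move=> s0 mF F0.
have ms : measurable_fun [set: measurableTypeR R] (fun t : measurableTypeR R => (s * t)%R : measurableTypeR R).
  exact: measurable_funM.
pose P : {measure set (measurableTypeR R) -> \bar R} :=
  measure_function_pushforward__canonical__measure_function_Measure leb ms.
pose sn : {nonneg R} := NngNum (ltW s0).
have lP A : measurable A -> leb A = mscale sn P A.
  apply: lebesgue_measure_unique => _ [[a b] _ <-] /=.
  rewrite /mscale /P /= /pushforward.
  rewrite (_ : _ @^-1` _ = [set` `](a / s)%R, (b / s)%R]]); last first.
    apply/seteqP; split => x /=; rewrite !in_itv/= ltr_pdivrMr// ler_pdivlMr//;
      by rewrite !(mulrC s).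
  rewrite !lebesgue_measure_itv/= !lte_fin ltr_pM2r ?invr_gt0//.
  case: ifPn => _; last by rewrite mule0.
  by rewrite -!EFinB -EFinM -mulrBl mulrC mulfVK// gt_eqF.
rewrite [in RHS](eq_measure_integral (mscale sn P)); last by move=> A mA _; exact: lP.
rewrite ge0_integral_mscale//=.
have := @ge0_integral_pushforward _ _ _ _ R _ ms leb setT F measurableT mF.
rewrite preimage_setT => -> //.
by rewrite muleA -EFinM mulVf ?gt_eqF// mul1e.
Qed.

Lemma rV_scale_cons n (s : R) t (x : 'rV[R]_n) :
  (s *: rV_cons (t, x) = rV_cons (s * t, s *: x))%R.
Proof.
by apply/rowP => i; rewrite !mxE; case: (unliftP ord0 i) => [j _|_]; rewrite /= ?mxE.
Qed.

Lemma measurable_scale n (s : R) : measurable_fun setT (fun x : 'rV[R]_n => s *: x)%R.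
Proof.
apply: measurable_fun_rVP => i; under eq_fun do rewrite mxE.
by apply: measurable_funM; [exact: measurable_cst|exact: measurable_coord].
Qed.

Lemma rV_scale n (s : R) (F : 'rV[R]_n -> \bar R) : (0 < s)%R -> measurable_fun setT F ->
  (forall x, 0 <= F x) -> \int[mu n]_x F (s *: x)%R = ((s^-1) ^+ n)%:E * \int[mu n]_x F x.
Proof.
move=> s0; elim: n F => [|n IH] F mF F0.
  rewrite expr0 mul1e; apply: eq_integral => x _; congr F.
  by rewrite (thinmx0 x) (thinmx0 (_ *: _)%R).
have mFs : measurable_fun setT (fun x : 'rV[R]_n.+1 => F (s *: x)%R).
  by apply: measurableT_comp => //; exact: measurable_scale.
rewrite ge0_int_cons// ge0_int_cons//.
pose g t := \int[mu n]_x F (rV_cons (t, x)).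
have mg : measurable_fun [set: measurableTypeR R] g by exact: ge0_int_slice.
have g0 t : 0 <= g t by apply: integral_ge0 => x _.
under eq_integral => t _.
  under eq_integral => x _ do rewrite rV_scale_cons.
  rewrite (IH (fun x => F (rV_cons (s * t, x))%R)); last 2 first.
  - apply: (measurableT_comp mF); apply: (measurableT_comp (@measurable_rV_cons R n)).
    by apply: measurable_fun_pair => //; exact: measurable_cst.
  - by move=> x; exact: F0.
  over.
rewrite -/(g _) ge0_integralZl; last 4 first.
- exact: measurableT.
- by apply: (measurableT_comp mg); exact: measurable_funM.
- by move=> t _; exact: g0.
- by rewrite lee_fin exprn_ge0// invr_ge0 ltW.
by rewrite (leb_scale s0 mg g0) muleA -EFinM -exprSr.
Qed.

Lemma rV_scale_set n (s : R) (A : set 'rV[R]_n) (F : 'rV[R]_n -> \bar R) : (0 < s)%R ->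
  measurable A -> measurable_fun A F -> (forall x, 0 <= F x) ->
  \int[mu n]_(x in [set x | A (s *: x)%R]) F (s *: x)%R =
  ((s^-1) ^+ n)%:E * \int[mu n]_(x in A) F x.
Proof.
move=> s0 mA mF F0; rewrite integral_mkcond [in RHS]integral_mkcond.
rewrite -(rV_scale s0); last 2 first.
- by apply/(measurable_restrictT _ mA).
- by move=> x; rewrite patchE; case: ifP.
by apply: eq_integral => x _; rewrite !patchE; congr (if _ then _ else _); rewrite !inE.
Qed.

Lemma rV_scale_null n (s : R) (A : set 'rV[R]_n) : (0 < s)%R ->
  (mu n).-negligible A -> (mu n).-negligible [set x | A (s *: x)%R].
Proof.
move=> s0 [B [mB B0 AB]]; exists [set x | B (s *: x)%R]; split.
- by rewrite -[X in measurable X]setTI; exact: measurable_scale.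
- have := rV_scale_set s0 mB (F := fun=> 1) (measurable_cst _) (fun=> lee01).
  rewrite !integral_cst//; last by rewrite -[X in measurable X]setTI; exact: measurable_scale.
  rewrite !mul1e => h; apply: (etrans h).
  exact: etrans (congr1 (fun x => _ * x)%E B0) (mule0 _).
- by move=> x /AB.
Qed.

End scaling_measure.

Section scaling_smooth.
Context {R : realType} {n : nat}.
Local Notation E := 'rV[R]_n.
Variables (s : R) (s0 : 0 < s).

Lemma is_derive_scale (f : E -> R) (x v : E) (df : R) :
  is_derive (s *: x) v f df -> is_derive x v (fun y => f (s *: y)) (s * df).
Proof.
move=> fx; rewrite -[x]add0r -(scale0r v); apply/is_derive_line.
have -> : (fun r : R => f (s *: (r *: v + x))) = (fun r : R => f (r *: v + s *: x)) \o ( *%R s).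
  by apply/funext => r /=; rewrite scalerDr scalerA.
have h1 : is_derive (s * 0) (1 : R) (fun r : R => f (r *: v + s *: x)) df.
  have := (is_derive_line f (s *: x) v (s * 0) df).1.
  by rewrite mulr0 scale0r add0r => h; exact: (h fx).
have h2 : is_derive (0 : R) (1 : R) ( *%R s : R -> R) s.
  have := is_deriveZ s (is_derive_id (0 : R) (1 : R)).
  by rewrite -[X in is_derive _ _ _ X]/(s * 1) mulr1.
by have := is_derive1_comp h1 h2; rewrite mulrC.
Qed.

Lemma smooth_scale (f : E -> R) : smooth f -> smooth (fun x => f (s *: x)) /\
  forall i, partial i (fun x => f (s *: x)) = (fun x => s * partial i f (s *: x)).
Proof.
have cs : continuous (fun x : E => s *: x) by exact: scaler_continuous.
have pE (g : E -> R) (i : 'I_n) : smooth g -> forall x, is_derive x (delta_mx ord0 i) (fun x => g (s *: x)) (s * partial i g (s *: x)).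
  by move=> sg x; apply: is_derive_scale; apply/derivableP; exact: smooth_derivable.
have pE' (g : E -> R) (i : 'I_n) : smooth g -> partial i (fun x => g (s *: x)) = (fun x => s * partial i g (s *: x)).
  by move=> sg; apply/funext => x; have [_ <-] := pE g i sg x.
move=> sf; split; last by move=> i; exact: pE'.
apply/smoothP => k; elim: k f sf => [|k IH] f sf.
  by split=> // x; apply: continuous_comp; [exact: cs|exact: smooth_cont].
split; first by move=> x; apply: continuous_comp; [exact: cs|exact: smooth_cont].
move=> i; split; first by move=> x; have [] := pE f i sf x.
rewrite pE'//.
rewrite (_ : (fun x => _) = (fun x => s * partial i f (s *: x) + 0)); last first.
  by apply/funext => x; rewrite addr0.
have /smoothP h0 := @smooth_cst R n 0.
apply: (Ck_lin s (f := fun x => partial i f (s *: x))); last exact: h0.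
by apply: IH; exact: smooth_partial.
Qed.

Lemma box_scale (L : R) (x : E) : box (s * L) (s *: x) <-> box L x.
Proof.
by split=> h i; have := h i; rewrite mxE -mulrN !ltr_pM2l.
Qed.

Lemma rtest_scale (L : R) (f : E -> R) : rtest (box (s * L)) f -> rtest (box L) (fun x => f (s *: x)).
Proof.
move=> [sf [K [cK KL f0]]]; split; first by have [] := smooth_scale sf.
exists ((fun x => s^-1 *: x) @` K); split.
- apply: continuous_compact => //; apply: continuous_subspaceT.
  exact: scaler_continuous.
- by move=> _ [y /KL yL <-]; apply/box_scale; rewrite scalerA mulfV ?gt_eqF// scale1r.
- move=> x nK; apply: f0 => Kx; apply: nK; exists (s *: x) => //.
  by rewrite scalerA mulVf ?gt_eqF// scale1r.
Qed.

End scaling_smooth.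

Section form_scale.
Context {R : realType} {n : nat}.
Local Notation E := 'rV[R]_n.
Local Notation mu := (lebesgue_rV (R := R) n : {measure set E -> \bar R}).
Variables (s : R) (s0 : 0 < s) (L L1 : R) (hL : L = s * L1).
Local Notation H := (@boxL2 R n L).
Local Notation H1 := (@boxL2 R n L1).
Local Notation mD := (@measurable_box R n L).
Local Notation mD1 := (@measurable_box R n L1).
Local Notation ip := (@ipL2 _ _ _ mu (box L) mD : H -> H -> R).
Local Notation ip1 := (@ipL2 _ _ _ mu (box L1) mD1 : H1 -> H1 -> R).
Let sip : semi_inner ip := @ip_semi R n L.
Let sip1 : semi_inner ip1 := @ip_semi R n L1.

Lemma box_scaleE : box L1 = [set x : E | box L (s *: x)].
Proof. by apply/seteqP; split=> x; rewrite hL => /(box_scale s0). Qed.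

Lemma scH_sq (f : H) :
  (\int[mu]_(x in box L1) (f (s *: x) ^+ 2)%:E = (s^-1 ^+ n)%:E * (ip f f)%:E)%E.
Proof.
rewrite ipL2E box_scaleE -(rV_scale_set s0 mD (F := fun x => (f x ^+ 2)%:E)) //.
  by apply/measurable_EFinP; apply: measurable_funX; exact: L2meas.
by move=> x; rewrite lee_fin sqr_ge0.
Qed.

Lemma scH_sqint (f : H) : (fun x => f (s *: x)) \in sqint mu (box L1).
Proof.
apply/sqintP; split; last by rewrite scH_sq -EFinM ltry.
have ms : measurable_fun (box L1) (fun x : E => s *: x : E).
  by apply: measurable_funTS; exact: measurable_scale.
have sub : (fun x : E => s *: x) @` box L1 `<=` box L.
  by rewrite box_scaleE => _ [x Lx <-].
exact: (measurable_comp mD sub (L2meas f) ms).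
Qed.

Definition scH (f : H) : H1 := MkL2sp mD1 (scH_sqint f).

Lemma scHZ a f : scH (a *: f) = a *: scH f.
Proof. by apply/val_inj. Qed.

Lemma scHD f g : scH (f + g) = scH f + scH g.
Proof. by apply/val_inj. Qed.

Lemma scHB f g : scH (f - g) = scH f - scH g.
Proof. by apply/val_inj. Qed.

Lemma ip_scH2 (f : H) : ip1 (scH f) (scH f) = s^-1 ^+ n * ip f f.
Proof.
suff [] : (ip1 (scH f) (scH f))%:E = (s^-1 ^+ n * ip f f)%:E by [].
by rewrite ipL2E EFinM -scH_sq.
Qed.

(** Polarization of [ip_scH2]. *)
Lemma ip_scH (f g : H) : ip1 (scH f) (scH g) = s^-1 ^+ n * ip f g.
Proof.
have h1 := ip_scH2 f; have h2 := ip_scH2 g; have := ip_scH2 (f + g).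
rewrite scHD !(siDl sip1) !(siDr sip1) !(siDl sip) !(siDr sip) h1 h2.
by rewrite (siC sip1 (scH g)) (siC sip g); lra.
Qed.

Lemma scvg_scH (u : nat -> H) l : scvg ip u l -> scvg ip1 (scH \o u) (scH l).
Proof.
move=> h; have e : s^-1 ^+ n * 0 = 0 :> R by rewrite mulr0.
rewrite /scvg -e; apply: (cvg_ext _ (cvgM (cvg_cst (s^-1 ^+ n)) h)) => k.
by rewrite -[(_ \o _) k]/(scH (u k)) -scHB ip_scH2.
Qed.

Lemma scT_rtest (t : tst (n := n) L) : rtest (box L1) (fun x => t (s *: x)).
Proof. by apply: (rtest_scale s0); rewrite -hL; exact: tfunP. Qed.

Definition scT (t : tst (n := n) L) : tst (n := n) L1 := MkTst (scT_rtest t).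

Lemma scT_H t : tH (scT t) = scH (tH t).
Proof. by apply/val_inj. Qed.

Lemma scT_part t i : tH (tpart i (scT t)) = s *: scH (tH (tpart i t)).
Proof.
by apply/val_inj; have [_] := smooth_scale s (proj1 (tfunP t)); apply.
Qed.

Lemma scX_proof (x : form (n := n) L) :
  (scH (fJ x), fun i => s *: scH (fG x i)) \in formdom (R := R) (n := n) (L := L1).
Proof.
have [t [tJ tG]] := form_approx x.
apply/asboolP; exists (fun k => scT (t k)) => -[i|]; last first.
  under eq_fun do rewrite /= scT_H; exact: (scvg_scH tJ).
have h := scvg_scH (tG i).
have e : s ^+ 2 * 0 = 0 :> R by rewrite mulr0.
rewrite /scvg -e; apply: (cvg_ext _ (cvgM (cvg_cst (s ^+ 2)) h)) => k; rewrite /= scT_part -scalerBr (siZl sip1) (siZr sip1).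
by rewrite mulrA expr2.
Qed.

Definition scX (x : form (n := n) L) : form (n := n) L1 := MkForm (scX_proof x).

End form_scale.

Lemma invr_pos (R : realType) (s : R) : 0 < s -> 0 < s^-1.
Proof. by rewrite invr_gt0. Qed.

Section opgraph_scale.
Context {R : realType} {n : nat}.
Local Notation E := 'rV[R]_n.
Variables (s : R) (s0 : 0 < s) (L L1 : R) (hL : L = s * L1).

Lemma scale_inv : L1 = s^-1 * L.
Proof. by rewrite hL mulKf// gt_eqF. Qed.

Lemma scHK (f : @boxL2 R n L1) : scH s0 hL (scH (invr_pos s0) scale_inv f) = f.
Proof.
apply/val_inj/funext => x /=; congr (f _).
by rewrite scalerA mulVf ?scale1r// gt_eqF.
Qed.

(** Every test vector of the weak equation on the rescaled box comes from the original box, by the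
    inverse scaling. *)
Lemma scX_surj (v : form (n := n) L1) : exists x : form (n := n) L,
  fJ v = scH s0 hL (fJ x) /\ forall i, fG v i = s *: scH s0 hL (fG x i).
Proof.
exists (scX (invr_pos s0) scale_inv v); split.
  by rewrite -[fJ (scX _ _ _)]/(scH (invr_pos s0) scale_inv (fJ v)) scHK.
move=> i; rewrite -[fG (scX _ _ _) i]/(s^-1 *: scH _ _ (fG v i)) scHZ scalerA mulfV ?gt_eqF//.
by rewrite scale1r scHK.
Qed.

(** Each gradient in the form brings a factor s, so the potential and the image both scale by s^2,
    while the Jacobian is common to all terms. *)
Lemma opgraph_scale (V : E -> R) (mV : measurable_fun setT V) B (bV : forall x : E, `|V x| <= B)
    (V1 : E -> R) (mV1 : measurable_fun setT V1) B1 (bV1 : forall x : E, `|V1 x| <= B1)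
    (u g : @boxL2 R n L) : (forall x, V1 x = s ^+ 2 * V (s *: x)) ->
  opgraph mV bV u g -> opgraph mV1 bV1 (scH s0 hL u) (s ^+ 2 *: scH s0 hL g).
Proof.
move=> VE [x <- xg]; exists (scX s0 hL x) => // v.
have [y [vJ vG]] := scX_surj v.
have s1 := @ip_semi R n L1.
rewrite /en vJ -[fJ (scX s0 hL x)]/(scH s0 hL (fJ x)).
have -> : wmul mV1 bV1 (scH s0 hL (fJ x)) = s ^+ 2 *: scH s0 hL (wmul mV bV (fJ x)).
  apply/val_inj/funext => z.
  rewrite -[LHS]/(V1 z * fJ x (s *: z)) -[RHS]/(s ^+ 2 * (V (s *: z) * fJ x (s *: z))).
  by rewrite VE mulrA.
rewrite !(siZl s1) !ip_scH -xg /en !mulrDr; congr (_ + _).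
rewrite !mulr_sumr; apply: eq_bigr => i _.
rewrite vG -[fG (scX s0 hL x) i]/(s *: scH s0 hL (fG x i)) (siZl s1) (siZr s1) ip_scH.
by rewrite expr2 !mulrA.
Qed.

End opgraph_scale.

(** * Essential supremum and sensor sets under rescaling *)

Section supnorm.
Context {R : realType} {n : nat}.
Local Notation E := 'rV[R]_n.
Local Notation mu := (lebesgue_rV (R := R) n : {measure set E -> \bar R}).
Implicit Types V : E -> R.

Lemma box_measure_gt0 (L : R) : 0 < L -> (0 < mu (box L))%E.
Proof.
move=> L0; elim: n => [|m IH].
  by rewrite /= diracE mem_set ?lte_fin ?ltr01// => i; case: i.
have : (0 < (lebesgue_measure \x lebesgue_rV m)%E (@rV_cons R m @^-1` (@box R m.+1 L)))%E.
  rewrite box_cons product_measure1E//; last exact: measurable_box.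
  suff h : (0 < @lebesgue_measure R [set` `](- L)%R, L[%R])%E by exact: mule_gt0.
  rewrite lebesgue_measure_itv/= lte_fin ifT; last lra.
  by rewrite -EFinB lte_fin; lra.
exact.
Qed.

(** [Lnorm] at infinity is the essential supremum only on a space of positive measure. *)
Lemma rV_setT_gt0 : (0 < mu setT)%E.
Proof.
apply: lt_le_trans (box_measure_gt0 ltr01) _.
by apply: le_measure; rewrite ?inE//; exact: measurable_box.
Qed.

Lemma norm_oo_ess V : norm_oo V = fine (ess_sup mu (fun x => `|V x|%:E)).
Proof. by rewrite /norm_oo unlock rV_setT_gt0. Qed.

Lemma norm_oo_le V M : {ae mu, forall x, `|V x| <= M} -> norm_oo V <= M.
Proof.
move=> VM; rewrite norm_oo_ess.
have h : (ess_sup mu (fun x => `|V x|%:E) <= M%:E)%E.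
  by apply/ess_supP; apply: filterS VM => x; rewrite lee_fin.
have h0 : (0 <= ess_sup mu (fun x => `|V x|%:E))%E.
  by apply: ess_sup_gee; [exact: rV_setT_gt0|apply: nearW => x; rewrite lee_fin].
rewrite -lee_fin fineK// ge0_fin_numE//.
by apply: le_lt_trans h _; exact: ltry.
Qed.

Lemma norm_oo_ge0 V : 0 <= norm_oo V.
Proof. by rewrite /norm_oo fine_ge0// Lnorm_ge0. Qed.

Lemma norm_oo_ae V : bounded_measurable V -> {ae mu, forall x, `|V x| <= norm_oo V}.
Proof.
move=> [mV [M hM]]; rewrite norm_oo_ess.
have h : (ess_sup mu (fun x => `|V x|%:E) <= M%:E)%E.
  by apply/ess_supP; apply: nearW => x; rewrite lee_fin.
have h0 : (0 <= ess_sup mu (fun x => `|V x|%:E))%E.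
  by apply: ess_sup_gee; [exact: rV_setT_gt0|apply: nearW => x; rewrite lee_fin].
have := ess_sup_ge mu (fun x => `|V x|%:E); apply: filterS => x hx.
rewrite -lee_fin fineK// ge0_fin_numE//.
by apply: le_lt_trans h _; exact: ltry.
Qed.

(** This direction suffices: for N >= 0 and a base below 1, a larger norm in the exponent only
    weakens unique continuation. *)
Lemma norm_oo_scale (s : R) V : 0 < s -> bounded_measurable V ->
  norm_oo (fun x => s ^+ 2 * V (s *: x)) <= s ^+ 2 * norm_oo V.
Proof.
move=> s0 /norm_oo_ae hV; apply: norm_oo_le.
have := rV_scale_null s0 hV; apply: negligibleS => x /= h1 h2; apply: h1.
by rewrite normrM ger0_norm ?sqr_ge0// ler_wpM2l ?sqr_ge0.
Qed.

Lemma bounded_measurable_scale (s : R) V : 0 < s -> bounded_measurable V ->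
  bounded_measurable (fun x => s ^+ 2 * V (s *: x)).
Proof.
move=> s0 [mV [M hM]]; split.
  by apply: measurable_funM; [exact: measurable_cst|apply: (measurableT_comp mV); exact: measurable_scale].
exists (s ^+ 2 * M) => x; rewrite normrM ger0_norm ?sqr_ge0//.
by rewrite ler_wpM2l ?sqr_ge0.
Qed.

Lemma measurable_eball (z : E) (r : R) : measurable (eball z r).
Proof.
have mf : measurable_fun setT (fun y : E => \sum_i (y ord0 i - z ord0 i) ^+ 2).
  apply: measurable_sum => i; apply: measurable_funX; apply: measurable_funB.
    exact: measurable_coord.
  exact: measurable_cst.
rewrite (_ : eball z r = (fun y : E => Num.sqrt (\sum_i (y ord0 i - z ord0 i) ^+ 2)) @^-1` `]-oo, r[).
  rewrite -[X in measurable X]setTI.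
  have ms : measurable_fun setT (fun y : E => Num.sqrt (\sum_i (y ord0 i - z ord0 i) ^+ 2)).
    by apply: measurableT_comp mf; apply: continuous_measurable_fun; exact: sqrt_continuous.
  by apply: ms => //; exact: measurable_itv.
by apply/seteqP; split => y /=; rewrite /eball/= in_itv/=.
Qed.

Lemma measurable_sensor_set (delta : R) (z : 'rV[int]_n -> E) (L : R) :
  measurable (sensor_set delta z L).
Proof.
apply: measurableI; last exact: (@measurable_box R n (L / 2)).
apply: countable_bigcupT_measurable; first exact: countableP.
by move=> k; exact: measurable_eball.
Qed.

Lemma eball_scale (s : R) (z y : E) (r : R) : 0 < s ->
  eball (s^-1 *: z) (r / s) y <-> eball z r (s *: y).
Proof.
move=> s0; rewrite /eball/=.
have -> : \sum_i ((s *: y) ord0 i - z ord0 i) ^+ 2 = s ^+ 2 * \sum_i (y ord0 i - (s^-1 *: z) ord0 i) ^+ 2.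
  rewrite mulr_sumr; apply: eq_bigr => i _; rewrite !mxE -exprMn; congr (_ ^+ 2).
  by rewrite mulrBr mulVKf ?gt_eqF.
by rewrite sqrtrM ?sqr_ge0// sqrtr_sqr gtr0_norm// ltr_pdivlMr// mulrC.
Qed.

Lemma sensor_set_scale (s delta L : R) (z : 'rV[int]_n -> E) : 0 < s ->
  sensor_set (delta / s) (fun k => s^-1 *: z k) L =
  [set y | sensor_set delta z (s * L) (s *: y)].
Proof.
move=> s0; apply/seteqP; split=> y [[k _ hk] hy]; split.
- by exists k => //; apply/eball_scale.
- by rewrite -[cube _]/(box _) -mulrA; apply/box_scale.
- by exists k => //; apply/eball_scale.
- by move: hy; rewrite -[cube _]/(box _) -mulrA => /(box_scale s0).
Qed.

Lemma equidistributed_scale (s delta : R) (z : 'rV[int]_n -> E) : 0 < s ->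
  equidistributed s delta z -> equidistributed 1 (delta / s) (fun k => s^-1 *: z k).
Proof.
move=> s0 hz k y /(eball_scale _ _ _ s0) /hz /= h i; have := h i.
rewrite !mxE; move: (y _ _) => t; move: (k _ _)%:~R => j.
rewrite -mulrBr !mul1r => /andP[h1 h2].
by rewrite -(ltr_pM2l s0 (- _)) -(ltr_pM2l s0 (t - j)) mulrN h1.
Qed.

End supnorm.

Section low_modes.
Context {R : realType} {n : nat} {L : R}.
Local Notation E := 'rV[R]_n.
Local Notation H := (@boxL2 R n L).

(* Null coefficients are exempted from the constraint on the eigenvalue, so that
   the truncation of a sum to the low modes keeps its indexing by an interval. *)
Definition low_mode (V : E -> R) (mV : measurable_fun setT V) (B : R) (bV : forall x, `|V x| <= B)
    (b : R) (h : H) : Prop :=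
  exists (K : nat) (c lam0 : nat -> R) (phi : nat -> H), h = \sum_(i < K) c i *: phi i /\
    forall i, c i = 0 \/ opgraph mV bV (phi i) (lam0 i *: phi i) /\ lam0 i <= b.

(** The [phi i] are arbitrary eigenvectors, orthogonal to every basis mode above b because
    eigenvalues differ. This matters after rescaling, where the images of the original modes need
    not belong to the eigenbasis chosen on the new box. *)
Lemma low_mode_spectral (V : E -> R) (mV : measurable_fun setT V) (B : R)
    (bV : forall x, `|V x| <= B) (b : R) (h : bool -> H) : 0 < L -> bounded_measurable V ->
  (forall b', low_mode mV bV b (h b')) ->
  spectral_subspace (box L) (schrodinger (box L) V) b (ofH h).
Proof.
move=> L0 bmV hb.
have nu0 := norm_oo_ge0 V; have nuV := norm_oo_ae bmV.
have [e [lam eb]] := box_spectral L0 mV bV nu0 nuV.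
apply: (low_spectral_subspace L0 nuV eb) => b' k bk.
have [K [c [lam0 [phi [-> hc]]]]] := hb b'.
have sip := @ip_semi R n L.
rewrite (si_suml sip) big1// => i _; rewrite (siZl sip).
have [->|[/(opgraph_sgraph mV bV nu0) sg mb]] := hc i; first by rewrite mul0r.
have sew : semi_inner (en (L := L) (mVw mV (norm_oo V)) (bVw bV nu0)).
  by apply: en_semi; exact: Vw1.
rewrite (sgraph_eigen sip sew eb sg) ?mulr0//.
by rewrite gt_eqF// (le_lt_trans mb).
Qed.

End low_modes.

Lemma measurable_sqmod (R : realType) n (D : set 'rV[R]_n) f : L2 D f ->
  measurable_fun D (fun x => (sqmod (f x))%:E).
Proof.
by move=> [m1 m2 _]; apply/measurable_EFinP; apply: measurable_funD; exact: measurable_funX.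
Qed.

Section unique_continuation.
Context {R : realType} {d : nat} {N : R}.
Local Notation E := 'rV[R]_d.
Hypothesis hN : @unique_continuation_constant R d N.

Lemma eigen_low_mode (L : R) (V : E -> R) (mV : measurable_fun setT V) (B : R)
    (bV : forall x, `|V x| <= B) (m b : R) (h : @boxL2 R d L) :
  opgraph mV bV h (m *: h) -> m <= b -> low_mode mV bV b h.
Proof.
move=> hh mb; exists 1%N, (fun=> 1), (fun=> m), (fun=> h); split.
  by rewrite big_ord1 scale1r.
by move=> _; right.
Qed.

Lemma zero_low_mode (L : R) (V : E -> R) (mV : measurable_fun setT V) (B : R)
    (bV : forall x, `|V x| <= B) (b : R) : low_mode mV bV b (0 : @boxL2 R d L).
Proof.
exists 0%N, (fun=> 0), (fun=> 0), (fun=> 0); split; first by rewrite big_ord0.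
by move=> i; left.
Qed.

(* A negative N would make the observed mass of one eigenfunction exceed its
   total mass. *)
Lemma uc_constant_ge0 : 0 <= N.
Proof.
pose V : E -> R := fun=> 0.
have mV : measurable_fun setT V by exact: measurable_cst.
have bV x : `|V x| <= 0 by rewrite normr0.
have bmV : bounded_measurable V by split=> //; exists 0.
have L0 : 0 < 1 / 2 :> R by lra.
have nu0 := norm_oo_ge0 V; have nuV := norm_oo_ae bmV.
have [e [lam eb]] := box_spectral L0 mV bV nu0 nuV.
have sip := @ip_semi R d (1 / 2).
(* Basis vectors may be null, but if all were, the constant function 1 would be null on a box of
   positive measure. *)
have [k ke] : exists k, 0 < ipL2 (fJ (e k)) (fJ (e k)).
  apply/not_existsP => hk.
  have h1 : (fun=> 1 : R) \in sqint (lebesgue_rV d) (@box R d (1 / 2)).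
    have [mD Doo] := finmeas_box (R := R) d (1 / 2).
    apply/sqintP; split; first exact: measurable_cst.
    by under eq_integral do rewrite expr1n; rewrite integral_cst// mul1e.
  pose one : @boxL2 R d (1 / 2) := MkL2sp (@measurable_box R d (1 / 2)) h1.
  have e0 : ipL2 one one = 0.
    have sew : semi_inner (en (L := 1 / 2) (mVw mV (norm_oo V)) (bVw bV nu0)).
      by apply: en_semi; exact: Vw1.
    have := @proj_eq _ _ _ _ _ _ sip sew _ _ eb (fun g => @fJ_dense _ _ _ g) one 0.
    rewrite subr0; apply=> k; rewrite (si0l sip) (siC sip); apply: (si_null sip).
    by apply/eqP; rewrite eq_le (si_ge0 sip) andbT leNgt; apply/negP; exact: hk.
  have := ipL2E one; rewrite e0.
  under eq_integral do rewrite expr1n.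
  rewrite integral_cst ?mul1e; last exact: measurable_box.
  by have := box_measure_gt0 (n := d) L0 => /[swap] <-; rewrite ltxx.
pose h (b : bool) : @boxL2 R d (1 / 2) := if b then 0 else fJ (e k).
pose m := shifted lam (shiftV (norm_oo V)) k.
(* The unique continuation bound is only assumed for nonnegative b. *)
pose b0 := Num.max 0 m.
have hs : spectral_subspace (box (1 / 2)) (schrodinger (box (1 / 2)) V) b0 (ofH h).
  apply: (low_mode_spectral (bV := bV)) => // -[]; first exact: zero_low_mode.
  apply: (@eigen_low_mode _ _ _ _ _ m); last by rewrite le_max lexx orbT.
  apply/(opgraph_sgraph mV bV nu0).
  by have := sgraph_basis sip eb (shiftV (norm_oo V)) k.
pose z (k : 'rV[int]_d) : E := lattice_point 1 k.
have ez : equidistributed 1 (1 / 4) z.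
  move=> j y hy i; rewrite /z in hy; rewrite mxE; move: hy; rewrite /eball/= => hy.
  have : (y ord0 i - z j ord0 i) ^+ 2 <= \sum_i (y ord0 i - z j ord0 i) ^+ 2.
    by rewrite (bigD1 i)//= lerDl; apply: sumr_ge0 => q _; exact: sqr_ge0.
  rewrite -ler_sqrt ?sumr_ge0//; last by move=> q _; exact: sqr_ge0.
  rewrite sqrtr_sqr => /le_lt_trans/(_ hy).
  by rewrite !mxE ltr_norml => /andP[h1 h2]; apply/andP; split; lra.
have d4 : (0 < 1 / 4 :> R) && (1 / 4 < 1 / 2 :> R) by apply/andP; split; lra.
have b00 : 0 <= b0 by rewrite le_max lexx.
have := @hN (1 / 4) d4 z ez V bmV 1%N isT b0 b00 (ofH h) hs.
rewrite -[cube 1%:R]/(@box R d (1 / 2)).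
have hL := L2_ofH h.
rewrite (sqnormE hL).
have le1 : (sqnorm (sensor_set (1 / 4) z 1%:R) (ofH h) <= (nsq (ofH h) (L := 1 / 2))%:E)%E.
  rewrite -(sqnormE hL); apply: ge0_subset_integral => //.
  - exact: measurable_sensor_set.
  - exact: (@measurable_box R d (1/2)).
  - exact: measurable_sqmod.
  - by move=> x _; rewrite lee_fin addr_ge0 ?sqr_ge0.
  - by move=> x [].
move=> /le_trans/(_ le1); rewrite -EFinM lee_fin /nsq !pt_ofH.
rewrite (si0l sip) addr0 ger_pMl//.
apply: contraTle => N0; rewrite -ltNge.
have y0 : 0 < 1 + norm_oo V `^ (2 / 3) + Num.sqrt b0.
  by rewrite -addrA ltr_pwDl// addr_ge0 ?powR_ge0// sqrtr_ge0.
rewrite /powR gt_eqF// expR_gt1 nmulr_lgt0; last by apply: ln_lt0; case/andP: d4 => -> h2 /=; lra.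
by rewrite pmulr_llt0 // ltNge.
Qed.

(** The change of variables x = G y leads to side n, radius delta / G, potential G^2 V(G y) and
    eigenvalues multiplied by G^2. Both norms acquire the same factor G^-d, which cancels. *)
Lemma scaled_uc (G delta : R) (hG : 0 < G) (hdelta : 0 < delta < G / 2)
    (z : 'rV[int]_d -> E) (hz : equidistributed G delta z)
    (V : E -> R) (bmV : bounded_measurable V)
    (mV : measurable_fun setT V) (B : R) (bV : forall x, `|V x| <= B)
    (n : nat) (n0 : (0 < n)%N) (b : R) (b0 : 0 <= b)
    (h : bool -> @boxL2 R d (G * n%:R / 2)) :
  (forall b', low_mode mV bV b (h b')) ->
  (((delta / G) `^ (N * (1 + G `^ (4 / 3) * norm_oo V `^ (2 / 3) + G * Num.sqrt b)))%:E *
    sqnorm (cube (G * n%:R)) (ofH h) <= sqnorm (sensor_set delta z (G * n%:R)) (ofH h))%E.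
Proof.
move=> hb.
pose L1 : R := n%:R / 2.
have hL : G * n%:R / 2 = G * L1 by rewrite /L1 mulrA.
have L10 : 0 < L1 by rewrite divr_gt0// ltr0n.
pose V1 x := G ^+ 2 * V (G *: x).
have [mV1 [B1 bV1]] := bounded_measurable_scale hG bmV.
pose h1 b' := scH hG hL (h b').
have hs : spectral_subspace (box L1) (schrodinger (box L1) V1) (G ^+ 2 * b) (ofH h1).
  apply: (low_mode_spectral (mV := mV1) (bV := bV1)) => //.
    exact: bounded_measurable_scale.
  move=> b'; have [K [c [lam0 [phi [hE hc]]]]] := hb b'.
  exists K, c, (fun i => G ^+ 2 * lam0 i), (fun i => scH hG hL (phi i)); split.
    rewrite /h1 hE; elim/big_ind2: _ => //.
    - by apply/val_inj.
    - by move=> x1 x2 y1 y2 <- <-; exact: scHD.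
    - by move=> i _; exact: scHZ.
  move=> i; have [->|[og mb]] := hc i; [by left|right]; split.
    by have := opgraph_scale hG hL mV1 bV1 (fun=> erefl) og; rewrite scHZ scalerA.
  by rewrite ler_pM2l ?exprn_gt0.
have d1 : 0 < delta / G < 1 / 2.
  by case/andP: hdelta => h2 h3; rewrite divr_gt0//= ltr_pdivrMr// mul1r mulrC.
have b10 : 0 <= G ^+ 2 * b by rewrite mulr_ge0// sqr_ge0.
have := hN d1 (equidistributed_scale hG hz) (bounded_measurable_scale hG bmV) n0 b10 hs.
rewrite sensor_set_scale//.
have mf (A : set E) : measurable A -> A `<=` box (G * n%:R / 2) ->
    sqnorm [set y | A (G *: y)] (ofH h1) = ((G^-1 ^+ d)%:E * sqnorm A (ofH h))%E.
  move=> mA AL; rewrite -(rV_scale_set hG mA)//.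
  - by apply: measurable_funS (measurable_sqmod (L2_ofH h)) => //; exact: measurable_box.
  - by move=> x; rewrite lee_fin addr_ge0 ?sqr_ge0.
rewrite (mf (sensor_set delta z (G * n%:R))); last 2 first.
- exact: measurable_sensor_set.
- by move=> x [].
have -> : cube n%:R = [set y : E | cube (G * n%:R) (G *: y)].
  by rewrite -[LHS]/(box L1) (box_scaleE hG hL).
rewrite (mf (cube (G * n%:R))); last 2 first.
- exact: (@measurable_box R d (G * n%:R / 2)).
- by [].
rewrite muleCA lee_pmul2l//; last by rewrite lte_fin exprn_gt0// invr_gt0.
apply: le_trans; apply: lee_wpmul2r.
  by apply: integral_ge0 => x _; rewrite lee_fin addr_ge0 ?sqr_ge0.
(* The base delta / G is below 1, so it remains to compare exponents, where N >= 0 enters. *)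
rewrite lee_fin; apply: ger_powR.
  by case/andP: d1 => h2 h3; rewrite h2/=; lra.
apply: ler_wpM2l; first exact: uc_constant_ge0.
rewrite -!addrA lerD2l lerD//.
  have -> : G `^ (4 / 3) * norm_oo V `^ (2 / 3) = (G ^+ 2 * norm_oo V) `^ (2 / 3).
    rewrite powRM ?sqr_ge0 ?norm_oo_ge0//; congr (_ * _).
    by rewrite -(powR_mulrn 2 (ltW hG)) -powRrM; congr (_ `^ _); field.
  apply: ge0_ler_powR; rewrite ?nnegrE ?norm_oo_ge0 ?mulr_ge0 ?sqr_ge0 ?(ltW hG) ?norm_oo_ge0//.
  exact: norm_oo_scale.
by rewrite sqrtrM ?sqr_ge0// sqrtr_sqr gtr0_norm.
Qed.

End unique_continuation.

(** * The telescoping argument *)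

Section telescoping.
Context {R : realType}.
Local Notation oc x y := ([set` `]x%R, y%R]] : set R).
Local Notation cc x y := ([set` `[x%R, y%R]] : set R).
Local Notation leb := (@lebesgue_measure R).

(** The bound al may be negative; the claim then follows from W >= 0. *)
Lemma integral_ge_cst (W : R -> R) (x y al : R) : x <= y ->
  measurable_fun `]x, y] W -> (forall t, t \in `]x, y] -> 0 <= W t) ->
  (forall t, t \in `]x, y] -> al <= W t) ->
  (((y - x) * al)%:E <= \int[leb]_(t in oc x y) (W t)%:E)%E.
Proof.
move=> xy mW W0 Wal; have [al0|al0] := leP al 0.
  apply: (@le_trans _ _ 0%E); last by apply: integral_ge0 => t tI; rewrite lee_fin W0.
  by rewrite lee_fin mulr_ge0_le0// subr_ge0.
have <- : (\int[leb]_(t in oc x y) (cst al%:E) t = ((y - x) * al)%:E)%E.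
  rewrite integral_cst//= lebesgue_measure_itv/= lte_fin.
  move: xy; rewrite le_eqVlt => /predU1P[->|xy].
    by rewrite ltxx mule0 subrr mul0r.
  by rewrite xy -EFinB -EFinM mulrC.
apply: ge0_le_integral => //.
- by move=> t _; rewrite lee_fin ltW.
- by apply/measurable_EFinP.
Qed.

(** F stands for the squared norm of the solution, W for its part on the sensor set, B0 for the
    growth factor of the flow on [0, T], and M for a bound on F. *)
Variables (T a0 a c B0 M : R) (F W : R -> R).
Hypotheses (T0 : 0 < T) (a01 : 1 <= a0) (a_ge0 : 0 <= a) (c0 : 0 < c) (B01 : 1 <= B0).
Hypothesis F0 : forall t, 0 <= t <= T -> 0 <= F t <= M.
Hypothesis mW : measurable_fun `[0, T] W.
Hypothesis W0 : forall t, 0 <= t <= T -> 0 <= W t.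
Hypothesis FW : forall th t tau b, 0 <= th -> 0 <= t -> t <= tau -> th + tau <= T -> 0 <= b ->
  F (th + tau) <= B0 * (2 * a0 * expR (a * Num.sqrt b) * W (th + t) +
                        3 * a0 * expR (a * Num.sqrt b) * expR (- 2 * b * t) * F th).

Let s := a + c.
Hypothesis Tsmall : 6 * a0 * B0 * T <= 2 * s * c.

(* With sqrt b = s / tau, integrating [FW] over the last fraction c / (2 s) of an
   interval of length tau turns the coefficient of [F th] into the weight of the
   interval of length tau / 2, which makes the sum over dyadic intervals telescope. *)
Definition tweight (tau : R) : R := expR (- (a * s / tau)) * (c / (2 * s) * tau) / (2 * a0 * B0).

Let s0 : 0 < s. Proof. by move: c0 a_ge0; rewrite /s; lra. Qed.
Let a00 : 0 < a0. Proof. by move: a01; lra. Qed.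
Let B00 : 0 < B0. Proof. by move: B01; lra. Qed.

Lemma tweight_ge0 tau : 0 <= tau -> 0 <= tweight tau.
Proof.
move=> t0; apply: divr_ge0; last by rewrite !mulr_ge0 ?(ltW a00) ?(ltW B00).
by rewrite mulr_ge0 ?expR_ge0// mulr_ge0// divr_ge0 ?(ltW c0)// mulr_ge0// ltW.
Qed.

Lemma tweight_le tau : 0 <= tau -> tweight tau <= tau.
Proof.
move=> t0; rewrite /tweight ler_pdivrMr ?mulr_gt0//.
have h1 : expR (- (a * s / tau)) <= 1.
  by rewrite -expR0 ler_expR oppr_le0 divr_ge0// mulr_ge0// ltW.
have h2 : c / (2 * s) <= 1.
  by rewrite ler_pdivrMr ?mulr_gt0// mul1r; move: c0 a_ge0; rewrite /s; lra.
have h3 : 0 <= c / (2 * s) by rewrite divr_ge0 ?(ltW c0)// mulr_ge0// ltW.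
apply: le_trans (_ : 1 * (c / (2 * s) * tau) <= _).
  by rewrite ler_wpM2r// mulr_ge0.
rewrite mul1r mulrC ler_wpM2l// (le_trans h2)//.
have : 1 <= a0 * B0 by rewrite mulr_ege1.
by rewrite -mulrA; lra.
Qed.

Lemma telescope_step (th tau : R) : 0 <= th -> 0 < tau -> th + tau <= T -> tau <= T / 2 ->
  ((tweight tau * F (th + tau) - tweight (tau / 2) * F th)%:E <=
    \int[leb]_(t in oc th (th + tau)) (W t)%:E)%E.
Proof.
move=> th0 tau0 thT tauT.
(* Then 1 - eps = c / (2 s), and 2 b eps tau = 2 a s / tau + s c / tau for the b below: the first
   term is the exponent in [tweight (tau / 2)], the second is a surplus that absorbs constants. *)
pose eps := (a + c / 2) / s.
have eps01 : 0 <= eps <= 1.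
  apply/andP; split; first by rewrite divr_ge0 ?ltW// /s; move: c0 a_ge0; lra.
  by rewrite ler_pdivrMr// mul1r /s; move: c0; lra.
have [e0 e1] := andP eps01.
pose b := (s / tau) ^+ 2.
have sb : Num.sqrt b = s / tau by rewrite sqrtr_sqr ger0_norm// divr_ge0// ltW.
pose A := a0 * expR (a * (s / tau)).
have A0 : 0 < A by rewrite mulr_gt0// expR_gt0.
pose q := expR (- 2 * b * (eps * tau)).
pose al := (F (th + tau) / B0 - 3 * A * q * F th) / (2 * A).
have Fth : 0 <= F th.
  by have /andP[] : 0 <= F th <= M by apply: F0; rewrite th0/=; lra.
have et : eps * tau <= tau by rewrite ler_piMl// ltW.
have et0 : 0 <= eps * tau by rewrite mulr_ge0// ltW.
have hal t : t \in `](th + eps * tau), (th + tau)] -> al <= W t.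
  rewrite in_itv/= => /andP[t1 t2].
  have := @FW th (t - th) tau b th0.
  have -> : th + (t - th) = t by ring.
  rewrite sb => /(_ _ _ thT (sqr_ge0 _)) h.
  have {}h := h ltac:(lra) ltac:(lra).
  have A20 : 0 < 2 * A by rewrite mulr_gt0.
  rewrite /al (ler_pdivrMr _ _ A20) lerBlDr ler_pdivrMr//.
  apply: le_trans h _; rewrite (mulrC B0) ler_pM2r//.
  have hq : expR (- 2 * b * (t - th)) <= q.
    rewrite /q ler_expR !mulNr lerN2; apply: ler_wpM2l; first by rewrite mulr_ge0 ?sqr_ge0.
    by rewrite lerBrDr addrC ltW.
  have h2 : A * expR (- 2 * b * (t - th)) * F th <= A * q * F th.
    by rewrite ler_wpM2r// ler_wpM2l// ltW.
  rewrite /A in h2 *; lra.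
have sub : (((th + tau - (th + eps * tau)) * al)%:E <= \int[leb]_(t in oc th (th + tau)) (W t)%:E)%E.
  have subI (x y : R) : 0 <= x -> y <= T -> [set` `]x, y]] `<=` [set` `[0, T]].
    by move=> x0 yT t /=; rewrite !in_itv/= => /andP[? ?]; apply/andP; split; lra.
  apply: (@le_trans _ _ (\int[leb]_(t in oc (th + eps * tau) (th + tau)) (W t)%:E)%E).
    apply: integral_ge_cst => //; first lra.
    - by apply: measurable_funS mW => //; apply: subI => //; lra.
    - move=> t; rewrite in_itv/= => /andP[? ?]; apply: W0; apply/andP; split; lra.
  apply: ge0_subset_integral => //.
  - by apply/measurable_EFinP; apply: measurable_funS mW => //; apply: subI.
  - by move=> t /= ; rewrite in_itv/= => /andP[? ?]; rewrite lee_fin; apply: W0; apply/andP; split; lra.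
  - by move=> t /=; rewrite !in_itv/= => /andP[? ->]; rewrite andbT; lra.
apply: le_trans sub; rewrite lee_fin.
have -> : th + tau - (th + eps * tau) = c / (2 * s) * tau.
  by rewrite /eps /s; field; rewrite gt_eqF.
have -> : c / (2 * s) * tau * al = tweight tau * F (th + tau) - 3 / 2 * (c / (2 * s) * tau) * q * F th.
  rewrite /al /A /tweight expRN.
  rewrite -(mulrA a s); have := expR_gt0 (a * (s / tau)); move: (expR (a * _)) => X X0.
  by field; rewrite !gt_eqF.
rewrite lerD2l lerN2 ler_wpM2r//.
rewrite /tweight /q.
have -> : - (a * s / (tau / 2)) = - (2 * a * s / tau) by field; rewrite gt_eqF.
have -> : - 2 * b * (eps * tau) = - (2 * a * s / tau) - s * c / tau.
  by rewrite /b /eps /s; field; rewrite !gt_eqF// -/s.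
rewrite expRD.
have X0 := expR_gt0 (- (2 * a * s / tau)); move: (expR _) X0 => X X0.
(* From exp x >= x with x = s c / tau >= 2 s c / T, by tau <= T / 2, and 2 s c / T >= 6 a0 B0 by
   [Tsmall]. *)
have h : expR (- (s * c / tau)) * (6 * a0 * B0) <= 1.
  rewrite expRN mulrC ler_pdivrMr ?expR_gt0// mul1r.
  apply: le_trans (_ : s * c / tau <= _).
    rewrite ler_pdivlMr//; apply: le_trans (_ : 6 * a0 * B0 * (T / 2) <= _).
      by rewrite ler_wpM2l// !mulr_ge0// ltW.
    by move: Tsmall; lra.
  have := expR_ge1Dx (s * c / tau); lra.
move: (expR _) h => Y h.
rewrite ler_pdivlMr ?mulr_gt0//.
have p0 : 0 <= X * (c / (2 * s) * tau) / 2.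
  by rewrite !mulr_ge0 ?invr_ge0 ?ltW// mulr_gt0.
apply: le_trans (_ : (X * (c / (2 * s) * tau) / 2) * (Y * (6 * a0 * B0)) <= _).
  by rewrite le_eqVlt; apply/orP; left; apply/eqP; field; rewrite gt_eqF.
apply: le_trans (ler_wpM2l p0 h) _.
by rewrite mulr1 !mulrA.
Qed.

Lemma observability_of_telescoping :
  ((F T)%:E <= (4 * a0 * B0 * expR (2 * a * s / T) * (2 * s / (c * T)))%:E *
     \int[leb]_(t in cc 0 T) (W t)%:E)%E.
Proof.
pose x k := T * (2^-1) ^+ k.
have x0 k : 0 < x k by rewrite mulr_gt0// exprn_gt0// invr_gt0.
have xS k : x k.+1 = x k / 2 by rewrite /x exprSr mulrA.
have xT k : x k <= T by rewrite ler_piMr ?(ltW T0)// exprn_ile1//; lra.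
(* From [x k.+1] to [x k] the length is tau = [x k / 2]; the weight [tweight (tau / 2)] of the old
   term is then [tweight (x k.+1 / 2)], and consecutive steps cancel. *)
have step k : ((tweight (T / 2) * F T - tweight (x k / 2) * F (x k))%:E <=
    \int[leb]_(t in oc (x k) T) (W t)%:E)%E.
  elim: k => [|k IH].
    by rewrite /x expr0 mulr1 subrr set_itvoc0 integral_set0.
  have xk2 : x k.+1 + x k / 2 = x k by rewrite xS; field.
  have x2T : x k / 2 <= T / 2 by rewrite ler_pM2r ?invr_gt0//.
  have h := @telescope_step (x k.+1) (x k / 2) (ltW (x0 _)) _ _ x2T.
  rewrite xk2 -xS in h.
  have {}h := h (x0 _) (xT _).
  have -> : oc (x k.+1) T = oc (x k.+1) (x k) `|` oc (x k) T.
    by rewrite -itv_bndbnd_setU// bnd_simp; rewrite ?xT// xS; have := x0 k; lra.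
  have subI (p y : R) : 0 <= p -> y <= T -> [set` `]p, y]] `<=` [set` `[0, T]].
    by move=> p0 yT t /=; rewrite !in_itv/= => /andP[? ?]; apply/andP; split; lra.
  rewrite ge0_integral_setU//=; last 3 first.
  - apply/measurable_EFinP; apply: measurable_funS mW => //.
    by rewrite subUset; split; apply: subI => //; exact: ltW.
  - move=> t [|]/=; rewrite in_itv/= => /andP[t1 t2]; rewrite lee_fin; apply: W0; apply/andP; split.
    + by have := x0 k.+1; lra.
    + exact: le_trans t2 (xT _).
    + by have := x0 k; lra.
    + by [].
  - apply/disj_setPLR => t /=; rewrite !in_itv/= => /andP[_ t1] /andP[t2 _].
    by have := lt_le_trans t2 t1; rewrite ltxx.
  apply: le_trans (leeD h IH); rewrite -EFinD lee_fin.
  by rewrite -(xS k); lra.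
have M0 : 0 <= M.
  have /andP[h1 h2] : 0 <= F T <= M by apply: F0; rewrite lexx ltW.
  exact: le_trans h1 h2.
(* The remaining term at [x k] is at most [x k * M], by [tweight_le] and boundedness of F, and
   disappears as k grows. *)
have main k : ((tweight (T / 2) * F T)%:E <= \int[leb]_(t in cc 0 T) (W t)%:E + (x k * M)%:E)%E.
  have h : (\int[leb]_(t in oc (x k) T) (W t)%:E <= \int[leb]_(t in cc 0 T) (W t)%:E)%E.
    apply: ge0_subset_integral => //.
    - exact/measurable_EFinP.
    - by move=> t /=; rewrite !in_itv/= => /andP[t1 ->]; rewrite andbT; have := x0 k; lra.
  apply: le_trans (leeD (le_trans (step k) h) (lexx _)).
  rewrite -EFinD lee_fin -lerBlDl opprB addrCA subrr addr0.
  have /andP[f0 fM] : 0 <= F (x k) <= M by apply: F0; rewrite xT ltW.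
  apply: ler_pM => //; first by apply: tweight_ge0; rewrite divr_ge0// ltW.
  apply: le_trans (tweight_le _) _; first by rewrite divr_ge0// ltW.
  by have := x0 k; lra.
have lim : ((tweight (T / 2) * F T)%:E <= \int[leb]_(t in cc 0 T) (W t)%:E)%E.
  apply/lee_addgt0Pr => e e0.
  have xM : x k * M @[k --> \oo] --> 0.
    rewrite -(mul0r M) -(mulr0 T); apply: cvgM; last exact: cvg_cst.
    apply: cvgM; first exact: cvg_cst.
    by apply: cvg_expr; rewrite ger0_norm; lra.
  have /cvgrPdist_lt/(_ _ e0)[k _ hk] := xM.
  apply: le_trans (main k) _; apply: leeD => //; rewrite lee_fin ltW//.
  apply: le_lt_trans (hk k (leqnn k)); rewrite /= sub0r normrN ler_norm.
  by [].
(* K is the inverse of [tweight (T / 2)]. *)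
set K := (X in (X%:E * _)%E).
have K0 : 0 <= K.
  by rewrite !mulr_ge0 ?expR_ge0 ?invr_ge0 ?mulr_ge0 ?(ltW a00) ?(ltW B00) ?(ltW s0) ?(ltW c0) ?(ltW T0).
have -> : F T = K * (tweight (T / 2) * F T).
  rewrite /K /tweight.
  have -> : a * s / (T / 2) = 2 * a * s / T by field; rewrite gt_eqF.
  rewrite expRN; have := expR_gt0 (2 * a * s / T); move: (expR _) => X X0.
  by field; rewrite !gt_eqF.
by rewrite EFinM lee_wpmul2l// lee_fin.
Qed.

End telescoping.

(** * The heat equation *)

Section heat_modes.
Context {R : realType} {n : nat} {L : R}.
Local Notation E := 'rV[R]_n.
Local Notation C := R[i].
Local Notation mu := (lebesgue_rV (R := R) n : {measure set E -> \bar R}).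
Local Notation D := (@box R n L).
Local Notation H := (@boxL2 R n L).
Local Notation X := (@form R n L).
Local Notation mD := (@measurable_box R n L).
Local Notation ip := (@ipL2 _ _ _ mu D mD : H -> H -> R).
Let sip : semi_inner ip := @ip_semi R n L.

Lemma ip_pt_sq b (f : E -> C) (w : H) : ip (pt b f) w ^+ 2 <= nsq (L := L) f * ip w w.
Proof.
apply: le_trans (si_cs sip _ _) _.
by rewrite ler_wpM2r ?(si_ge0 sip)// pt_le_nsq.
Qed.

(** For a general filter, so as to serve both continuity on the closed time interval and the
    difference quotient at 0. *)
Lemma cvg_ip_pt (Fl : set_system R) {FF : Filter Fl} (f : R -> E -> C) (w : H) b :
  (\near Fl, L2 D (f Fl)) -> sqnorm D (f h) @[h --> Fl] --> 0%E ->
  ip (pt b (f h)) w @[h --> Fl] --> 0.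
Proof.
move=> hf /fine_cvgP[_ h0]; apply/cvgrPdist_lt => eps eps0.
have c0 : 0 < eps ^+ 2 / (ip w w + 1).
  by rewrite divr_gt0 ?exprn_gt0// ltr_wpDl// (si_ge0 sip).
have /cvgrPdist_lt/(_ _ c0) := h0; move: hf; apply: filterS2 => h hf.
rewrite /= sqnormE//= !sub0r !normrN ger0_norm ?nsq_ge0// => hh.
rewrite -(@ltr_pXn2r _ 2)// ?nnegrE// ?(ltW eps0)//.
rewrite real_normK ?num_real// (le_lt_trans (ip_pt_sq _ _ _))//.
have w0 : 0 < ip w w + 1 by rewrite ltr_wpDl// (si_ge0 sip).
move: hh; rewrite ltr_pdivlMr//; apply: le_lt_trans.
by rewrite ler_wpM2l ?nsq_ge0// lerDl.
Qed.

Lemma L2Z (a : R) (f : E -> C) : L2 D f -> L2 D (fun x => a%:C%C * f x).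
Proof.
move=> hf; have := L2_lin a hf (L2_ofH (L := L) (fun=> 0)).
congr (L2 D _); apply/funext => x; apply: cpart_eq => b.
by rewrite cpartD cpart_mkC addr0.
Qed.

Lemma ptZ b (a : R) (f : E -> C) : L2 D f -> pt b (fun x => a%:C%C * f x) = a *: pt b f :> H.
Proof.
move=> hf; apply: pt_eq => x; rewrite cpartZ.
by rewrite -[RHS]/(a * pt b f x) ptE.
Qed.

Hypothesis L0 : 0 < L.
Variables (V : E -> R) (mV : measurable_fun setT V) (B : R) (bV : forall x, `|V x| <= B).
Variables (nu : R) (nu0 : 0 <= nu) (nuV : {ae mu, forall x, `|V x| <= nu}).
Variables (e : nat -> X) (lam : nat -> R).
Hypothesis eb : eigenbasis ip (en (L := L) (mVw mV nu) (bVw bV nu0)) (@fJ R n L : {linear X -> H}) e lam.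
Local Notation m := (shifted lam (shiftV nu)).
Variables (T : R) (T0 : 0 < T) (u0 : E -> C) (u : R -> E -> C).
Hypothesis hu : heat_solution D V T u0 u.

Definition heat_coef b k t : R := ip (pt b (u t)) (basisE e k).

Lemma heat_L2 t : 0 <= t <= T -> L2 D (u t).
Proof. by case: hu => _ h _ _ tT; have [] := h t tT. Qed.

Lemma heat_coef_cont b k : {within `[0, T], continuous (heat_coef b k)}.
Proof.
apply/subspace_continuousP => t /= tT.
have hut := heat_L2 tT.
have [_ h _ _] := hu; have [_ ht] := h t tT.
have hL : \forall s \near within [set` `[0, T]] (nbhs t), L2 D (u s \- u t).
  by rewrite near_withinE; apply: nearW => s sI; apply: L2B => //; exact: heat_L2.
have h0' := @cvg_ip_pt _ _ _ (basisE e k) b hL ht.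
have h0 := h0' (within_filter _ (nbhs_filter t)).
apply/cvgrPdist_lt => eps eps0; move/cvgrPdist_lt: h0 => /(_ _ eps0).
rewrite !near_withinE; apply: filterS => s h' sI; have := h' sI.
by rewrite ptB//; [rewrite (siBl sip) sub0r normrN distrC|exact: heat_L2].
Qed.

(** By the equation, - ut is the image of [u t] under - Delta + V; symmetry moves the operator onto
    the eigenvector. *)
Lemma heat_schrodinger t : 0 < t < T -> exists ut : E -> C,
  [/\ L2 D ut, sqnorm D (fun x => (h^-1)%:C%C * (u (t + h) x - u t x) - ut x) @[h --> 0^'] --> 0%E &
    forall b k, ip (pt b ut) (basisE e k) = - m k * heat_coef b k t].
Proof.
move=> tT; have [_ _ _ h] := hu; have [ut [w [hut hlim hw hE]]] := h t tT.
exists ut; split=> // b k.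
have hUt : L2 D (u t) by apply: heat_L2; case/andP: tT => t1 t2; rewrite !ltW.
have hg := L2Z (-1) hut.
have sg : schrodinger D V (u t) (fun x => (-1)%:C%C * ut x).
  split=> //; exists w => //; move: hE; apply: filterS => x hx Dx.
  apply: cpart_eq => b'.
  have : cpart b' (ut x - w x + (V x)%:C%C * u t x) = 0 by rewrite hx//; case: b'.
  by rewrite !cpartD !cpartN !cpartZ; lra.
have [_ _ og] := (schrodingerP mV bV _ _ (ltW L0)).1 sg.
have /(opgraph_sgraph mV bV nu0) := og b.
rewrite ptZ// scaleN1r.
have sew : semi_inner (en (L := L) (mVw mV nu) (bVw bV nu0)).
  by apply: en_semi; exact: Vw1.
move=> sgr; have /eqP := @sgraph_coef _ _ _ _ _ _ sip sew _ _ eb _ _ _ k sgr.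
rewrite (siNl sip) eqr_oppLR => /eqP ->.
by rewrite mulNr.
Qed.

Lemma heat_coef_derive b k t : 0 < t < T -> is_derive t (1 : R) (heat_coef b k) (- m k * heat_coef b k t).
Proof.
move=> tT; have [ut [hut hlim hco]] := heat_schrodinger tT.
have hUt : L2 D (u t) by apply: heat_L2; case/andP: tT => t1 t2; rewrite !ltW.
have nh : \forall h \near (0 : R)^', 0 <= t + h <= T.
  have nh0 : \forall h \near (0 : R), 0 <= t + h <= T.
    have [t1 t2] := andP tT.
    have d0 : 0 < Num.min t (T - t) by rewrite lt_min t1 subr_gt0.
    have hh : \forall h \near (0 : R), `|h| < Num.min t (T - t) by exact: nbhs0_lt.
    apply: filterS hh => h; rewrite lt_min !ltr_norml.
    by move=> /andP[/andP[h1 h2] /andP[h3 h4]]; apply/andP; split; lra.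
  exact: nbhs_dnbhs.
have hL : \forall h \near (0 : R)^', L2 D (fun x => (h^-1)%:C%C * (u (t + h) x - u t x) - ut x).
  apply: filterS nh => h /heat_L2 hth.
  exact: (L2B (L2Z h^-1 (L2B hth hUt)) hut).
have h0' := @cvg_ip_pt _ _ _ (basisE e k) b hL hlim.
have h0 := h0' (dnbhs_filter _).
have hd : h^-1 *: ((heat_coef b k \o shift t) (h *: (1 : R)) - heat_coef b k t) @[h --> 0^'] --> - m k * heat_coef b k t.
  rewrite -hco; apply/cvgrPdist_lt => eps eps0; move/cvgrPdist_lt: h0 => /(_ _ eps0).
  move: nh; apply: filterS2 => h /heat_L2 hth.
  rewrite (ptB b (L2Z h^-1 (L2B hth hUt)) hut) (ptZ b _ (L2B hth hUt)) (ptB b hth hUt).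
  rewrite (siBl sip) (siZl sip) (siBl sip) sub0r normrN distrC => hh.
  have -> : (heat_coef b k \o shift t) (h *: 1) = heat_coef b k (t + h).
    by rewrite /= -[h *: 1]/(h * 1) mulr1 addrC.
  exact: hh.
by split; [apply: cvgP hd|apply: cvg_lim].
Qed.

(** The product with exp(m t) has zero derivative inside the interval and is continuous up to its
    ends, where the equation is not assumed; the mean value theorem makes it constant. *)
Lemma heat_coef_exp b k t : 0 <= t <= T -> heat_coef b k t = expR (- m k * t) * heat_coef b k 0.
Proof.
move=> /andP[t0 tT]; move: t0; rewrite le_eqVlt => /predU1P[<-|t0].
  by rewrite mulr0 expR0 mul1r.
pose g s := expR (m k * s) * heat_coef b k s.
have he s : is_derive s (1 : R) (fun s => expR (m k * s)) (m k * expR (m k * s)).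
  have h2 : is_derive s (1 : R) ( *%R (m k) : R -> R) (m k).
    have := is_deriveZ (m k) (is_derive_id s (1 : R)).
    by rewrite -[X in is_derive _ _ _ X]/(m k * 1) mulr1.
  by have := is_derive1_comp (is_derive_expR (m k * s)) h2; rewrite mulrC.
have [||s sI] := @MVT R g (fun=> 0) 0 t t0.
- move=> s; rewrite in_itv/= => /andP[s0 st].
  have hs : is_derive s (1 : R) (heat_coef b k) (- m k * heat_coef b k s).
    by apply: heat_coef_derive; rewrite s0 (lt_le_trans st).
  apply: is_derive_eq (is_deriveM (he s) hs) _.
  rewrite -[X in X + _ = _]/(_ * _) -[X in _ + X = _]/(_ * _); ring.
- have sub : [set` `[0, t]] `<=` [set` `[0, T]].
    by move=> s /=; rewrite !in_itv/= => /andP[-> st]; exact: le_trans st tT.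
  have := continuous_subspaceW sub (@heat_coef_cont b k) => /subspace_continuousP hc.
  apply/subspace_continuousP => s sI; apply: cvgM; last exact: hc.
  apply: cvg_within_filter.
  have ce : continuous (fun s => expR (m k * s)).
    move=> s'; apply: (@continuous_comp _ _ _ ( *%R (m k)) expR); last exact: continuous_expR.
    exact: mulrl_continuous.
  exact: ce.
rewrite mul0r /g mulr0 expR0 mul1r => /eqP; rewrite subr_eq0 => /eqP <-.
by rewrite mulrA -expRD mulNr addNr expR0 mul1r.
Qed.

End heat_modes.

Section heat_observability.
Context {R : realType} {n : nat} {L : R}.
Local Notation E := 'rV[R]_n.
Local Notation C := R[i].
Local Notation mu := (lebesgue_rV (R := R) n : {measure set E -> \bar R}).
Local Notation D := (@box R n L).
Local Notation H := (@boxL2 R n L).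
Local Notation X := (@form R n L).
Local Notation mD := (@measurable_box R n L).
Local Notation ip := (@ipL2 _ _ _ mu D mD : H -> H -> R).
Local Notation nsq := (nsq (L := L)).
Let sip : semi_inner ip := @ip_semi R n L.

Hypothesis L0 : 0 < L.
Variables (V : E -> R) (mV : measurable_fun setT V) (B : R) (bV : forall x, `|V x| <= B).
Variables (nu : R) (nu0 : 0 <= nu) (nuV : {ae mu, forall x, `|V x| <= nu}).
Variables (e : nat -> X) (lam : nat -> R).
Hypothesis eb : eigenbasis ip (en (L := L) (mVw mV nu) (bVw bV nu0)) (@fJ R n L : {linear X -> H}) e lam.
Local Notation m := (shifted lam (shiftV nu)).
Let oE : sorthonormal ip (basisE e). Proof. by case: eb. Qed.

Definition energy (f : E -> C) k : R :=
  ip (pt false f) (basisE e k) ^+ 2 + ip (pt true f) (basisE e k) ^+ 2.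

Lemma energy_ge0 f k : 0 <= energy f k.
Proof. by rewrite addr_ge0 ?sqr_ge0. Qed.

Lemma energy_sum f : \sum_(k < K) energy f k @[K --> \oo] --> nsq f.
Proof.
have hs (h : H) : \sum_(k < K) ip h (basisE e k) ^+ 2 @[K --> \oo] --> ip h h.
  exact: ip_sqr_sum eb _.
apply: (cvg_ext _ (cvgD (hs (pt false f)) (hs (pt true f)))) => K.
by rewrite -[LHS]/(_ + _) -big_split.
Qed.

Lemma nsq_le f g h C1 C2 : (forall k, energy f k <= C1 * energy g k + C2 * energy h k) ->
  nsq f <= C1 * nsq g + C2 * nsq h.
Proof.
move=> hk; have c1 := @energy_sum f.
have c2 : \sum_(k < K) (C1 * energy g k + C2 * energy h k) @[K --> \oo] --> C1 * nsq g + C2 * nsq h.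
  apply: (cvg_ext _ (cvgD (cvgM (cvg_cst C1) (@energy_sum g)) (cvgM (cvg_cst C2) (@energy_sum h)))) => K.
  by rewrite -[LHS]/(_ * _ + _ * _) !mulr_sumr -big_split.
have := ler_lim (cvgP _ c1) (cvgP _ c2) (nearW _ (fun K => ler_sum _ (fun (k : 'I_K) _ => hk k))).
by rewrite (cvg_lim _ c1)// (cvg_lim _ c2)//; apply.
Qed.

Lemma eigenvalue_ge k : - nu <= m k.
Proof. by have [_ _ h _ _] := eb; have := h k; rewrite /shifted /shiftV; lra. Qed.

Section low_part.
Variables (b : R) (f : E -> C) (hf : L2 D f).

(** Every mode from this index on is high; below it, [lowH] tests each eigenvalue. *)
Definition low_cut : nat := projT1 (cid (shifted_oo eb (shiftV nu) b)).

Lemma low_cutP k : (low_cut <= k)%N -> b < m k.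
Proof. by rewrite /low_cut; case: cid => K /= h; exact: h. Qed.

Definition lowH (b' : bool) : H :=
  \sum_(i < low_cut) (if m i <= b then ip (pt b' f) (basisE e i) else 0) *: basisE e i.

Lemma low_mode_lowH b' : low_mode mV bV b (lowH b').
Proof.
exists low_cut, (fun i => if m i <= b then ip (pt b' f) (basisE e i) else 0), m, (basisE e).
split=> // i; case: ifPn => mb; [right|by left]; split=> //.
apply/(opgraph_sgraph mV bV nu0).
exact: (sgraph_basis sip eb).
Qed.

Lemma ip_lowH b' k : ip (lowH b') (basisE e k) =
  if m k <= b then ip (pt b' f) (basisE e k) else 0.
Proof.
rewrite /lowH (si_suml sip).
have [kK|Kk] := ltnP k low_cut.
  rewrite (bigD1 (Ordinal kK))//= big1 ?addr0 => [|i ik].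
    by rewrite (siZl sip); case: ifP => _; rewrite ?mul0r// (coef_norm sip oE).
  by rewrite (siZl sip) oE.1 ?mulr0.
rewrite big1 => [|i _].
  by rewrite ifF//; apply/negbTE; rewrite -ltNge low_cutP.
rewrite (siZl sip) oE.1 ?mulr0//; apply: contraTneq Kk => <-; rewrite -ltnNge.
exact: ltn_ord.
Qed.

Lemma energy_low k : energy (ofH lowH) k = if m k <= b then energy f k else 0.
Proof. by rewrite /energy !pt_ofH !ip_lowH; case: ifP => // _; rewrite expr0n addr0. Qed.

Lemma energy_high k : energy (f \- ofH lowH) k = if m k <= b then 0 else energy f k.
Proof.
have hl := L2_ofH lowH.
rewrite /energy (ptB false hf hl) (ptB true hf hl) !(siBl sip) !pt_ofH !ip_lowH.
by case: ifP => _; rewrite ?subr0// !subrr expr0n addr0.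
Qed.

End low_part.

Variables (Ws : set E) (mWs : measurable Ws) (WD : Ws `<=` D).

Definition wsq (f : E -> C) : R := fine (sqnorm Ws f).

Lemma sqnorm_sub f : L2 D f -> (sqnorm Ws f <= (nsq f)%:E)%E.
Proof.
move=> hf; rewrite -(sqnormE hf); apply: ge0_subset_integral => //.
- exact: mD.
- exact: measurable_sqmod.
- by move=> x _; rewrite lee_fin addr_ge0 ?sqr_ge0.
Qed.

Lemma sqnorm_ge0 (A : set E) (f : E -> C) : (0 <= sqnorm A f)%E.
Proof. by apply: integral_ge0 => x _; rewrite lee_fin addr_ge0 ?sqr_ge0. Qed.

Lemma wsqE f : L2 D f -> sqnorm Ws f = (wsq f)%:E.
Proof.
move=> hf; rewrite fineK// ge0_fin_numE ?sqnorm_ge0//.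
by apply: le_lt_trans (sqnorm_sub hf) _; exact: ltry.
Qed.

Lemma wsq_ge0 f : 0 <= wsq f.
Proof. by apply: fine_ge0; exact: sqnorm_ge0. Qed.

Lemma wsq_tri f g : L2 D f -> L2 D g -> wsq g <= 2 * wsq f + 2 * nsq (f \- g).
Proof.
move=> hf hg; have hfg := L2B hf hg.
have : wsq g <= 2 * wsq f + 2 * wsq (f \- g).
  rewrite -lee_fin EFinD !EFinM -!wsqE//.
  have ms h : L2 D h -> measurable_fun Ws (fun x => (sqmod (h x))%:E).
    by move=> /measurable_sqmod; apply: (measurable_funS mD WD).
  have ge h x : (0 <= (sqmod (h x : C))%:E)%E by rewrite lee_fin addr_ge0 ?sqr_ge0.
  rewrite /sqnorm -!ge0_integralZl_EFin//; try exact: ms.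
  rewrite -ge0_integralD//; try by [move=> x _; rewrite mule_ge0|
     apply: measurable_funeM; exact: ms].
  apply: ge0_le_integral => //.
  - exact: ms.
  - by apply: emeasurable_funD; apply: measurable_funeM; exact: ms.
  - move=> x _; rewrite -!EFinM -EFinD lee_fin /sqmod.
    rewrite -[(f \- g) x]/(f x - g x); case: (f x) (g x) => [p q] [p' q'] /=.
    (* (2 p - p')^2 is the difference 2 p^2 + 2 (p - p')^2 - p'^2. *)
    by have := sqr_ge0 (2 * p - p'); have := sqr_ge0 (2 * q - q'); lra.
move=> /le_trans; apply; rewrite lerD2l ler_pM2l//.
by rewrite -lee_fin -wsqE// sqnorm_sub.
Qed.

Variables (a0 a : R) (a01 : 1 <= a0) (a_ge0 : 0 <= a).
Hypothesis uc : forall b (h : bool -> H), 0 <= b -> (forall b', low_mode mV bV b (h b')) ->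
  (((a0 * expR (a * Num.sqrt b))^-1)%:E * sqnorm D (ofH h) <= sqnorm Ws (ofH h))%E.

Variables (T : R) (T0 : 0 < T) (u0 : E -> C) (u : R -> E -> C).
Hypothesis hu : heat_solution D V T u0 u.

Lemma energy_heat t k : 0 <= t <= T -> energy (u t) k = expR (- 2 * m k * t) * energy (u 0) k.
Proof.
move=> tT; have h := heat_coef_exp L0 nuV eb hu.
rewrite /energy -!/(heat_coef e u _ _ _) !(h _ _ t tT) !exprMn -mulrDr; congr (_ * _).
by rewrite expr2 -expRD; congr expR; ring.
Qed.

Lemma energy_heatD th t k : 0 <= th -> 0 <= t -> th + t <= T ->
  energy (u (th + t)) k = expR (- 2 * m k * t) * energy (u th) k.
Proof.
move=> th0 t0 tT.
rewrite (@energy_heat (th + t)) ?addr_ge0// (@energy_heat th); last by rewrite th0/=; lra.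
by rewrite mulrA -expRD; congr (expR _ * _); ring.
Qed.

Lemma expR_mode t k : 0 <= t <= T -> expR (- 2 * m k * t) <= expR (2 * nu * T).
Proof.
move=> /andP[t0 tT]; rewrite ler_expR; have := eigenvalue_ge k => h.
have h1 : - m k * t <= nu * t by rewrite ler_wpM2r//; lra.
have h2 : nu * t <= nu * T by rewrite ler_wpM2l.
lra.
Qed.

Lemma heat_bound t : 0 <= t <= T -> 0 <= nsq (u t) <= expR (2 * nu * T) * nsq (u 0).
Proof.
move=> tT; rewrite nsq_ge0/=; apply: le_trans (_ : expR (2 * nu * T) * nsq (u 0) + 0 * nsq (u 0) <= _).
  apply: nsq_le => k; rewrite mul0r addr0 energy_heat//.
  by rewrite ler_wpM2r ?energy_ge0// expR_mode.
by rewrite mul0r addr0.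
Qed.

(** The solution is split at time th + t. Up to th + tau its low part grows at most by exp(2 nu T),
    while the high modes have decayed by Q since th. Replacing the low part by u on the sensor set
    costs the factor 2 of [wsq_tri]; the high part is counted twice there and once in the splitting,
    whence the 3. *)
Lemma heat_estimate th t tau b : 0 <= th -> 0 <= t -> t <= tau -> th + tau <= T -> 0 <= b ->
  nsq (u (th + tau)) <= expR (2 * nu * T) *
    (2 * a0 * expR (a * Num.sqrt b) * wsq (u (th + t)) +
     3 * a0 * expR (a * Num.sqrt b) * expR (- 2 * b * t) * nsq (u th)).
Proof.
move=> th0 t0 ttau tT b0.
have tau0 : 0 <= tau by exact: le_trans ttau.
have htT : th + t <= T by lra.
have hU : L2 D (u (th + t)) by apply: (heat_L2 hu); rewrite addr_ge0.
pose p := ofH (lowH b (u (th + t))).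
have hp : L2 D p := L2_ofH _.
pose Q := expR (- 2 * b * t).
have Qk s k : t <= s -> ~~ (m k <= b) -> expR (- 2 * m k * s) <= Q.
  rewrite -ltNge => ts bm; rewrite ler_expR.
  have h1 : b * t <= m k * s by apply: ler_pM => //; exact: ltW.
  lra.
have i1 : nsq (u (th + tau)) <= expR (2 * nu * T) * nsq p + Q * nsq (u th).
  apply: nsq_le => k; rewrite energy_low; case: ifPn => mb.
    have -> : th + tau = (th + t) + (tau - t) by ring.
    rewrite energy_heatD; [|exact: addr_ge0|by rewrite subr_ge0|lra].
    apply: le_trans (_ : expR (2 * nu * T) * energy (u (th + t)) k <= _).
      by rewrite ler_wpM2r ?energy_ge0// expR_mode// subr_ge0 ttau/=; lra.
    by rewrite lerDl mulr_ge0 ?expR_ge0 ?energy_ge0.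
  rewrite mulr0 add0r energy_heatD//.
  by rewrite ler_wpM2r ?energy_ge0// Qk.
have i2 : nsq (u (th + t) \- p) <= Q * nsq (u th).
  apply: le_trans (_ : Q * nsq (u th) + 0 * nsq (u th) <= _); last by rewrite mul0r addr0.
  apply: nsq_le => k; rewrite mul0r addr0 (energy_high _ hU); case: ifPn => mb.
    by rewrite mulr_ge0 ?expR_ge0 ?energy_ge0.
  rewrite energy_heatD//.
  by rewrite ler_wpM2r ?energy_ge0// Qk.
pose A := a0 * expR (a * Num.sqrt b).
have A1 : 1 <= A.
  by rewrite mulr_ege1// -expR0 ler_expR mulr_ge0// sqrtr_ge0.
have A0 : 0 < A by apply: lt_le_trans A1.
have i3 : nsq p <= A * wsq p.
  have := uc b0 (fun b' => low_mode_lowH b (u (th + t)) b').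
  rewrite -/p (wsqE hp) (sqnormE hp) -EFinM lee_fin -/A => h.
  by rewrite -(ler_pM2l (_ : 0 < A^-1)) ?invr_gt0// mulKf// gt_eqF.
have i4 := wsq_tri hU hp.
have B1 : 1 <= expR (2 * nu * T).
  by rewrite -expR0 ler_expR !mulr_ge0// ltW.
have F0 : 0 <= Q * nsq (u th) by rewrite mulr_ge0 ?expR_ge0 ?nsq_ge0.
apply: le_trans i1 _.
set Bt := expR (2 * nu * T) in B1 *.
have Bt0 : 0 < Bt by exact: expR_gt0.
have -> : Bt * (2 * a0 * expR (a * Num.sqrt b) * wsq (u (th + t)) +
     3 * a0 * expR (a * Num.sqrt b) * Q * nsq (u th)) =
   Bt * (A * (2 * wsq (u (th + t)) + 2 * (Q * nsq (u th)))) + Bt * A * (Q * nsq (u th)).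
  by rewrite /A; ring.
apply: lerD.
  rewrite ler_pM2l//; apply: le_trans i3 _; rewrite ler_pM2l//.
  by apply: le_trans i4 _; rewrite lerD2l ler_pM2l.
by rewrite ler_peMl// mulr_ege1.
Qed.

Lemma heat_tonelli : measurable_fun `[0, T] (fun t => wsq (u t)) /\
  sqnormT T Ws u = (\int[@lebesgue_measure R]_(t in [set` `[0%R, T]]) (wsq (u t))%:E)%E.
Proof.
have [[mr mi _] _ _ _] := hu.
pose P : set (measurableTypeR R * E) := [set` `[0, T]] `*` Ws.
have mP : measurable P by apply: measurableX => //; exact: measurable_itv.
have mTD : measurable ([set` `[0, T]] `*` D : set (measurableTypeR R * E)).
  by apply: measurableX; [exact: measurable_itv|exact: mD].
have subP : P `<=` [set` `[0, T]] `*` D by move=> [t x] [h1 h2]; split=> //; exact: WD.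
pose f (p : measurableTypeR R * E) : \bar R := (sqmod (u p.1 p.2))%:E.
have mf : measurable_fun P f.
  apply/measurable_EFinP; apply: measurable_funD; apply: measurable_funX.
    exact: (measurable_funS mTD subP mr).
  exact: (measurable_funS mTD subP mi).
have mfP : measurable_fun setT (f \_ P) by apply/(measurable_restrictT _ mP).
have fP0 p : (0 <= (f \_ P) p)%E.
  by rewrite patchE; case: ifP => // _; rewrite lee_fin addr_ge0 ?sqr_ge0.
pose g (t : measurableTypeR R) : \bar R := (\int[mu]_y (f \_ P) (t, y))%E.
have mg : measurable_fun setT g.
  by apply: (@measurable_fun_fubini_tonelli_F _ _ _ _ _ _ (f \_ P)).
have gE t : t \in `[0, T] -> g t = (wsq (u t))%:E.
  move=> tT; rewrite -(wsqE (heat_L2 hu tT)) /sqnorm [RHS]integral_mkcond /g.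
  apply: eq_integral => y _; rewrite !patchE; congr (if _ then _ else _).
  by apply/idP/idP; rewrite !inE; [case|move=> yW; split].
have g0 t : t \notin `[0, T] -> g t = 0%E.
  move=> tT; rewrite /g; apply: integral0_eq => y _; rewrite patchE ifF//.
  by apply/negP; rewrite inE => -[/= h _]; rewrite h in tT.
split.
  apply: (eq_measurable_fun (fun t => fine (g t))).
    by move=> t; rewrite inE => tT; rewrite gE.
  apply: measurable_funTS; apply: measurableT_comp => //; exact: mg.
rewrite /sqnormT -/P.
have -> : (\int[(lebesgue_measure \x lebesgue_rV n)%E]_(p in P) (sqmod (u p.1 p.2))%:E)%E =
   (\int[@lebesgue_measure R]_t g t)%E.
  rewrite integral_mkcond.
  by have := @fubini_tonelli1 _ _ _ _ _ (@lebesgue_measure R) (lebesgue_rV n) (f \_ P) mfP fP0.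
rewrite [RHS]integral_mkcond; apply: eq_integral => t _; rewrite patchE.
by case: ifPn; rewrite ?inE ?notin_setE => tT; [rewrite gE|rewrite g0//; apply/negP].
Qed.

Lemma heat_observability c : 0 < c ->
  6 * a0 * expR (2 * nu * T) * T <= 2 * (a + c) * c ->
  (sqnorm D (u T) <=
    (4 * a0 * expR (2 * nu * T) * expR (2 * a * (a + c) / T) * (2 * (a + c) / (c * T)))%:E *
      sqnormT T Ws u)%E.
Proof.
move=> c0 hT; have [mW ->] := heat_tonelli.
have TT : 0 <= T <= T by rewrite lexx ltW.
rewrite (sqnormE (heat_L2 hu TT)).
apply: (@observability_of_telescoping _ T a0 a c (expR (2 * nu * T)) (expR (2 * nu * T) * nsq (u 0))
   (fun t => nsq (u t)) (fun t => wsq (u t))) => //.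
- by rewrite -expR0 ler_expR !mulr_ge0// ltW.
- exact: heat_bound.
- by move=> t _; exact: wsq_ge0.
- exact: heat_estimate.
Qed.

End heat_observability.

(** * The cost and the choice of constants *)

Lemma ln2_le_ln (R : realType) (x : R) : 2 < x -> ln 2 <= ln x.
Proof. by move=> x2; rewrite ler_ln ?posrE ?ltW//; lra. Qed.

(** 2 (a + c)^2 = 2 a (a + c) + 2 c (a + c), and the second exponential absorbs the prefactor
    through x <= exp x and 1 / c <= c. *)
Lemma cost_bound (R : realType) (a0 B0 b0 a c T : R) : 0 <= a0 -> 0 <= B0 -> B0 <= b0 ->
  1 <= c -> 0 <= a -> 0 < T ->
  4 * a0 * B0 * expR (2 * a * (a + c) / T) * (2 * (a + c) / (c * T)) <=
  4 * a0 * b0 * expR (2 * (a + c) ^+ 2 / T).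
Proof.
move=> a00 B00 Bb c1 a_ge0 T0; have c0 : 0 < c by lra.
have s0 : 0 < a + c by lra.
have -> : 2 * (a + c) ^+ 2 / T = 2 * a * (a + c) / T + 2 * (a + c) * c / T.
  by field; rewrite gt_eqF.
move: (a + c) s0 => s s0; rewrite expRD.
have h : 2 * s / (c * T) <= expR (2 * s * c / T).
  apply: le_trans (_ : 2 * s * c / T <= _); last by have := expR_ge1Dx (2 * s * c / T); lra.
  rewrite -!mulrA ler_pM2l// ler_pM2l// invfM ler_pM2r ?invr_gt0//.
  by apply: (le_trans _ c1); rewrite invf_le1.
have h1 := expR_ge0 (2 * a * s / T); move: (expR (2 * a * s / T)) h1 => X X0.
move: (expR _) h => Y h.
have Z0 : 0 <= 2 * s / (c * T) by rewrite divr_ge0// mulr_ge0// ltW.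
rewrite -mulrA; apply: ler_pM; [by rewrite !mulr_ge0|exact: mulr_ge0| |exact: ler_wpM2l].
by apply: ler_wpM2l => //; exact: mulr_ge0.
Qed.

Theorem theorem2p13 (R : realType) (d : nat) (hd : (0 < d)%N) (N : R)
    (hN : unique_continuation_constant d N)
    (G delta KV : R) (hG : 0 < G) (hdelta : 0 < delta < G / 2) (hKV : 0 <= KV) :
  exists2 T' : R, 0 < T' &
    forall T : R, 0 < T <= T' ->
    forall z : 'rV[int]_d -> 'rV[R]_d, equidistributed G delta z ->
    forall V : 'rV[R]_d -> R, bounded_measurable V -> norm_oo V <= KV ->
    forall n : nat, (0 < n)%N ->
    let L := G * n%:R in
    let a0 := (delta / G) `^ (- (N * (1 + G `^ (4 / 3) * norm_oo V `^ (2 / 3)))) in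
    let b0 := expR (2 * norm_oo V) in
    exists kappa cstar : R,
      [/\ final_state_observable (cube L) V (sensor_set delta z L) T kappa,
          kappa <= 4 * a0 * b0 * expR (2 * cstar / T) &
          cstar <= ln (G / delta) ^+ 2 * (N * G + 4 / ln 2) ^+ 2].
Proof.
have N0 : 0 <= N := uc_constant_ge0 hN.
have [d0 dG] := andP hdelta.
have Gd2 : 2 < G / delta by rewrite ltr_pdivlMr//; lra.
pose q := ln (G / delta).
have l20 : 0 < ln 2 :> R by apply: ln_gt0; lra.
have ql2 : ln 2 <= q by exact: ln2_le_ln.
have q0 : 0 < q by exact: lt_le_trans ql2.
have lnE : ln (delta / G) = - q.
  by rewrite /q -lnV ?posrE ?divr_gt0// invf_div.
have powE x : (delta / G) `^ x = expR (- (q * x)).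
  by rewrite /powR gt_eqF ?divr_gt0// lnE mulrN mulrC.
pose a := N * G * q; pose c := 4 * q / ln 2; pose s := a + c.
have a_ge0 : 0 <= a by rewrite !mulr_ge0// ltW.
have c4 : 4 <= c by rewrite /c -mulrA ler_peMr// ler_pdivlMr// mul1r.
have c0 : 0 < c by lra.
have s0 : 0 < s by rewrite /s; lra.
pose A0 v := (delta / G) `^ (- (N * (1 + G `^ (4 / 3) * v `^ (2 / 3)))).
have A0E v : A0 v = expR (q * (N * (1 + G `^ (4 / 3) * v `^ (2 / 3)))).
  by rewrite /A0 powE mulrN opprK.
have A0_gt0 v : 0 < A0 v by rewrite A0E expR_gt0.
(* The smallness condition of the telescoping at the worst norm KV, so that T' does not depend on
   V. *)
pose T1 := 2 * s * c / (6 * A0 KV * expR (2 * KV)).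
have K0 : 0 < 6 * A0 KV * expR (2 * KV).
  by apply: mulr_gt0 (expR_gt0 _); apply: mulr_gt0 (A0_gt0 _).
have T10 : 0 < T1 by apply: divr_gt0 K0; apply: mulr_gt0 c0; apply: mulr_gt0 s0.
(* The bound T <= 1 serves for [B0 <= b0]. *)
exists (Num.min 1 T1); first by rewrite lt_min ltr01.
move=> T /andP[T0]; rewrite le_min => /andP[TT1 TT] z hz V bmV VK n n0 L a0 b0.
have nu0 := norm_oo_ge0 V; have nuV := norm_oo_ae bmV.
have [mV [B bV]] := bmV.
have L0 : 0 < L / 2 by rewrite divr_gt0// mulr_gt0// ltr0n.
have a01 : 1 <= a0.
  rewrite /a0 -/(A0 _) A0E -expR0 ler_expR !mulr_ge0 ?(ltW q0)//.
  by rewrite addr_ge0// mulr_ge0 ?powR_ge0.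
have a0K : a0 <= A0 KV.
  rewrite /a0 -/(A0 _) !A0E ler_expR ler_pM2l// ler_wpM2l// lerD2l ler_wpM2l ?powR_ge0//.
  by apply: ge0_ler_powR; rewrite ?nnegrE.
pose B0 := expR (2 * norm_oo V * T).
have B0b : B0 <= b0.
  by rewrite ler_expR ler_piMr// mulr_ge0.
have b0K : b0 <= expR (2 * KV) by rewrite ler_expR ler_pM2l.
have [e [lam eb]] := box_spectral L0 mV bV nu0 nuV.
(* [kappa] is the cost produced by the telescoping, and s^2 equals the bound required of [cstar]. *)
exists (4 * a0 * B0 * expR (2 * a * s / T) * (2 * s / (c * T))), (s ^+ 2); split.
- move=> u0 u hu0 hu.
  apply: (@heat_observability R d (L / 2) L0 V mV B bV (norm_oo V) nu0 nuV e lam eb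
    (sensor_set delta z L) _ _ a0 a a01 a_ge0 _ T T0 u0 u hu c c0).
  + exact: measurable_sensor_set.
  + by move=> x [].
  + move=> b h b_ge0 hb.
    have := scaled_uc hN hG hdelta hz bmV n0 b_ge0 hb.
    suff -> : (delta / G) `^ (N * (1 + G `^ (4 / 3) * norm_oo V `^ (2 / 3) + G * Num.sqrt b)) =
      (a0 * expR (a * Num.sqrt b))^-1 by [].
    rewrite powE /a0 -/(A0 _) A0E -expRD -expRN; congr expR; rewrite /a; ring.
  + apply: le_trans (_ : 6 * A0 KV * expR (2 * KV) * T <= _).
      rewrite ler_wpM2r ?(ltW T0)//; apply: ler_pM.
      * exact: mulr_ge0 (ler0n _ 6) (le_trans ler01 a01).
      * exact: expR_ge0.
      * by rewrite ler_pM2l.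
      * exact: le_trans B0b b0K.
    by move: TT; rewrite /T1 (ler_pdivlMr _ _ K0) mulrC.
- have c1 : 1 <= c by lra.
  exact: (cost_bound (le_trans ler01 a01) (expR_ge0 _) B0b c1 a_ge0 T0).
- rewrite le_eqVlt; apply/orP; left; apply/eqP; rewrite -/q /s /a /c.
  by field; rewrite gt_eqF.
Qed.
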